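(* Let $A$ be a formal cdga and $V$ a dg vector space. (1) Let $V$ be given an $A$-linear $L_\infty$ algebra structure and let $\xi\in \mathrm{MC}(V,A)$. Then $V$ has the structure of an $A$-linear $\mathscr L_\infty$ algebra. Conversely, an $A$-linear $\mathscr L_\infty$ algebra structure on $V$ gives rise to an $A$-linear $L_\infty$ algebra structure on $V$ together with a choice of an element of $\mathrm{MC}(V,A)$. (2) Let $V$ be given an $A$-linear $A_\infty$ algebra structure and let $\xi\in \mathrm{MC}(V,A)$. Then $V$ has the structure of an $A$-linear $\mathscr A_\infty$ algebra. Conversely, an $A$-linear $\mathscr A_\infty$ algebra structure on $V$ gives rise to an $A$-linear $A_\infty$ algebra structure on $V$ together with a choice of an element of $\mathrm{MC}(V,A)$. In both cases the correspondence is the natural one: the $L_\infty$ (respectively $A_\infty$) structure is the restriction of the operad map along $L_\infty\subset\mathscr L_\infty$ (respectively $A_\infty\subset\mathscr A_\infty$), and the MC element is the image of the generator $x$.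
   Context: $\mathbf k$ is a field of characteristic $0$; all vector spaces are $\mathbb Z/2$-graded, dg means differential $\mathbb Z/2$-graded, $\Pi$ is parity reversion, and the Koszul sign rule is used. Operads are non-unital: collections $\mathcal O(n)$, $n\ge 0$, with $S_n$-actions and partial compositions $\circ_i$; without $S_n$-actions one speaks of non-symmetric operads. For a dg vector space $W$, $\mathcal E(W)$ is the endomorphism operad, $\mathcal E(W)(n)=\mathrm{Hom}(W^{\otimes n},W)$. For $f\in\mathcal O(n)$ and $g_1,\dots,g_i$ with $i\le n$, $f\circ(g_1\otimes\dots\otimes g_i)$ denotes inserting $g_1,\dots,g_i$ in the first $i$ inputs of $f$. $A_\infty$ is the non-symmetric dg operad freely generated by odd $m_n\in A_\infty(n)$, $n\ge1$, with $d(m_n)=\sum_{k=1}^n\sum_{i=1}^k m_k\circ_i m_{n-k+1}$. $L_\infty$ is the dg operad freely generated by odd $S_n$-invariant elements $m_n\in L_\infty(n)$, $n\ge 1$, with $d(m_n)=\sum_{k=1}^n\sum_{\sigma\in \mathrm{Sh}(n-k+1,k-1)}\sigma(m_k\circ_1 m_{n-k+1})$. (Note $m_1$ is included.) For an operad $\mathcal O$, $\mathcal O[x]$ is the operad obtained by freely adjoining $x$, and $\mathcal O[[x]]=\varprojlim_k \mathcal O[x]/(x^k)$ is its completion at the operadic ideal $(x)$, a topological operad. $\mathscr L_\infty=L_\infty[[x]]$ with $x\in\mathscr L_\infty(0)$ even, $L_\infty\subset\mathscr L_\infty$ a dg suboperad and $d(x)=\sum_{n\ge1}\frac1{n!}m_n\circ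 x^{\otimes n}$. $\mathscr A_\infty=A_\infty[[x]]$ (non-symmetric) with $x\in \mathscr A_\infty(0)$ even, $A_\infty\subset\mathscr A_\infty$ a dg suboperad and $d(x)=\sum_{n\ge1}m_n\circ x^{\otimes n}$. A formal cdga $A$ is obtained by adjoining a unit to an inverse limit $A_+$ of finite-dimensional nilpotent non-unital commutative dg algebras; $A_+\otimes W$ denotes the completed tensor product $\varprojlim (A_+)_i\otimes W$. For a (possibly topological) dg operad $\mathcal O$, an $A$-linear $\mathcal O$ algebra structure on $V$ is a continuous map of dg operads $f:\mathcal O\to A_+\otimes\mathcal E(\Pi V)$. For $\mathcal O=L_\infty$ or $A_\infty$ its structure maps are $\mu_n:=-f(m_n):(\Pi V)^{\otimes n}\to A_+\otimes \Pi V$. $\mathrm{MC}(V,A)$ is the set of even $\xi\in A_+\otimes\Pi V$ such that, with $d=d_A\otimes\mathrm{id}+\mathrm{id}\otimes d_{\Pi V}$ and the $\mu_i$ extended $A$-multilinearly, $d(\xi)+\sum_{i\ge1}\frac1{i!}\mu_i(\xi^{\otimes i})=0$ in the $L_\infty$ case, and $d(\xi)+\sum_{i\ge1}\mu_i(\xi^{\otimes i})=0$ in the $A_\infty$ case. *)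

(* Defs.v *)
From HB Require Import structures.
From mathcomp Require Import all_boot all_order all_algebra all_fingroup.
From mathcomp Require Import generic_quotient.
From mathcomp Require Import boolp classical_sets functions.

Set Implicit Arguments.
Unset Strict Implicit.
Unset Printing Implicit Defensive.

Import GRing.Theory.
Local Open Scope ring_scope.

(* Parities are booleans (false = even, true = odd) and [part p] is the
   projection onto the component of parity p.  Structures come in two layers:
   records of linear operations ([dgmod], [preoperad]), which suffice to say what
   a morphism is, and predicates ([isDg], [isOperad]) stating the axioms. *)

Section Graded.
Variable k : fieldType.

Record dgmod := DgMod {
  dgcar :> lmodType k;
  part : bool -> {linear dgcar -> dgcar};
  diff : {linear dgcar -> dgcar} }.

Record isDg (V : dgmod) : Prop := IsDg {
  dg_partK : forall p q (v : V), part V p (part V q v) = if p == q then part V q v else 0;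
  dg_part_sum : forall v : V, part V false v + part V true v = v;
  dg_odd : forall p (v : V), diff V (part V p v) = part V (~~ p) (diff V v);
  dg_sq0 : forall v : V, diff V (diff V v) = 0 }.

Record dgvect := DgVect { dgvect_mod :> dgmod; dgvectP : isDg dgvect_mod }.

(* sgn v = (-1)^|v| v, and koszul q v = (-1)^(q|v|) v *)
Definition sgn (V : dgmod) (v : V) : V := part V false v - part V true v.
Definition koszul (V : dgmod) (q : bool) (v : V) : V := if q then sgn v else v.

Lemma sgn_linear (V : dgmod) : linear (@sgn V).
Proof.
by move=> a u v; rewrite /sgn (linearP (part V false)) (linearP (part V true)) scalerBr opprD addrACA.
Qed.
HB.instance Definition _ (V : dgmod) :=
  GRing.isLinear.Build k V V *:%R (@sgn V) (@sgn_linear V).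

Lemma koszul_linear (V : dgmod) q : linear (@koszul V q).
Proof. by case: q => //=; apply: sgn_linear. Qed.
HB.instance Definition _ (V : dgmod) q :=
  GRing.isLinear.Build k V V *:%R (@koszul V q) (@koszul_linear V q).

Record dgmor (V W : dgmod) := DgMor {
  dgmor_fun :> {linear V -> W};
  dgmor_part : forall p (v : V), dgmor_fun (part V p v) = part W p (dgmor_fun v);
  dgmor_diff : forall v : V, dgmor_fun (diff V v) = diff W (dgmor_fun v) }.

(* Parity reversion; Pi is odd, whence d (Pi v) = - Pi (d v). *)
Definition pi_diff (V : dgmod) (v : V) : V := - diff V v.
Lemma pi_diff_linear (V : dgmod) : linear (@pi_diff V).
Proof. by move=> a u v; rewrite /pi_diff linearP opprD scalerN. Qed.
HB.instance Definition _ (V : dgmod) :=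
  GRing.isLinear.Build k V V *:%R (@pi_diff V) (@pi_diff_linear V).
Definition Pi (V : dgmod) : dgmod :=
  @DgMod V (fun p => part V (~~ p)) (@pi_diff V).

End Graded.

(* sym = true: symmetric operads; sym = false: non-symmetric ones (the field
   [act] is then void).  'S_n acts on the left; in endomorphism operads
   (s f)(x_1, ..., x_n) = +- f(x_{s 1}, ..., x_{s n}).  There is no unit. *)

Section Operads.
Variables (k : fieldType) (sym : bool).

Record preoperad := PreOperad {
  op :> nat -> dgmod k;
  circ : forall n m, 'I_n -> op n -> op m -> op (n + m).-1;
  act : forall n, sym -> 'S_n -> op n -> op n;
  circ_linearl : forall n m (i : 'I_n) (b : op m),
    linear (fun a : op n => circ i a b);
  circ_linearr : forall n m (i : 'I_n) (a : op n), linear (@circ n m i a);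
  act_linear : forall n (h : sym) (s : 'S_n), linear (@act n h s) }.

Definition castop (P : preoperad) n m (e : n = m) (a : P n) : P m :=
  ecast x (P x) e a.

(* The slot of f o_l g (g of arity m) that comes from the slot j <> l of f. *)
Definition outer (m l j : nat) : nat := if (j < l)%N then j else (j + m).-1.

Record isOperad (P : preoperad) : Prop := IsOperad {
  op_dg : forall n, isDg (P n);
  circ_part : forall n m (i : 'I_n) (a : P n) (b : P m) p q,
    part _ (p (+) q) (circ i (part _ p a) (part _ q b))
    = circ i (part _ p a) (part _ q b);
  circ_diff : forall n m (i : 'I_n) (a : P n) (b : P m),
    diff _ (circ i a b) = circ i (diff _ a) b + circ i (sgn a) (diff _ b);
  circ_seq : forall n m p (i : 'I_n) (j : 'I_m) (l : 'I_(n + m).-1)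
      (a : P n) (b : P m) (c : P p) e,
    l = (i + j)%N :> nat ->
    castop e (circ l (circ i a b) c) = circ i a (circ j b c);
  circ_par : forall n m p (i j : 'I_n) (j' : 'I_(n + m).-1)
      (i' : 'I_(n + p).-1) (a : P n) (b : P m) (c : P p) u v e,
    (i < j)%N -> j' = (j + m).-1 :> nat -> i' = i :> nat ->
    castop e (circ j' (circ i a (part _ u b)) (part _ v c))
    = (-1) ^+ (u && v) *: circ i' (circ j a (part _ v c)) (part _ u b);
  act1 : forall n h (a : P n), act h 1%g a = a;
  (* in MathComp (s * t)%g is "first s, then t" *)
  actM : forall n h (s t : 'S_n) (a : P n), act h (s * t)%g a = act h t (act h s a);
  act_part : forall n h (s : 'S_n) p (a : P n),
    act h s (part _ p a) = part _ p (act h s a);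
  act_diff : forall n h (s : 'S_n) (a : P n),
    act h s (diff _ a) = diff _ (act h s a);
  (* r below is the block permutation s o_l t *)
  circ_act : forall n m h (s : 'S_n) (t : 'S_m) (l : 'I_n)
      (r : 'S_(n + m).-1) (a : P n) (b : P m),
    (forall (j : 'I_n) (x : 'I_(n + m).-1), j != l -> x = outer m l j :> nat ->
       r x = outer m (s l) (s j) :> nat) ->
    (forall (j : 'I_m) (x : 'I_(n + m).-1), x = (l + j)%N :> nat ->
       r x = (s l + t j)%N :> nat) ->
    circ (s l) (act h s a) (act h t b) = act h r (circ l a b) }.

Record opmor (P Q : preoperad) := OpMor {
  opmor_fun :> forall n, dgmor (P n) (Q n);
  opmor_circ : forall n m (i : 'I_n) (a : P n) (b : P m),
    opmor_fun _ (circ i a b) = circ i (opmor_fun _ a) (opmor_fun _ b);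
  opmor_act : forall n h (s : 'S_n) (a : P n),
    opmor_fun _ (act h s a) = act h s (opmor_fun _ a) }.

(* Linear topologies, given by a fundamental system of submodules *)
Record topOperad := TopOperad {
  top_operad :> preoperad;
  nbh_index : Type;
  nbh : nbh_index -> forall n, top_operad n -> Prop }.

Definition discrete (P : preoperad) : topOperad :=
  @TopOperad P unit (fun _ n a => a = 0).

Record topOpmor (P Q : topOperad) := TopOpMor {
  top_opmor :> opmor P Q;
  top_opmor_continuous : forall n (j : nbh_index Q), exists i : nbh_index P,
    forall a : P n, nbh i a -> nbh j (top_opmor n a) }.

Lemma fill_arity n : (n.+1 + 0).-1 = n. Proof. exact: addn0. Qed.

(* f o (x (x) ... (x) x) for x of arity 0: fill the first slot n times. *)
Fixpoint fill (P : preoperad) n : P n -> P 0%N -> P 0%N :=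
  match n with
  | 0 => fun a _ => a
  | n'.+1 => fun a x => @fill P n' (castop (fill_arity n') (circ ord0 a x)) x
  end.

(* [xpow x j]: the j-th power of the operadic ideal generated by x *)
Inductive xpow (P : preoperad) (x : P 0%N) : nat -> forall n, P n -> Prop :=
| xpow_gen : xpow x 1 x
| xpow_all n (a : P n) : xpow x 0 a
| xpow_le j n (a : P n) : xpow x j.+1 a -> xpow x j a
| xpow_0 j n : xpow x j (0 : P n)
| xpow_lin j n c (a b : P n) : xpow x j a -> xpow x j b -> xpow x j (c *: a + b)
| xpow_circ j l n m (i : 'I_n) (a : P n) (b : P m) :
    xpow x j a -> xpow x l b -> xpow x (j + l) (circ i a b)
| xpow_act j n h (s : 'S_n) (a : P n) : xpow x j a -> xpow x j (act h s a).

(* [pres G Phi] is the dg operad freely generated by G subject to Phi, where Phi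
   is a condition on families of elements, indexed by G, of an arbitrary dg
   operad: the terms in G modulo the equations that hold for every family
   satisfying Phi in every dg operad.  It is a dg operad ([pres_isOperad]), and
   each such family extends uniquely to a morphism ([pres_mor],
   [pres_mor_unique]). *)

Inductive term (G : nat -> Type) : nat -> Type :=
| Tgen n : G n -> term G n
| Tzero n : term G n
| Tadd n : term G n -> term G n -> term G n
| Tscale n : k -> term G n -> term G n
| Tpart n : bool -> term G n -> term G n
| Tdiff n : term G n -> term G n
| Tcirc n m : 'I_n -> term G n -> term G m -> term G (n + m).-1
| Tact n : sym -> 'S_n -> term G n -> term G n.

HB.instance Definition _ G n := gen_eqMixin (term G n).
HB.instance Definition _ G n := gen_choiceMixin (term G n).

Fixpoint eval G (P : preoperad) (g : forall n, G n -> P n) n (t : term G n) : P n :=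
  match t in term _ n return P n with
  | Tgen n x => g n x
  | Tzero n => 0
  | Tadd n s t => eval g s + eval g t
  | Tscale n c t => c *: eval g t
  | Tpart n p t => part _ p (eval g t)
  | Tdiff n t => diff _ (eval g t)
  | Tcirc n m i s t => circ i (eval g s) (eval g t)
  | Tact n h s t => act h s (eval g t)
  end.

Section Presentation.
Variables (G : nat -> Type) (Phi : forall P : preoperad, (forall n, G n -> P n) -> Prop).

Definition provable n (s t : term G n) : Prop :=
  forall (P : preoperad) (g : forall n, G n -> P n),
    isOperad P -> Phi g -> eval g s = eval g t.

Definition term_eq n : rel (term G n) := fun s t => `[< provable s t >].

Lemma term_eq_refl n : reflexive (@term_eq n).
Proof. by move=> t; apply/asboolP. Qed.
Lemma term_eq_sym n : symmetric (@term_eq n).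
Proof. by move=> s t; apply/asbool_equiv_eq; split=> h P g oP Pg; rewrite h. Qed.
Lemma term_eq_trans n : transitive (@term_eq n).
Proof.
move=> t s u /asboolP st /asboolP tu; apply/asboolP => P g oP Pg.
by rewrite st // tu.
Qed.
Canonical term_equiv n :=
  EquivRel (@term_eq n) (@term_eq_refl n) (@term_eq_sym n) (@term_eq_trans n).

Definition pres_car n := {eq_quot term_equiv n}%qT.
HB.instance Definition _ n := Choice.on (pres_car n).
HB.instance Definition _ n := EqQuotient.on (pres_car n).

Definition cls n (t : term G n) : pres_car n := \pi_(pres_car n)%qT t.
Definition rep n (x : pres_car n) : term G n := repr x.

Definition pres_eval (P : preoperad) (g : forall n, G n -> P n) n (x : pres_car n) : P n :=
  eval g (rep x).

Lemma pres_eval_cls (P : preoperad) (g : forall n, G n -> P n) n (t : term G n) :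
  isOperad P -> Phi g -> pres_eval g (cls t) = eval g t.
Proof.
move=> oP Pg; rewrite /pres_eval /rep.
have /eqmodP/asboolP : repr (cls t) = t %[mod pres_car n]%qT by rewrite reprK.
exact.
Qed.

Lemma pres_ext n (x y : pres_car n) :
  (forall (P : preoperad) (g : forall n, G n -> P n), isOperad P -> Phi g ->
     pres_eval g x = pres_eval g y) -> x = y.
Proof.
move=> h; rewrite -[x]reprK -[y]reprK; apply/eqmodP/asboolP => P g oP Pg.
exact: h.
Qed.

Definition pzero n : pres_car n := cls (Tzero G n).
Definition padd n (x y : pres_car n) := cls (Tadd (rep x) (rep y)).
Definition popp n (x : pres_car n) := cls (Tscale (-1) (rep x)).
Definition pscale n (c : k) (x : pres_car n) := cls (Tscale c (rep x)).
Definition ppart n p (x : pres_car n) := cls (Tpart p (rep x)).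
Definition pdiff n (x : pres_car n) := cls (Tdiff (rep x)).
Definition pcirc n m (i : 'I_n) (x : pres_car n) (y : pres_car m) :=
  cls (Tcirc i (rep x) (rep y)).
Definition pact n (h : sym) (s : 'S_n) (x : pres_car n) := cls (Tact h s (rep x)).

Section PresEval.
Variables (P : preoperad) (g : forall n, G n -> P n).
Hypotheses (oP : isOperad P) (Pg : Phi g).
Lemma ev_zero n : pres_eval g (pzero n) = 0.
Proof. by rewrite pres_eval_cls. Qed.
Lemma ev_add n (x y : pres_car n) : pres_eval g (padd x y) = pres_eval g x + pres_eval g y.
Proof. by rewrite pres_eval_cls. Qed.
Lemma ev_opp n (x : pres_car n) : pres_eval g (popp x) = - pres_eval g x.
Proof. by rewrite pres_eval_cls //= scaleN1r. Qed.
Lemma ev_scale n c (x : pres_car n) : pres_eval g (pscale c x) = c *: pres_eval g x.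
Proof. by rewrite pres_eval_cls. Qed.
Lemma ev_part n p (x : pres_car n) : pres_eval g (ppart p x) = part _ p (pres_eval g x).
Proof. by rewrite pres_eval_cls. Qed.
Lemma ev_diff n (x : pres_car n) : pres_eval g (pdiff x) = diff _ (pres_eval g x).
Proof. by rewrite pres_eval_cls. Qed.
Lemma ev_circ n m (i : 'I_n) (x : pres_car n) (y : pres_car m) :
  pres_eval g (pcirc i x y) = circ i (pres_eval g x) (pres_eval g y).
Proof. by rewrite pres_eval_cls. Qed.
Lemma ev_act n (h : sym) (s : 'S_n) (x : pres_car n) :
  pres_eval g (pact h s x) = act h s (pres_eval g x).
Proof. by rewrite pres_eval_cls. Qed.
End PresEval.

Let evE := (ev_zero, ev_add, ev_opp, ev_scale).

Lemma paddA n : associative (@padd n).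
Proof. by move=> x y z; apply: pres_ext => P g oP Pg; rewrite !evE // addrA. Qed.
Lemma paddC n : commutative (@padd n).
Proof. by move=> x y; apply: pres_ext => P g oP Pg; rewrite !evE // addrC. Qed.
Lemma padd0 n : left_id (@pzero n) (@padd n).
Proof. by move=> x; apply: pres_ext => P g oP Pg; rewrite !evE // add0r. Qed.
Lemma paddN n : left_inverse (@pzero n) (@popp n) (@padd n).
Proof. by move=> x; apply: pres_ext => P g oP Pg; rewrite !evE // addNr. Qed.
HB.instance Definition _ n :=
  GRing.isZmodule.Build (pres_car n) (@paddA n) (@paddC n) (@padd0 n) (@paddN n).

Lemma pscaleA n a b (x : pres_car n) : pscale a (pscale b x) = pscale (a * b) x.
Proof. by apply: pres_ext => P g oP Pg; rewrite !evE // scalerA. Qed.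
Lemma pscale1 n : left_id 1 (@pscale n).
Proof. by move=> x; apply: pres_ext => P g oP Pg; rewrite !evE // scale1r. Qed.
Lemma pscaleDr n : right_distributive (@pscale n) +%R.
Proof. by move=> a x y; apply: pres_ext => P g oP Pg; rewrite !evE // scalerDr. Qed.
Lemma pscaleDl n (x : pres_car n) : {morph (@pscale n)^~ x : a b / a + b}.
Proof. by move=> a b; apply: pres_ext => P g oP Pg; rewrite !evE // scalerDl. Qed.
HB.instance Definition _ n :=
  GRing.Zmodule_isLmodule.Build k (pres_car n)
    (@pscaleA n) (@pscale1 n) (@pscaleDr n) (@pscaleDl n).

Lemma ev_lin (P : preoperad) (g : forall n, G n -> P n) n a (x y : pres_car n) :
  isOperad P -> Phi g ->
  pres_eval g (a *: x + y) = a *: pres_eval g x + pres_eval g y.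
Proof. by move=> oP Pg; rewrite ev_add // ev_scale. Qed.

Lemma ppart_linear n p : linear (@ppart n p).
Proof.
by move=> a x y; apply: pres_ext => P g oP Pg;
   rewrite ev_lin // !ev_part // ev_lin // linearP.
Qed.
Lemma pdiff_linear n : linear (@pdiff n).
Proof.
by move=> a x y; apply: pres_ext => P g oP Pg;
   rewrite ev_lin // !ev_diff // ev_lin // linearP.
Qed.
HB.instance Definition _ n p :=
  GRing.isLinear.Build k (pres_car n) (pres_car n) *:%R (@ppart n p) (@ppart_linear n p).
HB.instance Definition _ n :=
  GRing.isLinear.Build k (pres_car n) (pres_car n) *:%R (@pdiff n) (@pdiff_linear n).

Lemma pcirc_linearl n m (i : 'I_n) (y : pres_car m) : linear (fun x => pcirc i x y).
Proof.
by move=> a x z; apply: pres_ext => P g oP Pg;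
   rewrite ev_lin // !ev_circ // ev_lin // circ_linearl.
Qed.
Lemma pcirc_linearr n m (i : 'I_n) (x : pres_car n) : linear (@pcirc n m i x).
Proof.
by move=> a y z; apply: pres_ext => P g oP Pg;
   rewrite ev_lin // !ev_circ // ev_lin // circ_linearr.
Qed.
Lemma pact_linear n (h : sym) (s : 'S_n) : linear (pact h s).
Proof.
by move=> a x y; apply: pres_ext => P g oP Pg;
   rewrite ev_lin // !ev_act // ev_lin // act_linear.
Qed.

Definition pres : preoperad :=
  @PreOperad (fun n => @DgMod k (pres_car n) (@ppart n) (@pdiff n))
    pcirc pact pcirc_linearl pcirc_linearr pact_linear.

Lemma pres_isOperad : isOperad pres.
Proof.
have evS (P : preoperad) (g : forall n, G n -> P n) n (x : pres n) :
    isOperad P -> Phi g -> pres_eval g (sgn x) = sgn (pres_eval g x).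
  move=> oP Pg; rewrite /sgn -scaleN1r addrC ev_lin // !ev_part //.
  by rewrite scaleN1r addrC.
have evC (P : preoperad) (g : forall n, G n -> P n) n m (e : n = m) (x : pres n) :
    pres_eval g (castop e x) = castop e (pres_eval g x) by case: m / e.
split=> /=.
- move=> n; split=> /= [p q x|x|p x|x]; apply: pres_ext => P g oP Pg;
    have [partK part_sum odd sq0] := op_dg oP n.
  + rewrite !ev_part // partK; case: eqP => _; rewrite ?ev_part //.
    by rewrite [RHS]ev_zero.
  + by rewrite [LHS]ev_add // !ev_part.
  + by rewrite ev_part // !ev_diff // ev_part.
  + by rewrite !ev_diff // [RHS]ev_zero.
- move=> n m i a b p q; apply: pres_ext => P g oP Pg.
  by rewrite !(ev_part, ev_circ) // circ_part.
- move=> n m i a b; apply: pres_ext => P g oP Pg.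
  by rewrite [RHS]ev_add // !(ev_diff, ev_circ, evS) // circ_diff.
- move=> n m p i j l a b c e el; apply: pres_ext => P g oP Pg.
  by rewrite evC !ev_circ //; apply: circ_seq.
- move=> n m p i j j' i' a b c u v e ij ej ei; apply: pres_ext => P g oP Pg.
  rewrite evC [RHS]ev_scale // !(ev_circ, ev_part) //.
  exact: circ_par.
- by move=> n h a; apply: pres_ext => P g oP Pg; rewrite ev_act // act1.
- by move=> n h s t a; apply: pres_ext => P g oP Pg; rewrite !ev_act // actM.
- move=> n h s p a; apply: pres_ext => P g oP Pg.
  by rewrite !(ev_act, ev_part) // act_part.
- move=> n h s a; apply: pres_ext => P g oP Pg.
  by rewrite !(ev_act, ev_diff) // act_diff.
- move=> n m h s t l r a b r1 r2; apply: pres_ext => P g oP Pg.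
  by rewrite !(ev_act, ev_circ) //; apply: circ_act.
Qed.

Definition pgen n (x : G n) : pres n := cls (Tgen x).

Section Universal.
Variables (P : preoperad) (g : forall n, G n -> P n).
Hypotheses (oP : isOperad P) (Pg : Phi g).

Definition pres_ev n (x : pres n) : P n := pres_eval g x.
Lemma pres_ev_linear n : linear (@pres_ev n).
Proof. by move=> a x y; apply: ev_lin. Qed.
HB.instance Definition _ n :=
  GRing.isLinear.Build k (pres n) (P n) *:%R (@pres_ev n) (@pres_ev_linear n).
Lemma pres_ev_part n p (x : pres n) : pres_ev (part _ p x) = part _ p (pres_ev x).
Proof. exact: ev_part. Qed.
Lemma pres_ev_diff n (x : pres n) : pres_ev (diff _ x) = diff _ (pres_ev x).
Proof. exact: ev_diff. Qed.
Lemma pres_ev_circ n m (i : 'I_n) (x : pres n) (y : pres m) :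
  pres_ev (circ i x y) = circ i (pres_ev x) (pres_ev y).
Proof. exact: ev_circ. Qed.
Lemma pres_ev_act n h (s : 'S_n) (x : pres n) : pres_ev (act h s x) = act h s (pres_ev x).
Proof. exact: ev_act. Qed.

Definition pres_mor : opmor pres P :=
  @OpMor pres P
    (fun n => @DgMor k (pres n) (P n) (@pres_ev n) (@pres_ev_part n) (@pres_ev_diff n))
    pres_ev_circ pres_ev_act.

Lemma pres_mor_gen n (x : G n) : pres_mor n (pgen x) = g x.
Proof. exact: pres_eval_cls. Qed.

Lemma pres_mor_unique (f : opmor pres P) :
  (forall n (x : G n), f n (pgen x) = g x) -> forall n (x : pres n), f n x = pres_mor n x.
Proof.
move=> fg; suff E n (t : term G n) : f n (cls t) = eval g t.
  by move=> n x; rewrite -[x]reprK; rewrite [LHS]E [RHS]pres_eval_cls.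
elim: t => {n} [n x|n|n s IHs t IHt|n c t IH|n p t IH|n t IH|n m i s IHs t IHt|n h s t IH] /=.
- exact: fg.
- have -> : cls (Tzero G n) = 0 :> pres n by [].
  exact: linear0.
- have -> : cls (Tadd s t) = cls s + cls t :> pres n.
    by apply: pres_ext => Q q oQ Qq; rewrite [RHS]ev_add // !pres_eval_cls.
  by rewrite linearD IHs IHt.
- have -> : cls (Tscale c t) = c *: cls t :> pres n.
    by apply: pres_ext => Q q oQ Qq; rewrite [RHS]ev_scale // !pres_eval_cls.
  by rewrite linearZ IH.
- have -> : cls (Tpart p t) = part (pres n) p (cls t).
    by apply: pres_ext => Q q oQ Qq; rewrite ev_part // !pres_eval_cls.
  by rewrite dgmor_part IH.
- have -> : cls (Tdiff t) = diff (pres n) (cls t).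
    by apply: pres_ext => Q q oQ Qq; rewrite ev_diff // !pres_eval_cls.
  by rewrite dgmor_diff IH.
- have -> : cls (Tcirc i s t) = circ i (cls s : pres n) (cls t : pres m).
    by apply: pres_ext => Q q oQ Qq; rewrite ev_circ // !pres_eval_cls.
  by rewrite (opmor_circ f) IHs IHt.
- have -> : cls (Tact h s t) = act h s (cls t : pres n).
    by apply: pres_ext => Q q oQ Qq; rewrite ev_act // !pres_eval_cls.
  by rewrite (opmor_act f) IH.
Qed.
End Universal.

End Presentation.

Section PresentationMap.
Variables (G : nat -> Type) (Phi Psi : forall P : preoperad, (forall n, G n -> P n) -> Prop).
Hypothesis PsiPhi : forall (P : preoperad) (g : forall n, G n -> P n), Psi g -> Phi g.

Definition pmap n (x : pres Phi n) : pres Psi n := cls Psi (rep x).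

Lemma pmap_eval (P : preoperad) (g : forall n, G n -> P n) n (x : pres Phi n) :
  isOperad P -> Psi g -> pres_eval g (pmap x) = pres_eval g x.
Proof. by move=> oP Pg; rewrite pres_eval_cls. Qed.

Lemma pmap_linear n : linear (@pmap n).
Proof.
move=> a x y; apply: pres_ext => P g oP Pg; have Pg' := PsiPhi Pg.
by rewrite ev_lin // !pmap_eval // ev_lin.
Qed.
HB.instance Definition _ n :=
  GRing.isLinear.Build k (pres Phi n) (pres Psi n) *:%R (@pmap n) (@pmap_linear n).

Lemma pmap_part n p (x : pres Phi n) : pmap (part _ p x) = part _ p (pmap x).
Proof.
apply: pres_ext => P g oP Pg; have Pg' := PsiPhi Pg.
by rewrite pmap_eval // !ev_part // pmap_eval.
Qed.
Lemma pmap_diff n (x : pres Phi n) : pmap (diff _ x) = diff _ (pmap x).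
Proof.
apply: pres_ext => P g oP Pg; have Pg' := PsiPhi Pg.
by rewrite pmap_eval // !ev_diff // pmap_eval.
Qed.
Lemma pmap_circ n m (i : 'I_n) (x : pres Phi n) (y : pres Phi m) :
  pmap (circ i x y) = circ i (pmap x) (pmap y).
Proof.
apply: pres_ext => P g oP Pg; have Pg' := PsiPhi Pg.
by rewrite pmap_eval // !ev_circ // !pmap_eval.
Qed.
Lemma pmap_act n h (s : 'S_n) (x : pres Phi n) : pmap (act h s x) = act h s (pmap x).
Proof.
apply: pres_ext => P g oP Pg; have Pg' := PsiPhi Pg.
by rewrite pmap_eval // !ev_act // pmap_eval.
Qed.

Definition pres_map : opmor (pres Phi) (pres Psi) :=
  @OpMor (pres Phi) (pres Psi)
    (fun n => @DgMor k (pres Phi n) (pres Psi n) (@pmap n) (@pmap_part n) (@pmap_diff n))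
    pmap_circ pmap_act.
End PresentationMap.

Lemma castopE (P Q : preoperad) (f : opmor P Q) n m (e : n = m) (x : P n) :
  f m (castop e x) = castop e (f n x).
Proof. by case: m / e. Qed.

End Operads.

Section InvLim.
Variables (k : fieldType) (I : Type) (le : I -> I -> Prop).

Section Module.
Variables (X : I -> lmodType k) (tr : forall i j, le i j -> {linear X j -> X i}).

Record invlim := InvLim {
  proj : forall i, X i;
  proj_compat : forall i j (h : le i j), tr h (proj j) = proj i }.

HB.instance Definition _ := gen_eqMixin invlim.
HB.instance Definition _ := gen_choiceMixin invlim.

Lemma invlim_ext (x y : invlim) : (forall i, proj x i = proj y i) -> x = y.
Proof.
case: x y => [x hx] [y hy] /= xy.
have exy : x = y by apply: functional_extensionality_dep.
by rewrite exy in hx *; congr InvLim; apply: Prop_irrelevance.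
Qed.

Lemma lim_zero_compat i j (h : le i j) : tr h 0 = 0. Proof. exact: linear0. Qed.
Lemma lim_opp_compat (x : invlim) i j (h : le i j) : tr h (- proj x j) = - proj x i.
Proof. by rewrite linearN proj_compat. Qed.
Lemma lim_add_compat (x y : invlim) i j (h : le i j) :
  tr h (proj x j + proj y j) = proj x i + proj y i.
Proof. by rewrite linearD !proj_compat. Qed.
Lemma lim_scale_compat c (x : invlim) i j (h : le i j) :
  tr h (c *: proj x j) = c *: proj x i.
Proof. by rewrite linearZ /= proj_compat. Qed.

Definition lim_zero := InvLim lim_zero_compat.
Definition lim_opp x := InvLim (lim_opp_compat x).
Definition lim_add x y := InvLim (lim_add_compat x y).
Definition lim_scale c x := InvLim (lim_scale_compat c x).

Lemma lim_addA : associative lim_add.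
Proof. by move=> x y z; apply: invlim_ext => i /=; rewrite addrA. Qed.
Lemma lim_addC : commutative lim_add.
Proof. by move=> x y; apply: invlim_ext => i /=; rewrite addrC. Qed.
Lemma lim_add0 : left_id lim_zero lim_add.
Proof. by move=> x; apply: invlim_ext => i /=; rewrite add0r. Qed.
Lemma lim_addN : left_inverse lim_zero lim_opp lim_add.
Proof. by move=> x; apply: invlim_ext => i /=; rewrite addNr. Qed.
HB.instance Definition _ :=
  GRing.isZmodule.Build invlim lim_addA lim_addC lim_add0 lim_addN.

Lemma lim_scaleA a b x : lim_scale a (lim_scale b x) = lim_scale (a * b) x.
Proof. by apply: invlim_ext => i /=; rewrite scalerA. Qed.
Lemma lim_scale1 : left_id 1 lim_scale.
Proof. by move=> x; apply: invlim_ext => i /=; rewrite scale1r. Qed.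
Lemma lim_scaleDr : right_distributive lim_scale +%R.
Proof. by move=> a x y; apply: invlim_ext => i /=; rewrite scalerDr. Qed.
Lemma lim_scaleDl x : {morph lim_scale^~ x : a b / a + b}.
Proof. by move=> a b; apply: invlim_ext => i /=; rewrite scalerDl. Qed.
HB.instance Definition _ :=
  GRing.Zmodule_isLmodule.Build k invlim lim_scaleA lim_scale1 lim_scaleDr lim_scaleDl.

End Module.

Section Dg.
Variables (X : I -> dgmod k) (tr : forall i j, le i j -> dgmor (X j) (X i)).

Lemma lim_part_compat p (x : invlim tr) i j (h : le i j) :
  tr h (part (X j) p (proj x j)) = part (X i) p (proj x i).
Proof. by rewrite dgmor_part proj_compat. Qed.
Lemma lim_diff_compat (x : invlim tr) i j (h : le i j) :
  tr h (diff (X j) (proj x j)) = diff (X i) (proj x i).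
Proof. by rewrite dgmor_diff proj_compat. Qed.
Definition lim_part p (x : invlim tr) : invlim tr := InvLim (lim_part_compat p x).
Definition lim_diff (x : invlim tr) : invlim tr := InvLim (lim_diff_compat x).
Lemma lim_part_linear p : linear (lim_part p).
Proof. by move=> a x y; apply: invlim_ext => i /=; rewrite linearP. Qed.
Lemma lim_diff_linear : linear lim_diff.
Proof. by move=> a x y; apply: invlim_ext => i /=; rewrite linearP. Qed.
HB.instance Definition _ p :=
  GRing.isLinear.Build k (invlim tr) (invlim tr) *:%R (lim_part p) (lim_part_linear p).
HB.instance Definition _ :=
  GRing.isLinear.Build k (invlim tr) (invlim tr) *:%R lim_diff lim_diff_linear.

Definition limdg : dgmod k := @DgMod k (invlim tr) lim_part lim_diff.
End Dg.

Section Operad.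
Variables (sym : bool) (P : I -> preoperad k sym).
Variable tr : forall i j, le i j -> opmor (P j) (P i).

Definition limop_op n : dgmod k :=
  @limdg (fun i => P i n) (fun i j h => tr h n).

Lemma lim_circ_compat n m (l : 'I_n) (x : limop_op n) (y : limop_op m) i j (h : le i j) :
  tr h _ (circ l (proj x j) (proj y j)) = circ l (proj x i) (proj y i).
Proof. by rewrite opmor_circ (proj_compat x) (proj_compat y). Qed.
Lemma lim_act_compat n (hs : sym) (s : 'S_n) (x : limop_op n) i j (h : le i j) :
  tr h _ (act hs s (proj x j)) = act hs s (proj x i).
Proof. by rewrite opmor_act (proj_compat x). Qed.
Definition lim_circ n m (l : 'I_n) (x : limop_op n) (y : limop_op m)
  : limop_op (n + m).-1 := InvLim (lim_circ_compat l x y).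
Definition lim_act n (hs : sym) (s : 'S_n) (x : limop_op n) : limop_op n :=
  InvLim (lim_act_compat hs s x).
Lemma lim_circ_linearl n m (l : 'I_n) (y : limop_op m) : linear (fun x => lim_circ l x y).
Proof. by move=> a x z; apply: invlim_ext => i /=; apply: circ_linearl. Qed.
Lemma lim_circ_linearr n m (l : 'I_n) (x : limop_op n) : linear (@lim_circ n m l x).
Proof. by move=> a y z; apply: invlim_ext => i /=; apply: circ_linearr. Qed.
Lemma lim_act_linear n (hs : sym) (s : 'S_n) : linear (lim_act hs s).
Proof. by move=> a x y; apply: invlim_ext => i /=; apply: act_linear. Qed.

(* The P i are discrete: the kernels of the projections are a fundamental system
   of neighbourhoods of 0 (le is directed in all uses). *)
Definition limop : topOperad k sym :=
  @TopOperad _ _ (PreOperad lim_circ_linearl lim_circ_linearr lim_act_linear)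
    I (fun i n x => proj x i = 0).
End Operad.
End InvLim.

Inductive infgen : nat -> Type := Mgen n : infgen n.+1.

Section Infinity.
Variable k : fieldType.

Lemma infty_arity n (a : 'I_n.+1) : (a.+1 + (n - a).+1).-1 = n.+1.
Proof. by rewrite addSn addnS subnKC // -ltnS. Qed.

(* m_{a+1} o_i m_{n-a+1}, in arity n+1 *)
Definition mcirc (sym : bool) (P : preoperad k sym) (m : forall n, P n.+1)
    n (a : 'I_n.+1) (i : 'I_a.+1) : P n.+1 :=
  castop (infty_arity a) (circ i (m a) (m (n - a)%N)).

Definition shuffle p n (s : 'S_n) : bool :=
  [forall i : 'I_n, forall j : 'I_n,
    (i < j)%N && ((j < p)%N || (p <= i)%N) ==> (s i < s j)%N].

(* m n stands for m_{n+1} *)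
Definition isAinf (P : preoperad k false) (m : forall n, P n.+1) : Prop :=
  (forall n, part _ true (m n) = m n) /\
  (forall n, diff _ (m n) = \sum_(a < n.+1) \sum_(i < a.+1) mcirc m i).

Definition isLinf (P : preoperad k true) (m : forall n, P n.+1) : Prop :=
  [/\ forall n, part _ true (m n) = m n,
      forall n (s : 'S_n.+1), act isT s (m n) = m n &
      forall n, diff _ (m n) =
        \sum_(a < n.+1) \sum_(s : 'S_n.+1 | shuffle (n - a).+1 s)
          act isT s (mcirc m (ord0 : 'I_a.+1))].

Definition relA (P : preoperad k false) (g : forall n, infgen n -> P n) : Prop :=
  isAinf (fun n => g n.+1 (Mgen n)).
Definition relL (P : preoperad k true) (g : forall n, infgen n -> P n) : Prop :=
  isLinf (fun n => g n.+1 (Mgen n)).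

Definition Ainf : preoperad k false := pres relA.
Definition Linf : preoperad k true := pres relL.
Definition mA n : Ainf n.+1 := pgen relA (Mgen n).
Definition mL n : Linf n.+1 := pgen relL (Mgen n).

Lemma mA_isAinf : isAinf mA.
Proof.
split=> n; apply: pres_ext => P g oP Pg; case: (Pg) => godd gd.
  by rewrite ev_part // pres_eval_cls //= godd.
rewrite ev_diff // pres_eval_cls //= gd; set S := (X in _ = pres_eval g X).
transitivity (pres_mor oP Pg n.+1 S); last by [].
rewrite linear_sum; apply: eq_bigr => a _; rewrite linear_sum; apply: eq_bigr => i _.
by rewrite /mcirc castopE opmor_circ !pres_mor_gen.
Qed.

Lemma mL_isLinf : isLinf mL.
Proof.
split=> [n|n s|n]; apply: pres_ext => P g oP Pg; case: (Pg) => godd ginv gd.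
- by rewrite ev_part // pres_eval_cls //= godd.
- by rewrite ev_act // pres_eval_cls //= ginv.
rewrite ev_diff // pres_eval_cls //= gd; set S := (X in _ = pres_eval g X).
transitivity (pres_mor oP Pg n.+1 S); last by [].
rewrite linear_sum; apply: eq_bigr => a _; rewrite linear_sum; apply: eq_bigr => s _.
by rewrite opmor_act /mcirc castopE opmor_circ !pres_mor_gen.
Qed.

End Infinity.

Section Adjoin.
Variables (k : fieldType) (sym : bool) (O : preoperad k sym).
Variables (m : forall n, O n.+1) (c : nat -> k).

Inductive adjgen : nat -> Type :=
| Old n : O n -> adjgen n
| New : adjgen 0.

(* The relations of O[x]/(x^N) with d(x) = sum_(n >= 1) c_n m_n o x^n; the terms
   with n >= N lie in (x^N), so that all partial sums of length >= N agree. *)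
Record isTrunc (N : nat) (P : preoperad k sym) (i : opmor O P) (x : P 0%N) : Prop := IsTrunc {
  trunc_even : part _ false x = x;
  trunc_ideal : forall r n (a : P n), (N <= r)%N -> xpow x r a -> a = 0;
  trunc_diff : forall r, (N <= r)%N ->
    diff _ x = \sum_(n < r) c n.+1 *: fill (i n.+1 (m n)) x }.

Definition relT (N : nat) (P : preoperad k sym) (g : forall n, adjgen n -> P n) : Prop :=
  exists2 i : opmor O P, forall n (a : O n), g n (Old a) = i n a & isTrunc N i (g 0%N New).

Definition trunc N : preoperad k sym := pres (@relT N).

Section TruncRel.
Variable N : nat.
Let gen n : adjgen n -> trunc N n := @pgen _ _ _ (@relT N) n.

Lemma trunc_xpow (P : preoperad k sym) (g : forall n, adjgen n -> P n)
    (oP : isOperad P) (Pg : relT N g) r n (a : trunc N n) :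
  xpow (gen New) r a -> xpow (g 0%N New) r (pres_mor oP Pg n a).
Proof.
elim=> {r n a} [|n a|j n a _ IH|j n|j n d a b _ IHa _ IHb|j l n m' i a b _ IHa _ IHb|j n h s a _ IH].
- by rewrite pres_mor_gen; constructor.
- by constructor.
- by constructor.
- by rewrite (linear0 (pres_mor oP Pg n)); constructor.
- by rewrite (linearP (pres_mor oP Pg n)); constructor.
- by rewrite (opmor_circ (pres_mor oP Pg)); constructor.
- by rewrite (opmor_act (pres_mor oP Pg)); constructor.
Qed.

Lemma fill_mor (P Q : preoperad k sym) (f : opmor P Q) n (a : P n) x :
  f 0%N (fill a x) = fill (f n a) (f 0%N x).
Proof.
elim: n a => [//|n IH] a /=; rewrite IH castopE; congr (fill (castop _ _) _).
exact: (opmor_circ f ord0 a x).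
Qed.

Definition trunc_old n (a : O n) : trunc N n := gen (Old a).

Lemma trunc_old_linear n : linear (@trunc_old n).
Proof.
move=> d a b; apply: pres_ext => P g oP Pg; rewrite ev_lin // !pres_eval_cls //=.
by case: (Pg) => i iE _; rewrite !iE linearP.
Qed.
HB.instance Definition _ n :=
  GRing.isLinear.Build k (O n) (trunc N n) *:%R (@trunc_old n) (@trunc_old_linear n).
Lemma trunc_old_part n p (a : O n) : trunc_old (part _ p a) = part _ p (trunc_old a).
Proof.
apply: pres_ext => P g oP Pg; rewrite ev_part // !pres_eval_cls //=.
by case: (Pg) => i iE _; rewrite !iE dgmor_part.
Qed.
Lemma trunc_old_diff n (a : O n) : trunc_old (diff _ a) = diff _ (trunc_old a).
Proof.
apply: pres_ext => P g oP Pg; rewrite ev_diff // !pres_eval_cls //=.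
by case: (Pg) => i iE _; rewrite !iE dgmor_diff.
Qed.
Lemma trunc_old_circ n m' (l : 'I_n) (a : O n) (b : O m') :
  trunc_old (circ l a b) = circ l (trunc_old a) (trunc_old b).
Proof.
apply: pres_ext => P g oP Pg; rewrite ev_circ // !pres_eval_cls //=.
by case: (Pg) => i iE _; rewrite !iE opmor_circ.
Qed.
Lemma trunc_old_act n h (s : 'S_n) (a : O n) :
  trunc_old (act h s a) = act h s (trunc_old a).
Proof.
apply: pres_ext => P g oP Pg; rewrite ev_act // !pres_eval_cls //=.
by case: (Pg) => i iE _; rewrite !iE opmor_act.
Qed.

Definition trunc_incl : opmor O (trunc N) :=
  @OpMor k sym O (trunc N)
    (fun n => @DgMor k (O n) (trunc N n) (@trunc_old n) (@trunc_old_part n) (@trunc_old_diff n))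
    trunc_old_circ trunc_old_act.

Lemma trunc_relT : relT N gen.
Proof.
exists trunc_incl => //; split=> [|r n a Nr ax|r Nr]; apply: pres_ext => P g oP Pg;
  case: (Pg) => i iE [gx gI gd].
- by rewrite ev_part // pres_eval_cls //=.
- have /(gI _ _ _ Nr) /= E := trunc_xpow oP Pg ax.
  by rewrite -/(pres_ev g a) E [RHS]ev_zero.
rewrite ev_diff // pres_eval_cls //= (gd r Nr); set S := (X in _ = pres_eval g X).
transitivity (pres_mor oP Pg 0%N S); last by [].
rewrite linear_sum; apply: eq_bigr => j _; rewrite linearZ -iE; congr (_ *: _).
have := fill_mor (pres_mor oP Pg) (gen (Old (m j))) (gen New).
by rewrite (pres_mor_gen oP Pg (Old (m j))) (pres_mor_gen oP Pg New) => <-.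
Qed.
End TruncRel.

Lemma relT_le N N' (h : (N <= N')%N) (P : preoperad k sym)
  (g : forall n, adjgen n -> P n) : relT N g -> relT N' g.
Proof.
move=> [i gi [gx gI gd]]; exists i => //; split=> // [r n a|r] Nr;
  by [apply: gI; apply: leq_trans Nr | apply: gd; apply: leq_trans Nr].
Qed.

Definition trunc_map N N' (h : (N <= N')%N) : opmor (trunc N') (trunc N) :=
  pres_map (@relT_le N N' h).

(* O[[x]] = lim_N O[x]/(x^N) *)
Definition adjoin : topOperad k sym := limop trunc_map.

Lemma adjoin_compat n (t : adjgen n) N N' (h : (N <= N')%N) :
  trunc_map h n (pgen (@relT N') t) = pgen (@relT N) t.
Proof.
apply: pres_ext => P g oP Pg.
by rewrite pmap_eval ?pres_eval_cls //; apply: relT_le Pg.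
Qed.

Definition adjoin_gen n (t : adjgen n) : adjoin n := InvLim (adjoin_compat t).
Definition adjoin_in n (a : O n) : adjoin n := adjoin_gen (Old a).
Definition adjoin_x : adjoin 0 := adjoin_gen New.

End Adjoin.

Section Extensions.
Variable k : fieldType.
Definition coefL (n : nat) : k := (n`!)%:R^-1.
Definition coefA (n : nat) : k := 1.
Definition sLinf : topOperad k true := adjoin (@mL k) coefL.
Definition sAinf : topOperad k false := adjoin (@mA k) coefA.
End Extensions.

Section Endo.
Variables (k : fieldType) (W : dgmod k).

(* A map W^n -> W is encoded as a function on lists that vanishes on the lists
   of length different from n. *)
Definition is_multilinear (n : nat) (f : seq W -> W) : Prop :=
  (forall s, size s != n -> f s = 0) /\
  (forall s1 s2 a u v,
     f (s1 ++ (a *: u + v) :: s2) = a *: f (s1 ++ u :: s2) + f (s1 ++ v :: s2)).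

Definition multilinear n : {pred (seq W -> W)} := fun f => `[< is_multilinear n f >].

Lemma multilinear_submod n : submod_closed (multilinear n).
Proof.
split=> [|c f g /asboolP[f0 fL] /asboolP[g0 gL]]; apply/asboolP.
  by split=> // s1 s2 a u v; rewrite scaler0 addr0.
have E s : (c *: f + g) s = c *: f s + g s by [].
split=> [s sn|s1 s2 a u v]; rewrite !E; first by rewrite f0 // g0 // scaler0 addr0.
by rewrite fL gL !scalerDr !scalerA (mulrC c) addrACA.
Qed.
HB.instance Definition _ n :=
  GRing.isSubmodClosed.Build k (seq W -> W) (multilinear n) (multilinear_submod n).

Record mlin n := MLin { mfun :> seq W -> W; _ : mfun \in multilinear n }.
HB.instance Definition _ n := [isSub for @mfun n].
HB.instance Definition _ n := [Choice of mlin n by <:].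
HB.instance Definition _ n := [SubChoice_isSubLmodule of mlin n by <:].


Lemma mlin_size n (f : mlin n) s : size s != n -> f s = 0.
Proof. by case: f => f /= /asboolP[f0 _]; apply: f0. Qed.
Lemma mlinP n (f : mlin n) s1 s2 a u v :
  f (s1 ++ (a *: u + v) :: s2) = a *: f (s1 ++ u :: s2) + f (s1 ++ v :: s2).
Proof. by case: f => f /= /asboolP[_ fL]; apply: fL. Qed.
Lemma mlin_ext n (f g : mlin n) : (forall s, f s = g s) -> f = g.
Proof. by move=> fg; apply: val_inj; apply: functional_extensionality_dep. Qed.
Lemma mlin_lin n c (f g : mlin n) s : (c *: f + g) s = c *: f s + g s.
Proof. by []. Qed.

Lemma take_slot_le i (s1 s2 : seq W) w : (i <= size s1)%N -> take i (s1 ++ w :: s2) = take i s1.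
Proof.
rewrite take_cat leq_eqVlt => /predU1P[->|->//].
by rewrite ltnn subnn take_size cats0.
Qed.
Lemma drop_slot_le i (s1 s2 : seq W) w :
  (i <= size s1)%N -> drop i (s1 ++ w :: s2) = drop i s1 ++ w :: s2.
Proof.
rewrite drop_cat leq_eqVlt => /predU1P[->|->//].
by rewrite ltnn subnn drop_size.
Qed.
Lemma take_slot_gt i (s1 s2 : seq W) w : (size s1 < i)%N ->
  take i (s1 ++ w :: s2) = s1 ++ w :: take (i - (size s1).+1) s2.
Proof. by move=> lt; rewrite take_cat ltnNge (ltnW lt) /= -(subnSK lt). Qed.
Lemma drop_slot_gt i (s1 s2 : seq W) w : (size s1 < i)%N ->
  drop i (s1 ++ w :: s2) = drop (i - (size s1).+1) s2.
Proof. by move=> lt; rewrite drop_cat ltnNge (ltnW lt) /= -(subnSK lt). Qed.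
Lemma nth_slot i (s1 s2 : seq W) w w' : i != size s1 ->
  nth 0 (s1 ++ w :: s2) i = nth 0 (s1 ++ w' :: s2) i.
Proof. by rewrite !nth_cat; case: ltngtP => // lt _; rewrite -(subnSK lt). Qed.

Definition guard n (F : seq W -> W) : seq W -> W :=
  fun s => if size s == n then F s else 0.

Lemma guard_multilinear n (F : seq W -> W) :
  (forall s1 s2 a u v, (size s1 + size s2).+1 = n ->
     F (s1 ++ (a *: u + v) :: s2) = a *: F (s1 ++ u :: s2) + F (s1 ++ v :: s2)) ->
  guard n F \in multilinear n.
Proof.
move=> FL; apply/asboolP; split=> [s /negPf sn|s1 s2 a u v]; rewrite /guard ?sn //.
rewrite !size_cat /= addnS; case: eqP => [sn|_]; first exact: FL.
by rewrite scaler0 addr0.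
Qed.

Lemma scale_aux (U : lmodType k) (a b c : k) (x x' y y' : U) :
  b *: ((a *: x + x') + c *: (a *: y + y'))
  = a *: (b *: (x + c *: y)) + b *: (x' + c *: y').
Proof.
rewrite !scalerDr !scalerA addrACA; congr (_ + _ + _).
  by rewrite mulrC.
by rewrite mulrC mulrA.
Qed.

Local Notation eps := (@sgn k W).

(* Conjugation by eps is f |-> (-1)^|f| f, and 2 is invertible in characteristic 0. *)
Definition endo_part_fun n (p : bool) (f : mlin n) : seq W -> W :=
  guard n (fun s => 2^-1 *: (f s + (-1) ^+ p *: eps (f (map eps s)))).
Lemma endo_part_multilinear n p (f : mlin n) : endo_part_fun p f \in multilinear n.
Proof.
apply: guard_multilinear => s1 s2 a u v _.
by rewrite !map_cat /= linearP !mlinP linearP; apply: scale_aux.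
Qed.
Definition endo_part n p (f : mlin n) := MLin (endo_part_multilinear p f).

Lemma endo_part_linear n p : linear (@endo_part n p).
Proof.
move=> c f g; apply: mlin_ext => s; rewrite mlin_lin /= /endo_part_fun /guard.
case: ifP => _; last by rewrite scaler0 addr0.
by rewrite !mlin_lin linearP; apply: scale_aux.
Qed.
HB.instance Definition _ n p :=
  GRing.isLinear.Build k (mlin n) (mlin n) *:%R (@endo_part n p) (@endo_part_linear n p).

Definition endo_sgn n (f : mlin n) : mlin n := endo_part false f - endo_part true f.
Lemma endo_sgn_lin n c (f g : mlin n) : endo_sgn (c *: f + g) = c *: endo_sgn f + endo_sgn g.
Proof. by rewrite /endo_sgn 2!(linearP (@endo_part n _)) scalerBr opprD addrACA. Qed.

(* (d f)(w_1, ..., w_n) = d (f (w_1, ..., w_n)) -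
   sum_i (-1)^(|f| + |w_1| + ... + |w_(i-1)|) f (w_1, ..., d w_i, ..., w_n) *)
Definition endo_diff_fun n (f : mlin n) : seq W -> W :=
  guard n (fun s => diff W (f s) -
    \sum_(i < n) endo_sgn f (map eps (take i s) ++ diff W (nth 0 s i) :: drop i.+1 s)).
Lemma endo_diff_multilinear n (f : mlin n) : endo_diff_fun f \in multilinear n.
Proof.
apply: guard_multilinear => s1 s2 a u v sn.
rewrite mlinP linearP scalerBr.
rewrite [RHS]addrACA -opprD scaler_sumr -big_split; congr (_ - _).
apply: eq_bigr => i _.
move: (endo_sgn f) => h; have [lt|gt|eq] := ltngtP i (size s1).
- have neq : i != size s1 :> nat by rewrite ltn_eqF.
  rewrite !take_slot_le ?(ltnW lt) // !drop_slot_le // -!cat_cons !catA.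
  by rewrite (nth_slot _ _ 0 neq) (nth_slot _ u 0 neq) (nth_slot _ v 0 neq) mlinP.
- have neq : i != size s1 :> nat by rewrite gtn_eqF.
  rewrite !take_slot_gt // !drop_slot_gt ?ltnS ?(ltnW gt) //.
  rewrite (nth_slot _ _ 0 neq) (nth_slot _ u 0 neq) (nth_slot _ v 0 neq) !map_cat /= linearP -!catA !cat_cons.
  by rewrite mlinP.
- rewrite eq !take_slot_le // !drop_slot_gt // !nth_cat ltnn subnn /=.
  by rewrite linearP mlinP.
Qed.
Definition endo_diff n (f : mlin n) := MLin (endo_diff_multilinear f).

Lemma endo_diff_linear n : linear (@endo_diff n).
Proof.
move=> c f g; apply: mlin_ext => s; rewrite mlin_lin /= /endo_diff_fun /guard.
case: ifP => _; last by rewrite scaler0 addr0.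
rewrite endo_sgn_lin mlin_lin (linearP (diff W)) [X in _ = X + _]scalerBr scaler_sumr addrACA -opprD -big_split.
by congr (_ - _); apply: eq_bigr => i _; rewrite mlin_lin.
Qed.
HB.instance Definition _ n :=
  GRing.isLinear.Build k (mlin n) (mlin n) *:%R (@endo_diff n) (@endo_diff_linear n).

Definition endo_op n : dgmod k := @DgMod k (mlin n) (@endo_part n) (@endo_diff n).

(* (f o_i g)(w) = (-1)^(|g|(|w_1| + ... + |w_(i-1)|)) f (w_1, ..., g (w_i, ...), ...);
   i counts from 0 *)
Definition endo_circ_fun n m (i : 'I_n) (f : mlin n) (g : mlin m) : seq W -> W :=
  guard (n + m).-1 (fun s => \sum_(q : bool)
    f (map (@koszul k W q) (take i s) ++
       endo_part q g (take m (drop i s)) :: drop (i + m) s)).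
Lemma endo_circ_multilinear n m (i : 'I_n) (f : mlin n) (g : mlin m) :
  endo_circ_fun i f g \in multilinear (n + m).-1.
Proof.
apply: guard_multilinear => s1 s2 a u v sn.
rewrite scaler_sumr -big_split; apply: eq_bigr => q _.
have [lt|ge] := ltnP (size s1) i.
  rewrite !take_slot_gt // !drop_slot_gt // ?(leq_trans lt) ?leq_addr //.
  by rewrite !map_cat /= linearP -!catA !cat_cons mlinP.
rewrite !(take_slot_le _ _ ge) !(drop_slot_le _ _ ge).
have [lt|ge2] := ltnP (size s1) (i + m).
  rewrite !take_slot_gt ?size_drop ?ltn_subLR // !drop_slot_gt //.
  by rewrite !mlinP.
rewrite !take_slot_le ?size_drop ?leq_subRL // !drop_slot_le //.
by rewrite -!cat_cons !catA mlinP.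
Qed.
Definition endo_circ n m (i : 'I_n) (f : endo_op n) (g : endo_op m) : endo_op (n + m).-1 :=
  MLin (endo_circ_multilinear i f g).

Lemma endo_circ_linearl n m (i : 'I_n) (g : endo_op m) : linear (fun f => endo_circ i f g).
Proof.
move=> c f f'; apply: mlin_ext => s; rewrite mlin_lin /= /endo_circ_fun /guard.
case: ifP => _; last by rewrite scaler0 addr0.
by rewrite scaler_sumr -big_split; apply: eq_bigr => q _; rewrite mlin_lin.
Qed.
Lemma endo_circ_linearr n m (i : 'I_n) (f : endo_op n) : linear (@endo_circ n m i f).
Proof.
move=> c g g'; apply: mlin_ext => s; rewrite mlin_lin /= /endo_circ_fun /guard.
case: ifP => _; last by rewrite scaler0 addr0.
by rewrite scaler_sumr -big_split; apply: eq_bigr => q _; rewrite linearP mlin_lin mlinP.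
Qed.

(* Koszul sign of w_1 ... w_n |-> w_(s 1) ... w_(s n), where |w_i| = q i *)
Definition ksign n (s : 'S_n) (q : {ffun 'I_n -> bool}) : k :=
  (-1) ^+ #|[set x : 'I_n * 'I_n |
    [&& (x.1 < x.2)%N, (s x.2 < s x.1)%N, q (s x.1) & q (s x.2)]]|.

Definition endo_act_fun n (s : 'S_n) (f : mlin n) : seq W -> W :=
  guard n (fun w => \sum_(q : {ffun 'I_n -> bool})
    ksign s q *: f [seq part W (q (s j)) (nth 0 w (s j)) | j <- enum 'I_n]).
Lemma endo_act_multilinear n (s : 'S_n) (f : mlin n) : endo_act_fun s f \in multilinear n.
Proof.
apply: guard_multilinear => s1 s2 a u v sn.
have lt : (size s1 < n)%N by rewrite -sn ltnS leq_addr.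
rewrite scaler_sumr -big_split; apply: eq_bigr => q _ /=.
pose j := (s^-1)%g (Ordinal lt).
have sj : s j = size s1 :> nat by rewrite permKV.
have := enum_uniq 'I_n; have : j \in enum 'I_n by rewrite mem_enum.
case/splitPr => e1 e2; rewrite cat_uniq /= negb_or => /and4P[_ /andP[je1 _] je2 _].
rewrite !map_cat /= sj !nth_cat !ltnn !subnn /= linearP.
have E w w' e : j \notin e ->
   [seq part W (q (s i)) (nth 0 (s1 ++ w :: s2) (s i)) | i <- e] =
   [seq part W (q (s i)) (nth 0 (s1 ++ w' :: s2) (s i)) | i <- e].
  move=> je; apply/eq_in_map => i ie; congr (part W _ _); apply: nth_slot.
  by apply: contraNneq je => eq; rewrite -(@perm_inj _ s i j) //; apply: val_inj; rewrite /= sj.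
rewrite (E (a *: u + v) v e1) // (E (a *: u + v) v e2) // (E u v e1) // (E u v e2) //.
by rewrite mlinP scalerDr !scalerA mulrC.
Qed.
Definition endo_act n (s : 'S_n) (f : endo_op n) : endo_op n :=
  MLin (endo_act_multilinear s f).

Lemma endo_act_linear n (s : 'S_n) : linear (@endo_act n s).
Proof.
move=> c f f'; apply: mlin_ext => w; rewrite mlin_lin /= /endo_act_fun /guard.
case: ifP => _; last by rewrite scaler0 addr0.
rewrite scaler_sumr -big_split; apply: eq_bigr => q _.
by rewrite mlin_lin /= scalerDr !scalerA mulrC.
Qed.

Definition endo (sym : bool) : preoperad k sym :=
  @PreOperad k sym endo_op endo_circ (fun n _ => @endo_act n)
    endo_circ_linearl endo_circ_linearr (fun n _ => @endo_act_linear n).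

(* g |-> g (w, -) *)
Definition endo_inst_fun n (f : mlin n.+1) (w : W) : seq W -> W := fun s => f (w :: s).
Lemma endo_inst_multilinear n (f : mlin n.+1) w : endo_inst_fun f w \in multilinear n.
Proof.
apply/asboolP; split=> [s sn|s1 s2 a u v]; rewrite /endo_inst_fun.
  by rewrite mlin_size.
by rewrite -!cat_cons mlinP.
Qed.
Definition endo_inst n (f : endo_op n.+1) (w : W) : endo_op n :=
  MLin (endo_inst_multilinear f w).

(* Hom(k, W) = W *)
Definition endo0 (f : endo_op 0) : W := (f : mlin 0) [::].
Lemma endo0_linear : linear endo0. Proof. by []. Qed.
HB.instance Definition _ := GRing.isLinear.Build k (endo_op 0) W *:%R endo0 endo0_linear.

End Endo.

(* For B finite-dimensional with basis e_1, ..., e_d, the space B (x) U is U^d, a family x standing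
   for sum_i e_i (x) x_i. *)

Section Tensor.
Variable k : fieldType.

Section Map.
Variables (B B' : vectType k) (U U' : lmodType k).

Definition bas (i : 'I_(\dim {:B})) : B := (vbasis {:B})`_i.
Definition tens : lmodType k := {ffun 'I_(\dim {:B}) -> U}.
Definition pure (b : B) (u : U) : tens := [ffun i => coord (vbasis {:B}) i b *: u].
End Map.

Lemma pure_linearl (B : vectType k) (U : lmodType k) (u : U) : linear (fun b : B => pure b u).
Proof. by move=> a b b'; apply/ffunP => i; rewrite !ffunE linearP scalerDl scalerA. Qed.
Lemma pure_linearr (B : vectType k) (U : lmodType k) (b : B) : linear (@pure B U b).
Proof.
by move=> a u u'; apply/ffunP => i; rewrite !ffunE scalerDr !scalerA mulrC.
Qed.
HB.instance Definition _ (B : vectType k) (U : lmodType k) (b : B) :=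
  GRing.isLinear.Build k U (tens B U) *:%R (@pure B U b) (@pure_linearr B U b).

Lemma sum_bas (B : vectType k) (b : B) : b = \sum_i coord (vbasis {:B}) i b *: bas i.
Proof. by rewrite {1}(coord_vbasis (memvf b)). Qed.

(* phi (x) psi *)
Definition tmap (B B' : vectType k) (U U' : lmodType k)
    (phi : B -> B') (psi : U -> U') (x : tens B U) : tens B' U' :=
  \sum_i pure (phi (bas i)) (psi (x i)).

Lemma tmap_linear (B B' : vectType k) (U U' : lmodType k)
  (phi : B -> B') (psi : {linear U -> U'}) : linear (@tmap B B' U U' phi psi).
Proof.
move=> a x y; rewrite /tmap scaler_sumr -big_split; apply: eq_bigr => i _.
by rewrite !ffunE linearP; apply: pure_linearr.
Qed.
HB.instance Definition _ (B B' : vectType k) (U U' : lmodType k)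
  (phi : B -> B') (psi : {linear U -> U'}) :=
  GRing.isLinear.Build k (tens B U) (tens B' U') *:%R (@tmap B B' U U' phi psi)
    (@tmap_linear B B' U U' phi psi).

Lemma tmap_pure (B B' : vectType k) (U U' : lmodType k)
    (phi : {linear B -> B'}) (psi : {linear U -> U'}) b u :
  tmap phi psi (pure b u) = pure (phi b) (psi u).
Proof.
rewrite /tmap {2}(sum_bas b) linear_sum.
have : linear (fun b' : B' => pure b' (psi u)) by exact: pure_linearl.
set h := (fun b' => _) => hL.
pose hl : {linear B' -> tens B' U'} :=
  HB.pack h (GRing.isLinear.Build k B' (tens B' U') *:%R h hL).
transitivity (hl (\sum_i phi (coord (vbasis {:B}) i b *: bas i))); last by [].
rewrite linear_sum; apply: eq_bigr => i _.
by rewrite ffunE !linearZ.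
Qed.

Lemma tmap_comp (B B' B2 : vectType k) (U U' U2 : lmodType k)
    (phi : {linear B -> B'}) (psi : {linear U -> U'})
    (phi' : {linear B' -> B2}) (psi' : {linear U' -> U2}) x :
  tmap phi' psi' (tmap phi psi x) = tmap (phi' \o phi) (psi' \o psi) x.
Proof. by rewrite [tmap phi psi x]/tmap linear_sum; apply: eq_bigr => i _; exact: tmap_pure. Qed.

End Tensor.

Section Cdga.
Variable k : fieldType.

(* Finite-dimensional nilpotent non-unital commutative dg algebras *)
Record nilcdga := NilCdga {
  ncar :> vectType k;
  npart : bool -> {linear ncar -> ncar};
  ndiff : {linear ncar -> ncar};
  ndg := DgMod npart ndiff;
  nmul : ncar -> ncar -> ncar;
  ndgP : isDg ndg;
  nmul_linearl : forall b, linear (nmul^~ b);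
  nmul_linearr : forall a, linear (nmul a);
  nmul_part : forall p q a b,
    npart (p (+) q) (nmul (npart p a) (npart q b)) = nmul (npart p a) (npart q b);
  nmulA : associative nmul;
  nmulC : forall p q a b,
    nmul (npart p a) (npart q b) = (-1) ^+ (p && q) *: nmul (npart q b) (npart p a);
  ndiffM : forall a b, ndiff (nmul a b) = nmul (ndiff a) b + nmul (@sgn k ndg a) (ndiff b);
  nnil : exists n, forall a (s : seq ncar), size s = n -> foldl nmul a s = 0 }.

Definition nsgn (B : nilcdga) : {linear B -> B} :=
  (@sgn k (ndg B) : {linear ndg B -> ndg B}).

Record nilmor (B C : nilcdga) := NilMor {
  nilmor_fun :> dgmor (ndg B) (ndg C);
  nilmor_mul : forall a b : B, nilmor_fun (nmul a b) = nmul (nilmor_fun a) (nilmor_fun b) }.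

(* A = k + A_+ with A_+ the limit of an inverse system over a directed set; a
   formal cdga is recorded by that inverse system. *)
Record formalCdga := FormalCdga {
  fidx : Type;
  fle : fidx -> fidx -> Prop;
  fle_refl : forall i, fle i i;
  fle_trans : forall i j l, fle i j -> fle j l -> fle i l;
  fidx_inh : inhabited fidx;
  fidx_dir : forall i j, exists l, fle i l /\ fle j l;
  falg : fidx -> nilcdga;
  ftr : forall i j, fle i j -> nilmor (falg j) (falg i);
  ftr_id : forall i (h : fle i i) a, ftr h a = a;
  ftr_comp : forall i j l (h : fle i j) (h' : fle j l) (h2 : fle i l) a,
    ftr h (ftr h' a) = ftr h2 a }.

End Cdga.

Section TensorDg.
Variables (k : fieldType) (B : nilcdga k).

Section Dg.
Variable U : dgmod k.

Definition tens_part (p : bool) (x : tens B U) : tens B U :=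
  \sum_(q : bool) tmap (npart B q) (part U (p (+) q)) x.
(* d (b (x) u) = d b (x) u + (-1)^|b| b (x) d u *)
Definition tens_diff (x : tens B U) : tens B U :=
  tmap (ndiff B) idfun x + tmap (nsgn B) (diff U) x.

Lemma tens_part_linear p : linear (tens_part p).
Proof.
move=> a x y; rewrite /tens_part scaler_sumr -big_split; apply: eq_bigr => q _.
exact: linearP.
Qed.
Lemma tens_diff_linear : linear tens_diff.
Proof.
move=> a x y; rewrite /tens_diff scalerDr addrACA.
by congr (_ + _); apply: linearP.
Qed.
HB.instance Definition _ p :=
  GRing.isLinear.Build k (tens B U) (tens B U) *:%R (tens_part p) (tens_part_linear p).
HB.instance Definition _ :=
  GRing.isLinear.Build k (tens B U) (tens B U) *:%R tens_diff tens_diff_linear.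

Definition tensdg : dgmod k := @DgMod k (tens B U) tens_part tens_diff.
End Dg.

(* (b (x) u) (c (x) v) |-> (-1)^(|u||c|) bc (x) h u v *)
Definition tmul (U U' U2 : dgmod k) (h : U -> U' -> U2)
    (x : tensdg U) (y : tensdg U') : tensdg U2 :=
  \sum_i \sum_j \sum_(q : bool)
    pure (nmul (bas i) (npart B q (bas j))) (h (koszul q (x i)) (y j)).

Lemma tmul_linearl (U U' U2 : dgmod k) (h : U -> U' -> U2) (y : tensdg U') :
  (forall v, linear (h^~ v)) -> linear (fun x : tensdg U => tmul h x y).
Proof.
move=> hL a x x'; rewrite /tmul scaler_sumr -big_split; apply: eq_bigr => i _.
rewrite scaler_sumr -big_split; apply: eq_bigr => j _.
rewrite scaler_sumr -big_split; apply: eq_bigr => q _.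
by rewrite !ffunE linearP hL; apply: pure_linearr.
Qed.
Lemma tmul_linearr (U U' U2 : dgmod k) (h : U -> U' -> U2) (x : tensdg U) :
  (forall u, linear (h u)) -> linear (tmul h x).
Proof.
move=> hL a y y'; rewrite /tmul scaler_sumr -big_split; apply: eq_bigr => i _.
rewrite scaler_sumr -big_split; apply: eq_bigr => j _.
rewrite scaler_sumr -big_split; apply: eq_bigr => q _.
by rewrite !ffunE hL; apply: pure_linearr.
Qed.

Section Operad.
Variables (sym : bool) (P : preoperad k sym).
Definition tens_circ n m (l : 'I_n) : tensdg (P n) -> tensdg (P m) -> tensdg (P (n + m).-1) :=
  tmul (@circ _ _ P n m l).
Definition tens_act n (h : sym) (s : 'S_n) (x : tensdg (P n)) : tensdg (P n) :=
  [ffun i => act h s (x i)].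
Lemma tens_circ_linearl n m (l : 'I_n) (y : tensdg (P m)) :
  linear (fun x : tensdg (P n) => tens_circ l x y).
Proof. by apply: tmul_linearl => v; apply: circ_linearl. Qed.
Lemma tens_circ_linearr n m (l : 'I_n) (x : tensdg (P n)) : linear (@tens_circ n m l x).
Proof. by apply: tmul_linearr => u; apply: circ_linearr. Qed.
Lemma tens_act_linear n (h : sym) (s : 'S_n) : linear (@tens_act n h s).
Proof. by move=> a x y; apply/ffunP => i; rewrite !ffunE; apply: act_linear. Qed.
Definition tensop : preoperad k sym :=
  @PreOperad k sym (fun n => tensdg (P n)) tens_circ tens_act
    tens_circ_linearl tens_circ_linearr tens_act_linear.
End Operad.
End TensorDg.

Section Completed.
Variable k : fieldType.

Section Transition.
Variables (B C : nilcdga k) (phi : nilmor B C).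

Section Dg.
Variable U : dgmod k.
Definition tens_tr : {linear tens B U -> tens C U} := tmap phi (@idfun U).

Lemma tens_trE (x : tens B U) : tens_tr x = \sum_i pure (phi (bas i)) (x i).
Proof. by []. Qed.

Lemma tens_tr_part p (x : tensdg B U) :
  tens_tr (part (tensdg B U) p x) = part (tensdg C U) p (tens_tr x).
Proof.
rewrite /= /tens_part linear_sum; apply: eq_bigr => q _.
rewrite [LHS]tmap_comp [RHS]tmap_comp; apply: eq_bigr => i _ /=.
by rewrite (dgmor_part phi).
Qed.
Lemma tens_tr_diff (x : tensdg B U) :
  tens_tr (diff (tensdg B U) x) = diff (tensdg C U) (tens_tr x).
Proof.
rewrite /= /tens_diff linearD; congr (_ + _);
  rewrite [LHS]tmap_comp [RHS]tmap_comp; apply: eq_bigr => i _ /=.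
  by rewrite (dgmor_diff phi).
by rewrite /sgn linearB !(dgmor_part phi).
Qed.
Definition tens_mor : dgmor (tensdg B U) (tensdg C U) :=
  @DgMor k (tensdg B U) (tensdg C U) tens_tr tens_tr_part tens_tr_diff.
End Dg.

End Transition.

Lemma linear_comb (U U' : lmodType k) (f : U -> U') (I : finType) (a : I -> k) (x : I -> U) :
  linear f -> f (\sum_i a i *: x i) = \sum_i a i *: f (x i).
Proof.
move=> fL; pose fl : {linear U -> U'} := HB.pack f (GRing.isLinear.Build k U U' *:%R f fL).
transitivity (fl (\sum_i a i *: x i)); first by [].
by rewrite linear_sum; apply: eq_bigr => i _; rewrite linearZ.
Qed.
Lemma linear_sum1 (U U' : lmodType k) (f : U -> U') (I : finType) (x : I -> U) :
  linear f -> f (\sum_i x i) = \sum_i f (x i).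
Proof.
move=> fL; pose fl : {linear U -> U'} := HB.pack f (GRing.isLinear.Build k U U' *:%R f fL).
transitivity (fl (\sum_i x i)); first by [].
by rewrite linear_sum.
Qed.

Lemma tmul_pure (D : nilcdga k) (U U' U2 : dgmod k) (h : U -> U' -> U2) (b c : D) u v :
  (forall v, linear (h^~ v)) -> (forall u, linear (h u)) ->
  tmul h (pure b u : tensdg D U) (pure c v : tensdg D U')
  = \sum_(q : bool) pure (nmul b (npart D q c)) (h (koszul q u) v).
Proof.
move=> hl hr; pose G q b c : tens D U2 := pure (nmul b (npart D q c)) (h (koszul q u) v).
have Gl q c' : linear (G q ^~ c').
  by move=> a x y; rewrite /G nmul_linearl; apply: pure_linearl.
have Gr q b' : linear (G q b').
  by move=> a x y; rewrite /G linearP nmul_linearr; apply: pure_linearl.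
transitivity (\sum_(q : bool) G q b c); last by [].
have -> : \sum_(q : bool) G q b c = \sum_(q : bool) \sum_i \sum_j
    coord (vbasis {:D}) i b *: (coord (vbasis {:D}) j c *: G q (bas i) (bas j)).
  apply: eq_bigr => q _; rewrite {1}(sum_bas b) (linear_comb _ _ (Gl q c)).
  apply: eq_bigr => i _; rewrite {1}(sum_bas c) (linear_comb _ _ (Gr q _)).
  by rewrite scaler_sumr.
rewrite [RHS]exchange_big; apply: eq_bigr => i _; rewrite [RHS]exchange_big.
apply: eq_bigr => j _; apply: eq_bigr => q _; rewrite !ffunE linearZ /= /G.
set bi := coord _ i b; set cj := coord _ j c; set w := koszul q u.
have -> : h (bi *: w) (cj *: v) = bi *: (cj *: h w v).
  have := hl (cj *: v) bi w 0; rewrite addr0 => ->.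
  have := hr w cj v 0; rewrite addr0 => ->.
  have h0 : h 0 (cj *: v) = 0.
    by have := hl (cj *: v) (-1) 0 0; rewrite scaler0 addr0 scaleN1r addNr.
  have h1 : h w 0 = 0 by have := hr w (-1) 0 0; rewrite scaler0 addr0 scaleN1r addNr.
  by rewrite h0 h1 !addr0.
by rewrite linearZ linearZ.
Qed.

Lemma tens_tr_mul (B C : nilcdga k) (phi : nilmor B C) (U U' U2 : dgmod k)
    (h : U -> U' -> U2) (x : tensdg B U) (y : tensdg B U') :
  (forall v, linear (h^~ v)) -> (forall u, linear (h u)) ->
  tens_tr phi U2 (tmul h x y)
  = tmul h (tens_tr phi U x : tensdg C U) (tens_tr phi U' y : tensdg C U').
Proof.
move=> hl hr.
have L (y' : tensdg C U') : linear (fun x' : tensdg C U => tmul h x' y').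
  exact: tmul_linearl.
rewrite (tens_trE phi x) (tens_trE phi y) (linear_sum1 _ (L _)).
rewrite {1}/tmul linear_sum; apply: eq_bigr => i _.
rewrite (linear_sum1 _ (tmul_linearr _ hr)) linear_sum; apply: eq_bigr => j _.
rewrite tmul_pure // linear_sum; apply: eq_bigr => q _ /=.
rewrite [LHS]tmap_pure /= nilmor_mul; congr (pure (nmul _ _) _).
exact: (dgmor_part phi).
Qed.

Lemma tens_tr_act (B C : nilcdga k) (phi : nilmor B C) (sym : bool) (P : preoperad k sym)
    n (h : sym) (s : 'S_n) (x : tensdg B (P n)) :
  tens_tr phi (P n) (tens_act h s x) = tens_act h s (tens_tr phi (P n) x : tensdg C (P n)).
Proof.
rewrite (tens_trE phi x) (linear_sum1 _ (@tens_act_linear _ _ _ _ _ h s)).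
apply: eq_bigr => i _; apply/ffunP => j; rewrite !ffunE /=.
have := act_linear h s (coord (vbasis {:C}) j (phi (bas i))) (x i) 0.
have a0 : act h s (0 : P n) = 0.
  have := @act_linear _ _ P n h s (-1) 0 0.
  by rewrite scaler0 addr0 scaleN1r addNr.
by rewrite a0 !addr0 => ->.
Qed.

Definition tensop_mor (B C : nilcdga k) (phi : nilmor B C) (sym : bool) (P : preoperad k sym)
  : opmor (tensop B P) (tensop C P) :=
  @OpMor _ _ (tensop B P) (tensop C P) (fun n => tens_mor phi (P n))
    (fun n m l x y => tens_tr_mul phi x y (circ_linearl l) (circ_linearr l))
    (fun n h s x => tens_tr_act phi h s x).

Variable A : formalCdga k.

(* A_+ (x) U *)
Definition ctens (U : dgmod k) : dgmod k :=
  @limdg k (fidx A) (@fle k A) (fun i => tensdg (falg i) U) (fun i j h => tens_mor (ftr h) U).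

(* A_+ (x) P, whose space of n-ary operations is ctens (P n) *)
Definition ctensop (sym : bool) (P : preoperad k sym) : topOperad k sym :=
  @limop k (fidx A) (@fle k A) sym (fun i => tensop (falg i) P)
    (fun i j h => tensop_mor (ftr h) P).

(* the A-linear extension of psi *)
Lemma ctens_map_compat (U U' : dgmod k) (psi : {linear U -> U'}) (x : ctens U)
    i j (h : fle i j) :
  tens_mor (ftr h) U' (tmap idfun psi (proj x j)) = tmap idfun psi (proj x i).
Proof.
rewrite -(proj_compat x h) /= !tmap_comp.
by apply: eq_bigr => l _.
Qed.
Definition ctens_map (U U' : dgmod k) (psi : {linear U -> U'}) (x : ctens U) : ctens U' :=
  InvLim (ctens_map_compat psi x).

End Completed.

Section Algebras.
Variables (k : fieldType) (A : formalCdga k) (V : dgvect k).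

Definition alg_structure (sym : bool) (O : topOperad k sym) : Type :=
  topOpmor O (ctensop A (endo (Pi V) sym)).

(* (b (x) f)(a_1 (x) w_1, ..., a_n (x) w_n), for f : W^n -> W *)
Fixpoint mulext (B : nilcdga k) (W : dgmod k) n
    : tensdg B (endo_op W n) -> seq (tensdg B W) -> tensdg B W :=
  match n with
  | 0 => fun y _ => tmap idfun (@endo0 k W) y
  | n'.+1 => fun y xs =>
      @mulext B W n' (tmul (@endo_inst k W n') y (head 0 xs)) (behead xs)
  end.

Section MC.
Variables (sym : bool) (O : preoperad k sym) (m : forall n, O n.+1) (c : nat -> k).
Variable f : alg_structure (discrete O).

Definition structure_map n : ctens A (endo_op (Pi V) n.+1) := - f n.+1 (m n).

(* In each (A_+)_i the sum over n has finitely many nonzero terms. *)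
Definition isMC (xi : ctens A (Pi V)) : Prop :=
  part _ false xi = xi /\
  forall i, exists N, forall r, (N <= r)%N ->
    diff _ (proj xi i) +
    \sum_(n < r) c n.+1 *: mulext (proj (structure_map n) i) (nseq n.+1 (proj xi i)) = 0.
End MC.

Section Correspondence.
Variables (sym : bool) (O : preoperad k sym) (m : forall n, O n.+1) (c : nat -> k).

(* f is the restriction of F to O, and xi = F x *)
Definition restricts_to (F : alg_structure (adjoin m c)) (f : alg_structure (discrete O))
    (xi : ctens A (Pi V)) : Prop :=
  (forall n (a : O n), F n (adjoin_in m c a) = f n a) /\
  ctens_map (@endo0 k (Pi V)) (F 0%N (adjoin_x m c)) = xi.
End Correspondence.

End Algebras.

(* Main.v *)
From HB Require Import structures.
From mathcomp Require Import all_boot all_order all_algebra all_fingroup.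
From mathcomp Require Import boolp zify.
Require Import Defs.

Set Implicit Arguments.
Unset Strict Implicit.
Unset Printing Implicit Defensive.
Import GRing.Theory.
Local Open Scope ring_scope.

(** The completed operad O[[x]] is topologically generated by O and x.  A continuous
    map out of it is therefore determined by its restriction to O and by the image
    of x ([adjoin_mor_unique]).  The relation d x = sum_n c_n m_n o x^n holds in
    O[[x]], and a continuous map into an operad tensored with A_+ carries it to the
    Maurer-Cartan equation for the image of x ([mc_restrict]).  The translation
    between the two is [isMC_fill]: an element xi of W = Pi V is a nullary operation,
    and inserting it n times into an n-ary operation evaluates that operation at
    (xi, ..., xi).

    Conversely, let f and a Maurer-Cartan element xi be given, and let B be one of the
    finite-dimensional nilpotent algebras whose limit is A_+.  Sending x to the
    component of xi in B satisfies the relations of O[x]/(x^N) for some N: the formula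
    for d x is the Maurer-Cartan equation, and (x^N) goes to 0 because each x
    contributes a factor from B and long products in B vanish ([xpow_nilpotent]).
    So O[x]/(x^N) maps to B (x) E(W), and these maps for varying B assemble to a
    continuous map on O[[x]] ([adjoin_extend], [mc_extend]).  Nothing here is special
    to the L-infinity or the A-infinity operad: O, the m_n and the coefficients c_n
    are arbitrary.

    The universal property of O[x]/(x^N) concerns maps to dg operads, so the
    substance of the proof is that B (x) E(W) is one ([endo_isOperad],
    [tensop_isOperad]).  The axioms are multilinear and need to be checked only on
    homogeneous elements ([isOperad_span]), for which everything but the signs is
    formal.  The signs are handled in three ways.  The differential of a tensor power
    is defined by recursion on the list of arguments, which makes its square and its
    restriction to blocks easy ([Dsum]).  Partial compositions are evaluated on
    arguments cut at the slot ([endo_circE]).  The Koszul sign of a permutation is a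
    sum modulo 2 over pairs of entries of its one-line notation ([kparity]); its
    cocycle property and its behaviour under insertion of a block then reduce to
    counting which letters change sides. *)

(** * Linearity and parity *)

Section LinearProp.
Variables (k : fieldType) (U V : lmodType k).

(** Many maps below are linear in one argument only and carry no bundled structure
    in it, so that the usual lemmas on linear maps are needed for the bare
    predicate. *)
Lemma lin0 (f : U -> V) : linear f -> f 0 = 0.
Proof. by move=> fL; have := fL (-1) 0 0; rewrite scaler0 addr0 scaleN1r addNr. Qed.
Lemma linD (f : U -> V) : linear f -> {morph f : u v / u + v}.
Proof. by move=> fL u v; have := fL 1 u v; rewrite !scale1r. Qed.
Lemma linZ (f : U -> V) : linear f -> forall c u, f (c *: u) = c *: f u.
Proof. by move=> fL c u; have := fL c u 0; rewrite (lin0 fL) !addr0. Qed.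
Lemma linN (f : U -> V) : linear f -> forall u, f (- u) = - f u.
Proof. by move=> fL u; rewrite -scaleN1r (linZ fL) scaleN1r. Qed.
Lemma linB (f : U -> V) : linear f -> forall u v, f (u - v) = f u - f v.
Proof. by move=> fL u v; rewrite (linD fL) (linN fL). Qed.
Lemma lin_sum (f : U -> V) (I : Type) (r : seq I) (P : pred I) (F : I -> U) :
  linear f -> f (\sum_(i <- r | P i) F i) = \sum_(i <- r | P i) f (F i).
Proof. by move=> fL; apply: (big_morph f (linD fL) (lin0 fL)). Qed.
Lemma lin_comp (T : lmodType k) (f : V -> T) (g : U -> V) :
  linear f -> linear g -> linear (fun u => f (g u)).
Proof. by move=> fL gL a u v; rewrite gL fL. Qed.
Lemma lin_add (f g : U -> V) : linear f -> linear g -> linear (fun u => f u + g u).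
Proof. by move=> fL gL a u v; rewrite fL gL scalerDr addrACA. Qed.
Lemma lin_scale (c : k) (f : U -> V) : linear f -> linear (fun u => c *: f u).
Proof. by move=> fL a u v; rewrite fL scalerDr !scalerA mulrC. Qed.
End LinearProp.

Lemma signZ_addb (k : fieldType) (U : lmodType k) (p q : bool) (u : U) :
  (-1) ^+ p *: ((-1) ^+ q *: u) = (-1) ^+ (p (+) q) *: u.
Proof. by rewrite scalerA signr_addb. Qed.
Lemma signZK (k : fieldType) (U : lmodType k) (p : bool) (u : U) :
  (-1) ^+ p *: ((-1) ^+ p *: u) = u.
Proof. by rewrite signZ_addb addbb scale1r. Qed.

Lemma sgnD (k : fieldType) (W : dgmod k) (u v : W) : sgn (u + v) = sgn u + sgn v.
Proof. exact: (linD (@sgn_linear _ W)). Qed.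
Lemma sgnZ (k : fieldType) (W : dgmod k) c (u : W) : sgn (c *: u) = c *: sgn u.
Proof. exact: (linZ (@sgn_linear _ W)). Qed.
Lemma sgnN (k : fieldType) (W : dgmod k) (u : W) : sgn (- u) = - sgn u.
Proof. exact: (linN (@sgn_linear _ W)). Qed.

Lemma partD (k : fieldType) (W : dgmod k) p (u v : W) : part W p (u + v) = part W p u + part W p v.
Proof. exact: linearD. Qed.
Lemma partZr (k : fieldType) (W : dgmod k) p c (u : W) : part W p (c *: u) = c *: part W p u.
Proof. exact: linearZ. Qed.
Lemma diffD (k : fieldType) (W : dgmod k) (u v : W) : diff W (u + v) = diff W u + diff W v.
Proof. exact: linearD. Qed.
Lemma diffZ (k : fieldType) (W : dgmod k) c (u : W) : diff W (c *: u) = c *: diff W u.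
Proof. exact: linearZ. Qed.

Section Parity.
Variables (k : fieldType) (W : dgmod k) (dgW : isDg W).
Implicit Types (v w : W) (p q : bool).

Lemma sgn_hom p v : part W p v = v -> sgn v = (-1) ^+ p *: v.
Proof.
move=> <-; rewrite /sgn !(dg_partK dgW).
by case: p; rewrite /= ?subr0 ?sub0r ?scale1r ?scaleN1r.
Qed.
Lemma sgn_part p v : sgn (part W p v) = part W p (sgn v).
Proof. by rewrite /sgn linearB /= !(dg_partK dgW); case: p. Qed.
Lemma hom_ind (P : W -> Prop) :
  (forall u v, P u -> P v -> P (u + v)) -> (forall p v, part W p v = v -> P v) ->
  forall v, P v.
Proof.
by move=> PD Ph v; rewrite -(dg_part_sum dgW v); apply: PD; [apply: (Ph false)|apply: (Ph true)];
  rewrite (dg_partK dgW).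
Qed.
Lemma part_hom p q v : part W p v = v -> part W q v = if q == p then v else 0.
Proof. by move=> <-; rewrite (dg_partK dgW); case: eqP => // ->. Qed.
Lemma sgnK v : sgn (sgn v) = v.
Proof.
elim/hom_ind: v => [u v IHu IHv|p v hv]; first by rewrite (sgnD u v) sgnD IHu IHv.
by rewrite !(sgn_hom hv) sgnZ (sgn_hom hv) signZK.
Qed.
Lemma sgn_diff v : sgn (diff W v) = - diff W (sgn v).
Proof. by rewrite /sgn linearB /= !(dg_odd dgW) opprB. Qed.
Lemma koszulD p q v : koszul p (koszul q v) = koszul (p (+) q) v.
Proof. by case: p; case: q => //=; rewrite sgnK. Qed.
Lemma koszul_hom p q v : part W p v = v -> koszul q v = (-1) ^+ (q && p) *: v.
Proof. by move=> hv; case: q => /=; rewrite ?scale1r // (sgn_hom hv). Qed.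
Lemma diff_hom p v : part W p v = v -> part W (~~ p) (diff W v) = diff W v.
Proof. by move=> hv; rewrite -(dg_odd dgW) hv. Qed.

Hypothesis two : (2 : k) != 0.

Lemma partE p v : part W p v = 2^-1 *: (v + (-1) ^+ p *: sgn v).
Proof.
apply: (scalerI two); rewrite scalerA mulfV // scale1r scaler_nat mulr2n.
have -> : v + (-1) ^+ p *: sgn v
    = part W false v + part W true v + (-1) ^+ p *: (part W false v - part W true v).
  by rewrite (dg_part_sum dgW).
case: p; rewrite ?scaleN1r ?scale1r ?opprB; last by rewrite addrACA addrN addr0.
by rewrite [X in _ = X + _]addrC [RHS]addrACA addrN addr0.
Qed.
(** Away from characteristic 2 the parities are the eigenspaces of the involution
    [sgn]; for maps between graded spaces this is the convenient description. *)
Lemma hom_sgnP p v : part W p v = v <-> sgn v = (-1) ^+ p *: v.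
Proof.
split; first exact: sgn_hom.
move=> E; rewrite partE E signZK -mulr2n -scaler_nat scalerA mulVf ?scale1r //.
Qed.
End Parity.

(** * The differential of a tensor power *)

Section Dsum.
Variables (k : fieldType) (W : dgmod k).

(** The length of the list is left free: fixing some entries of such a function
    gives again such a function, which is what inductions over lists need. *)
Definition mlinear (f : seq W -> W) := forall s1 s2 a u v,
  f (s1 ++ (a *: u + v) :: s2) = a *: f (s1 ++ u :: s2) + f (s1 ++ v :: s2).

Lemma mlinear_slot f s1 s2 : mlinear f -> linear (fun w => f (s1 ++ w :: s2)).
Proof. by move=> fL a u v; apply: fL. Qed.
Lemma mlinear_cat f s1 s2 : mlinear f -> mlinear (fun s => f (s1 ++ s ++ s2)).
Proof. by move=> fL t1 t2 a u v /=; rewrite -!catA !cat_cons !catA -!catA catA fL -!catA. Qed.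
Lemma mlinear_cons f w : mlinear f -> mlinear (fun s => f (w :: s)).
Proof. by move=> fL t1 t2 a u v /=; rewrite -!cat_cons fL. Qed.

(** The composite of f with the differential of a tensor power of W.  The Koszul
    sign of d passing the first argument is absorbed into f by replacing that
    argument w with [sgn w]. *)
Fixpoint Dsum (f : seq W -> W) (s : seq W) : W :=
  if s is w :: s' then f (diff W w :: s') + Dsum (fun x => f (sgn w :: x)) s' else 0.

Lemma DsumE f s :
  Dsum f s = \sum_(i < size s) f (map (@sgn k W) (take i s) ++ diff W (nth 0 s i) :: drop i.+1 s).
Proof.
elim: s f => [|w s IH] f /=; first by rewrite big_ord0.
by rewrite big_ord_recl /= drop0 IH.
Qed.

Lemma eq_Dsum_size f g s : (forall x, size x = size s -> f x = g x) -> Dsum f s = Dsum g s.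
Proof.
elim: s f g => [//|w s IH] f g fg /=; rewrite fg //; congr (_ + _).
by apply: IH => x xs; rewrite fg //= xs.
Qed.
Lemma eq_Dsum f g : f =1 g -> Dsum f =1 Dsum g.
Proof. by move=> fg s; apply: eq_Dsum_size. Qed.

Lemma Dsum_cat f s1 s2 : Dsum f (s1 ++ s2) =
  Dsum (fun x => f (x ++ s2)) s1 + Dsum (fun x => f (map (@sgn k W) s1 ++ x)) s2.
Proof.
elim: s1 f => [|w s1 IH] f /=; first by rewrite add0r; apply: eq_Dsum.
by rewrite IH addrA.
Qed.

Lemma Dsum_lin a f g s : Dsum (fun x => a *: f x + g x) s = a *: Dsum f s + Dsum g s.
Proof.
elim: s f g => [|w s IH] f g /=; first by rewrite scaler0 addr0.
by rewrite IH !scalerDr addrACA.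
Qed.
Lemma DsumZ a f s : Dsum (fun x => a *: f x) s = a *: Dsum f s.
Proof.
elim: s f => [|w s IH] f /=; first by rewrite scaler0.
by rewrite IH !scalerDr.
Qed.
Lemma Dsum_linear (h : W -> W) f s : linear h -> Dsum (fun x => h (f x)) s = h (Dsum f s).
Proof.
move=> hL; elim: s f => [|w s IH] f /=; first by rewrite (lin0 hL).
by rewrite IH (linD hL).
Qed.

Hypothesis dgW : isDg W.

(** The differential anticommutes with the parity involution of a tensor power. *)
Lemma Dsum_koszul q f s :  mlinear f ->
  Dsum (fun x => f (map (@koszul k W q) x)) s = (-1) ^+ q *: Dsum f (map (@koszul k W q) s).
Proof.
elim: s f => [|w s IH] f fL /=; first by rewrite scaler0.
have fL' v := mlinear_cons v fL.
rewrite (IH (fun x => f (koszul q (sgn w) :: x))) // scalerDr; clear IH; congr (_ + _ *: Dsum _ _).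
  case: q => /=; rewrite ?scale1r // sgn_diff // scaleN1r.
  exact: (linN (mlinear_slot [::] _ fL)).
by apply: functional_extensionality_dep => x; case: q.
Qed.

(** Besides d d w = 0 in a single slot, each pair of slots contributes two terms,
    which cancel because [sgn] and d anticommute. *)
Lemma Dsum_sq0 f s : mlinear f -> Dsum (Dsum f) s = 0.
Proof.
elim: s f => [//|w s IH] f fL /=; rewrite (dg_sq0 dgW).
have h0 := lin0 (mlinear_slot [::] s fL); rewrite /= in h0.
rewrite h0 add0r.
have -> : Dsum (fun x => f (diff W (sgn w) :: x) + Dsum (fun x0 => f (sgn (sgn w) :: x0)) x) s
  = Dsum (fun x => f (diff W (sgn w) :: x)) s.
  rewrite -[RHS]addr0 -(IH _ (mlinear_cons (sgn (sgn w)) fL)).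
  rewrite -[X in _ = X + _]scale1r -Dsum_lin.
  by apply: eq_Dsum => x; rewrite scale1r.
rewrite -[X in X + _]scale1r -Dsum_lin.
transitivity (Dsum (fun x => 0 *: (0 : W)) s); last by rewrite DsumZ scale0r.
apply: eq_Dsum => x; rewrite scale0r scale1r sgn_diff //.
by rewrite (linN (mlinear_slot [::] x fL)) /= addNr.
Qed.
End Dsum.

(** * Checking the operad axioms on spanning elements *)

Lemma castop_lin (k : fieldType) (sym : bool) (P : preoperad k sym) n m (e : n = m) : linear (castop e : P n -> P m).
Proof. by case: m / e => a u v. Qed.

(** Operadic identities are multilinear and will be checked on spanning sets; this
    discharges the linearity of their two sides in one variable. *)
Ltac lin :=
  (* Backtracking is needed: the patterns for circ also match when the argument
     called b depends on the bound variable, and then fail. *)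
  match goal with
  | |- GRing.linear_for _ (fun a => @?f a + @?g a) => apply: (lin_add (f := f) (g := g)); lin
  | |- GRing.linear_for _ (fun a => ?c *: @?g a) => apply: (lin_scale c (f := g)); lin
  | |- GRing.linear_for _ (fun a => castop ?e (@?g a)) =>
      first [exact: castop_lin | apply: (lin_comp (f := castop e) (g := g)); [exact: castop_lin | lin]]
  | |- GRing.linear_for _ (fun a => circ ?i (@?g a) ?b) =>
      first [exact: circ_linearl | apply: (lin_comp (f := fun x => circ i x b) (g := g));
        [exact: circ_linearl | lin]]
  | |- GRing.linear_for _ (fun a => circ ?i ?b (@?g a)) =>
      first [apply: circ_linearr | apply: (lin_comp (f := fun x => circ i b x) (g := g));
        [apply: circ_linearr | lin]]
  | |- GRing.linear_for _ (fun a => act ?h ?s (@?g a)) =>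
      first [exact: act_linear | apply: (lin_comp (f := act h s) (g := g));
        [exact: act_linear | lin]]
  | |- GRing.linear_for _ (fun a => @GRing.Linear.sort _ _ _ _ ?h (@?g a)) =>
      first [exact: linearP | apply: (lin_comp (f := fun x => h x) (g := g)); [exact: linearP | lin]]
  | |- GRing.linear_for _ (fun a => sgn (@?g a)) =>
      first [exact: sgn_linear | apply: (lin_comp (f := @sgn _ _) (g := g));
        [exact: sgn_linear | lin]]
  | |- GRing.linear_for _ (fun a => a) => by move=> ? ? ?
  | _ => first [exact: circ_linearl | apply: circ_linearr | exact: act_linear | exact: linearP]
  end.

Section Spanning.
Variables (k : fieldType) (sym : bool).

Definition spanning (U : lmodType k) (S : U -> Prop) : Prop :=
  forall (V : lmodType k) (F G : U -> V), linear F -> linear G ->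
  (forall u, S u -> F u = G u) -> forall u, F u = G u.

Lemma hom_spanning (U : dgmod k) : isDg U -> spanning (fun u : U => exists p, part U p u = u).
Proof.
move=> dgU V F G FL GL FG; apply: (hom_ind dgU) => [u v Fu Fv|p u hu].
  by rewrite (linD FL) (linD GL) Fu Fv.
by apply: FG; exists p.
Qed.

Section Span.
Variables (P : preoperad k sym) (S : forall n, bool -> P n -> Prop).
Hypotheses (dgP : forall n, isDg (P n))
  (Shom : forall n p (a : P n), S p a -> part _ p a = a)
  (Sspan : forall n, spanning (fun a : P n => exists p, S p a)).

Lemma span_lin n (V : lmodType k) (F G : P n -> V) : linear F -> linear G ->
  (forall p a, S p a -> F a = G a) -> forall a, F a = G a.
Proof. by move=> FL GL FG; apply: Sspan => // a [p Sa]; apply: FG Sa. Qed.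

Hypothesis Spart : forall n m (i : 'I_n) (a : P n) (b : P m) p q, S p a -> S q b ->
  part _ (p (+) q) (circ i a b) = circ i a b.
Hypothesis Sdiff : forall n m (i : 'I_n) (a : P n) (b : P m) p q, S p a -> S q b ->
  diff _ (circ i a b) = circ i (diff _ a) b + (-1) ^+ p *: circ i a (diff _ b).
Hypothesis Sseq : forall n m p (i : 'I_n) (j : 'I_m) (l : 'I_(n + m).-1)
    (a : P n) (b : P m) (c : P p) u v w e, S u a -> S v b -> S w c ->
  l = (i + j)%N :> nat -> castop e (circ l (circ i a b) c) = circ i a (circ j b c).
Hypothesis Spar : forall n m p (i j : 'I_n) (j' : 'I_(n + m).-1) (i' : 'I_(n + p).-1)
    (a : P n) (b : P m) (c : P p) u v w e, S u a -> S v b -> S w c ->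
  (i < j)%N -> j' = (j + m).-1 :> nat -> i' = i :> nat ->
  castop e (circ j' (circ i a b) c) = (-1) ^+ (v && w) *: circ i' (circ j a c) b.
Hypothesis Sact1 : forall n h (a : P n) p, S p a -> act h 1%g a = a.
Hypothesis SactM : forall n h (s t : 'S_n) (a : P n) p, S p a ->
  act h (s * t)%g a = act h t (act h s a).
Hypothesis Sact_part : forall n h (s : 'S_n) p (a : P n), S p a ->
  part _ p (act h s a) = act h s a.
Hypothesis Sact_diff : forall n h (s : 'S_n) (a : P n) p, S p a ->
  act h s (diff _ a) = diff _ (act h s a).
Hypothesis Scirc_act : forall n m h (s : 'S_n) (t : 'S_m) (l : 'I_n)
    (r : 'S_(n + m).-1) (a : P n) (b : P m) p q, S p a -> S q b ->
  (forall (j : 'I_n) (x : 'I_(n + m).-1), j != l -> x = outer m l j :> nat ->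
     r x = outer m (s l) (s j) :> nat) ->
  (forall (j : 'I_m) (x : 'I_(n + m).-1), x = (l + j)%N :> nat ->
     r x = (s l + t j)%N :> nat) ->
  circ (s l) (act h s a) (act h t b) = act h r (circ l a b).

Let partL n p : linear (part (P n) p). Proof. exact: linearP. Qed.
Let partZ n p q (a : P n) : S p a -> part _ q a = (p == q)%:R *: a.
Proof.
move=> Sa; rewrite (part_hom (dgP n) q (Shom Sa)) eq_sym.
by case: eqP; rewrite ?scale1r ?scale0r.
Qed.

(** All axioms are multilinear, so homogeneous elements that span suffice; there
    the Koszul signs are explicit powers of -1. *)
Lemma isOperad_span : isOperad P.
Proof.
split=> //.
- move=> n m i a b p q; move: a; apply: span_lin => [||p' a Sa]; [lin|lin|].
  move: b; apply: span_lin => [||q' b Sb]; [lin|lin|].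
  rewrite (partZ p Sa) (partZ q Sb) !(linZ (circ_linearl i _)) !(linZ (circ_linearr i _)) !(linZ (partL _)).
  case: eqP => [<-|_]; last by rewrite !scale0r.
  case: eqP => [<-|_]; last by rewrite !scale0r !scaler0.
  by rewrite (Spart i Sa Sb).
- move=> n m i a b; move: a; apply: span_lin => [||p a Sa]; [lin|lin|].
  move: b; apply: span_lin => [||q b Sb]; [lin|lin|].
  by rewrite (Sdiff i Sa Sb) (sgn_hom (dgP _) (Shom Sa)) (linZ (circ_linearl i _)).
- move=> n m p i j l a b c e lij; move: a; apply: span_lin => [||u a Sa]; [lin|lin|].
  move: b; apply: span_lin => [||v b Sb]; [lin|lin|].
  move: c; apply: span_lin => [||w c Sc]; [lin|lin|].
  exact: Sseq Sa Sb Sc lij.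
- move=> n m p i j j' i' a b c u v e ij ej ei; move: a; apply: span_lin => [||w a Sa]; [lin|lin|].
  move: b; apply: span_lin => [||u' b Sb]; [lin|lin|].
  move: c; apply: span_lin => [||v' c Sc]; [lin|lin|].
  rewrite (partZ u Sb) (partZ v Sc) !(linZ (circ_linearr _ _)) !(linZ (circ_linearl _ _)) ?(linZ (circ_linearr _ _)).
  rewrite !(linZ (castop_lin _)).
  case: eqP => [<-|_]; last by rewrite !scale0r !scaler0.
  case: eqP => [<-|_]; last by rewrite !scale0r !scaler0.
  by rewrite !scale1r (Spar e Sa Sb Sc ij ej ei).
- move=> n h; apply: span_lin => [||p a]; [lin|lin|exact: Sact1].
- move=> n h s t; apply: span_lin => [||p a]; [lin|lin|exact: SactM].
- move=> n h s p; apply: span_lin => [||q a Sa]; [lin|lin|].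
  rewrite (partZ p Sa) (linZ (act_linear h s)) (part_hom (dgP _) p (Sact_part h s Sa)) eq_sym.
  by case: eqP => _; rewrite ?scale1r ?scale0r.
- move=> n h s; apply: span_lin => [||p a Sa]; [lin|lin|].
  exact: Sact_diff Sa.
move=> n m h s t l r a b r1 r2; move: a; apply: span_lin => [||p a Sa]; [lin|lin|].
move: b; apply: span_lin => [||q b Sb]; [lin|lin|].
exact: Scirc_act Sa Sb r1 r2.
Qed.
End Span.
End Spanning.

(** * The endomorphism operad: complexes and partial compositions *)

Section Endo.
Variables (k : fieldType) (W : dgmod k) (dgW : isDg W) (two : (2 : k) != 0).
Local Notation eps := (@sgn k W).

Lemma mlin_mlinear n (f : mlin W n) : mlinear f.
Proof. by move=> s1 s2 a u v; apply: mlinP. Qed.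

Lemma map_koszulD p q (s : seq W) :
  map (@koszul k W p) (map (@koszul k W q) s) = map (@koszul k W (p (+) q)) s.
Proof. by rewrite -map_comp; apply: eq_map => w /=; apply: koszulD. Qed.
Lemma map_koszul0 (s : seq W) : map (@koszul k W false) s = s.
Proof. exact: map_id. Qed.

Lemma endo_partE n p (f : endo_op W n) s :
  mfun (part (endo_op W n) p f) s = 2^-1 *: (mfun f s + (-1) ^+ p *: eps (mfun f (map eps s))).
Proof.
rewrite /= /endo_part_fun /guard; case: ifP => // /negbT sn.
by rewrite !mlin_size ?size_map // linear0 scaler0 addr0 scaler0.
Qed.

Lemma scale2K (U : lmodType k) (u : U) : 2^-1 *: (u + u) = u.
Proof. by rewrite -mulr2n -scaler_nat scalerA mulVf ?scale1r. Qed.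

(** The parity of maps is defined by conjugation with the involution [sgn], so this is
    the analogue of [hom_sgnP]. *)
Lemma endo_homP n p (f : endo_op W n) :
  part (endo_op W n) p f = f <-> forall s, eps (mfun f s) = (-1) ^+ p *: mfun f (map eps s).
Proof.
have epsK s : map eps (map eps s) = s.
  by rewrite -map_comp -[RHS]map_id; apply: eq_map => w /=; apply: sgnK.
split=> [hf s|hf].
  rewrite -hf !endo_partE epsK linearZ /= sgnD sgnZ sgnK // scalerA mulrC -scalerA.
  by congr (_ *: _); rewrite scalerDr signZK addrC.
by apply: mlin_ext => s; rewrite endo_partE hf epsK signZK scale2K.
Qed.

Lemma koszul_mlin n p q (f : endo_op W n) s : part (endo_op W n) p f = f ->
  koszul q (mfun f s) = (-1) ^+ (q && p) *: mfun f (map (@koszul k W q) s).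
Proof.
move=> hf; case: q => /=; first by move/endo_homP: hf => ->.
by rewrite scale1r map_koszul0.
Qed.

Lemma endo_part_hom n p q (f : endo_op W n) : part (endo_op W n) p f = f ->
  part (endo_op W n) q f = if q == p then f else 0.
Proof.
move=> hf; case: eqP => [->//|/eqP qp]; apply: mlin_ext => s.
have epsK : map eps (map eps s) = s.
  by rewrite -map_comp -[RHS]map_id; apply: eq_map => w /=; apply: sgnK.
move/endo_homP: hf => hf; rewrite endo_partE hf epsK signZ_addb.
by case: p q qp {hf} => -[] // _; rewrite scaleN1r subrr scaler0.
Qed.

Lemma endo_part_idem n p (f : endo_op W n) :
  part (endo_op W n) p (part (endo_op W n) p f) = part (endo_op W n) p f.
Proof.
apply/endo_homP => s; rewrite !endo_partE.
have -> : map eps (map eps s) = s.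
  by rewrite -map_comp -[RHS]map_id; apply: eq_map => w /=; apply: sgnK.
rewrite sgnZ sgnD sgnZ sgnK // [RHS]scalerA mulrC -[RHS]scalerA.
by rewrite [in RHS]scalerDr signZK addrC.
Qed.

Lemma endo_part_sum n (f : endo_op W n) :
  part (endo_op W n) false f + part (endo_op W n) true f = f.
Proof.
apply: mlin_ext => s.
have -> : mfun (part (endo_op W n) false f + part (endo_op W n) true f) s
  = mfun (part (endo_op W n) false f) s + mfun (part (endo_op W n) true f) s by [].
by rewrite !endo_partE -scalerDr scale1r scaleN1r addrACA subrr addr0 scale2K.
Qed.

Lemma endo_hom_ind n (P : endo_op W n -> Prop) :
  (forall f g, P f -> P g -> P (f + g)) ->
  (forall p f, part (endo_op W n) p f = f -> P f) -> forall f, P f.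
Proof.
move=> PD Ph f; rewrite -(endo_part_sum f).
by apply: PD; [apply: (Ph false)|apply: (Ph true)]; apply: endo_part_idem.
Qed.

Lemma endo_diffE n p (f : endo_op W n) s : part (endo_op W n) p f = f ->
  mfun (diff (endo_op W n) f) s = diff W (mfun f s) - (-1) ^+ p *: Dsum (mfun f) s.
Proof.
move=> hf; rewrite /= /endo_diff_fun /guard.
have -> : endo_sgn f = (-1) ^+ p *: f.
  rewrite /endo_sgn -!/(part (endo_op W n) _ f) !(endo_part_hom _ hf).
  by case: (p); rewrite ?subr0 ?sub0r ?scale1r ?scaleN1r.
have [sn|sn] := eqVneq (size s) n.
  by rewrite DsumE scaler_sumr sn.
rewrite mlin_size // linear0 DsumE big1 ?scaler0 ?subr0 // => i _.
rewrite mlin_size //; apply: contraNneq sn => <-.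
by rewrite size_cat /= size_map size_take size_drop ltn_ord addnS -addSn subnKC.
Qed.

(** Both w |-> d (f w) and f o d change the parity, since d anticommutes with the
    parity involution on W and on its tensor powers. *)
Lemma endo_diff_hom n p (f : endo_op W n) : part (endo_op W n) p f = f ->
  part (endo_op W n) (~~ p) (diff _ f) = diff _ f.
Proof.
move=> hf; apply/endo_homP => s; rewrite !(endo_diffE _ hf).
rewrite sgnD sgnN sgnZ (sgn_diff dgW) [RHS]scalerBr.
move/endo_homP: (hf) => hf'; rewrite hf' linearZ /=.
rewrite -(Dsum_linear _ _ (@sgn_linear _ W)) (eq_Dsum hf') DsumZ.
rewrite (@Dsum_koszul _ _ dgW true _ s (mlin_mlinear f)) /= expr1 !scaleN1r.
by case: p {hf hf'} => /=; rewrite ?scale1r ?scaleN1r ?opprK ?scalerN ?scaleN1r ?opprK.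
Qed.

(** For f of parity p, d f = d o f - (-1)^p f o d; applied twice, the squares
    vanish, and the two mixed terms cancel because d f has parity p + 1. *)
Lemma endo_isDg n : isDg (endo_op W n).
Proof.
split=> [p q f|f|p f|f].
- by rewrite (endo_part_hom _ (endo_part_idem q f)).
- exact: endo_part_sum.
- rewrite -{2}(endo_part_sum f) linearD linearD /=.
  have h0 := endo_diff_hom (endo_part_idem false f).
  have h1 := endo_diff_hom (endo_part_idem true f).
  rewrite -!/(part (endo_op W n) _ _) -!/(diff (endo_op W n) _) in h0 h1 *.
  rewrite (endo_part_hom _ h0) (endo_part_hom _ h1).
  by case: p; rewrite /= ?addr0 ?add0r.
elim/endo_hom_ind: f => [f g hf hg|p f hf]; first by rewrite !linearD hf hg addr0.
apply: mlin_ext => s; rewrite (endo_diffE _ (endo_diff_hom hf)) (endo_diffE _ hf).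
rewrite (eq_Dsum (fun x => endo_diffE x hf)).
have -> : Dsum (fun x => diff W (mfun f x) - (-1) ^+ p *: Dsum (mfun f) x) s = diff W (Dsum (mfun f) s).
  rewrite -[RHS](Dsum_linear _ _ (linearP (diff W))) -[RHS]addr0 -[X in _ = _ + X](scaler0 _ (- (-1) ^+ p)).
  rewrite -[X in _ = _ + _ *: X](Dsum_sq0 dgW s (mlin_mlinear f)) addrC -Dsum_lin.
  by apply: eq_Dsum => x; rewrite scaleNr addrC.
rewrite linearB linearZ /= (dg_sq0 dgW) sub0r.
by case: p {hf} => /=; rewrite ?scale1r ?scaleN1r ?opprK ?subrr // addNr.
Qed.

End Endo.

Section EndoCirc.
Variables (k : fieldType) (W : dgmod k) (dgW : isDg W) (two : (2 : k) != 0) (sym : bool).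
Local Notation eps := (@sgn k W).
Local Notation E := (endo W sym).
Local Notation kz := (@koszul k W).

Lemma castop_mlin n m (e : n = m) (f : E n) s : mfun (castop e f : E m) s = mfun f s.
Proof. by case: m / e. Qed.

Lemma mfunZ n c (f : E n) s : mfun (c *: f) s = c *: mfun f s.
Proof. by []. Qed.
Lemma mfunD n (f g : E n) s : mfun (f + g) s = mfun f s + mfun g s.
Proof. by []. Qed.

(** Cutting the arguments at the slot replaces all index arithmetic.  The length of
    s3 is free because both sides vanish when the number of arguments is wrong. *)
Lemma endo_circE n m p (i : 'I_n) (f : E n) (g : E m) s1 s2 s3 :
  part _ p g = g -> size s1 = i -> size s2 = m ->
  mfun (circ i f g) (s1 ++ s2 ++ s3) = mfun f (map (kz p) s1 ++ mfun g s2 :: s3).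
Proof.
move=> hg z1 z2; rewrite /= /endo_circ_fun /guard.
have -> : (size (s1 ++ s2 ++ s3) == (n + m).-1) = (size (map (kz p) s1 ++ mfun g s2 :: s3) == n).
  by rewrite !size_cat /= size_map z1 z2; have := ltn_ord i; lia.
case: ifP => [_|/negbT sn]; last by rewrite mlin_size.
rewrite (bigD1 p) //= big1 ?addr0 => [|q qp].
  have hg' : endo_part_fun p g = mfun g := congr1 (@mfun _ _ m) hg.
  rewrite hg' (take_size_cat _ z1) (drop_size_cat _ z1) (take_size_cat _ z2).
  by rewrite catA (drop_size_cat s3) // size_cat z1 z2.
have h0 := congr1 (@mfun _ _ m) (endo_part_hom dgW two q hg).
rewrite (negPf qp) in h0; rewrite (_ : endo_part_fun q g = mfun (0 : mlin W m)); last exact: h0.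
exact: lin0 (mlinear_slot _ _ (mlin_mlinear f)).
Qed.

Lemma mlin_split3 n m i (F G : E (n + m).-1) : (i < n)%N ->
  (forall s1 s2 s3, size s1 = i -> size s2 = m -> mfun F (s1 ++ s2 ++ s3) = mfun G (s1 ++ s2 ++ s3)) ->
  F = G.
Proof.
move=> ltin FG; apply: mlin_ext => s.
have [sn|sn] := eqVneq (size s) (n + m).-1; last by rewrite !mlin_size.
rewrite -(cat_take_drop i s) -[drop i s](cat_take_drop m); apply: FG.
  by rewrite size_takel //; lia.
by rewrite size_takel // size_drop; lia.
Qed.

Lemma endo_circ_hom n m p q (i : 'I_n) (f : E n) (g : E m) :
  part _ p f = f -> part _ q g = g -> part _ (p (+) q) (circ i f g) = circ i f g.
Proof.
move=> hf hg; apply/(endo_homP dgW two) => s; move: s.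
suff H s1 s2 s3 : size s1 = i -> size s2 = m ->
    eps (mfun (circ i f g) (s1 ++ s2 ++ s3))
    = (-1) ^+ (p (+) q) *: mfun (circ i f g) (map eps (s1 ++ s2 ++ s3)).
  move=> s; have [sn|sn] := eqVneq (size s) (n + m).-1; last first.
    by rewrite !mlin_size ?size_map // linear0 scaler0.
  rewrite -(cat_take_drop i s) -[drop i s](cat_take_drop m); apply: H.
    by rewrite size_takel //; have := ltn_ord i; lia.
  by rewrite size_takel // size_drop; have := ltn_ord i; lia.
move=> z1 z2; rewrite (endo_circE _ _ hg) // !map_cat (endo_circE _ _ hg) ?size_map //.
move/(endo_homP dgW two): hf => ->; move/(endo_homP dgW two): (hg) => hg'.
rewrite map_cat /= hg' (linZ (mlinear_slot _ _ (mlin_mlinear f))) signZ_addb.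
congr (_ *: mfun f (_ ++ _)); rewrite -!map_comp; apply: eq_map => w /=.
by rewrite -[eps (kz q w)]/(kz true (kz q w)) -[eps w]/(kz true w) !koszulD // addbC.
Qed.


(** The differential of the arguments is the sum of its parts on the three blocks
    around the slot.  The outer two, and d o f, also occur in the composition of d f with g.
    In that composition d moreover meets the value of g; this term cancels against
    its counterpart in the composition of f with d g, which leaves the middle block
    there. *)
Lemma endo_circ_diff n m (i : 'I_n) (f : E n) (g : E m) p q :
  part _ p f = f -> part _ q g = g ->
  diff _ (circ i f g) = circ i (diff _ f) g + (-1) ^+ p *: circ i f (diff _ g).
Proof.
move=> hf hg; apply: (mlin_split3 (ltn_ord i)) => s1 s2 s3 z1 z2.
rewrite (endo_diffE dgW two _ (endo_circ_hom i hf hg)).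
rewrite mfunD mfunZ (endo_circE _ _ hg) // (endo_circE _ _ hg) //.
rewrite (endo_circE _ _ (endo_diff_hom dgW two hg)) //.
rewrite (endo_diffE dgW two _ hf) (endo_diffE dgW two _ hg).
have fL := mlin_mlinear f.
rewrite (linB (mlinear_slot _ _ fL)) (linZ (mlinear_slot _ _ fL)) !Dsum_cat /=.
have map_eps q' s : map eps (map (kz q') s) = map (kz (~~ q')) s.
  exact: (map_koszulD dgW true).
have e1 : Dsum (fun x => mfun (circ i f g) (x ++ s2 ++ s3)) s1
    = (-1) ^+ q *: Dsum (fun x => mfun f (x ++ mfun g s2 :: s3)) (map (kz q) s1).
  rewrite -(Dsum_koszul dgW _ _ (mlinear_cat [::] _ fL)).
  by apply: eq_Dsum_size => x xs; rewrite (endo_circE _ _ hg) // xs.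
have e2 : Dsum (fun x => mfun (circ i f g) (map eps s1 ++ x ++ s3)) s2
    = mfun f (map (kz (~~ q)) s1 ++ Dsum (mfun g) s2 :: s3).
  rewrite -(Dsum_linear _ _ (mlinear_slot _ _ fL)); apply: eq_Dsum_size => x xs.
  by rewrite (endo_circE _ _ hg) ?size_map // ?xs // (map_koszulD dgW q true) addbT.
have e3 : Dsum (fun x => mfun (circ i f g) (map eps s1 ++ map eps s2 ++ x)) s3
    = (-1) ^+ q *: Dsum (fun x => mfun f (map (kz (~~ q)) s1 ++ eps (mfun g s2) :: x)) s3.
  rewrite -DsumZ; apply: eq_Dsum => x; rewrite -(linZ (mlinear_slot _ _ fL)).
  rewrite (endo_circE _ _ hg) ?size_map // (map_koszulD dgW q true) addbT.
  by move/(endo_homP dgW two): (hg) => ->; rewrite signZK.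
rewrite e1 e2 e3 map_eps -signZ_addb -[RHS]addrA; congr (_ + _).
rewrite [RHS]addrC -scalerBr -[LHS]scalerN; congr (_ *: _).
by rewrite !scalerDr !signZK !opprD [RHS]addrCA [X in _ = _ + X]addrACA subrr add0r.
Qed.

(** The sign of the composite of b and c in front of the slot i is the product of
    the sign of b and of that of c there; c also passes the arguments of b in
    front of its own slot, in both bracketings. *)
Lemma endo_circ_seq n m p (i : 'I_n) (j : 'I_m) (l : 'I_(n + m).-1)
    (a : E n) (b : E m) (c : E p) v w e : part _ v b = b -> part _ w c = c ->
  l = (i + j)%N :> nat -> castop e (circ l (circ i a b) c) = circ i a (circ j b c).
Proof.
move=> hb hc el; apply: (mlin_split3 (ltn_ord i)) => s1 s s3 z1 z; rewrite castop_mlin.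
rewrite (endo_circE _ _ (endo_circ_hom j hb hc)) //.
pose t1 := take j s; pose t2 := take p (drop j s); pose t3 := drop p (drop j s).
have es : s = t1 ++ t2 ++ t3 by rewrite /t1 /t2 /t3 !cat_take_drop.
have y1 : size t1 = j by rewrite size_takel //; have := ltn_ord j; lia.
have y2 : size t2 = p by rewrite size_takel // size_drop; have := ltn_ord j; lia.
have y3 : size t3 = (m - j.+1)%N by rewrite !size_drop z; have := ltn_ord j; lia.
have -> : mfun (circ j b c) s = mfun b (map (kz w) t1 ++ mfun c t2 :: t3).
  by rewrite es (endo_circE _ _ hc).
have -> : s1 ++ s ++ s3 = (s1 ++ t1) ++ t2 ++ (t3 ++ s3) by rewrite es -!catA.
rewrite (endo_circE _ _ hc) // ?size_cat ?z1 ?y1 ?el //.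
have -> : map (kz w) (s1 ++ t1) ++ mfun c t2 :: t3 ++ s3
    = map (kz w) s1 ++ (map (kz w) t1 ++ mfun c t2 :: t3) ++ s3.
  by rewrite map_cat -!catA.
rewrite (endo_circE _ _ hb) ?size_map // ?map_koszulD //.
by rewrite size_cat /= size_map y1 y3; have := ltn_ord j; lia.
Qed.

(** In (a o b) o c the operation c passes the arguments of b; in (a o c) o b it passes
    the value of b, whose parity differs from theirs by that of b.  Hence the sign
    (-1)^(|b||c|). *)
Lemma endo_circ_par n m p (i j : 'I_n) (j' : 'I_(n + m).-1) (i' : 'I_(n + p).-1)
    (a : E n) (b : E m) (c : E p) v w e : part _ v b = b -> part _ w c = c ->
  (i < j)%N -> j' = (j + m).-1 :> nat -> i' = i :> nat ->
  castop e (circ j' (circ i a b) c) = (-1) ^+ (v && w) *: circ i' (circ j a c) b.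
Proof.
move=> hb hc ij ej ei; apply: mlin_ext => s.
have [sn|sn] := eqVneq (size s) ((n + p).-1 + m).-1; last by rewrite !mlin_size.
have [jn im] := (ltn_ord j, ltn_ord i).
pose s1 := take i s; pose r1 := drop i s; pose s2 := take m r1; pose r2 := drop m r1.
pose s3 := take (j - i.+1) r2; pose r3 := drop (j - i.+1) r2.
pose s4 := take p r3; pose s5 := drop p r3.
have -> : s = s1 ++ s2 ++ s3 ++ s4 ++ s5 by rewrite !cat_take_drop.
have z1 : size s1 = i by rewrite size_takel //; lia.
have y1 : size r1 = (size s - i)%N by rewrite size_drop.
have z2 : size s2 = m by rewrite size_takel // y1; lia.
have y2 : size r2 = (size s - i - m)%N by rewrite size_drop y1.
have z3 : size s3 = (j - i.+1)%N by rewrite size_takel // y2; lia.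
have y3 : size r3 = (size s - i - m - (j - i.+1))%N by rewrite size_drop y2.
have z4 : size s4 = p by rewrite size_takel // y3; lia.
have lhs : mfun (circ j' (circ i a b) c) (s1 ++ s2 ++ s3 ++ s4 ++ s5) = mfun a
    (map (kz v) (map (kz w) s1) ++ mfun b (map (kz w) s2) :: map (kz w) s3 ++ mfun c s4 :: s5).
  have -> : s1 ++ s2 ++ s3 ++ s4 ++ s5 = (s1 ++ s2 ++ s3) ++ s4 ++ s5 by rewrite -!catA.
  rewrite (endo_circE _ _ hc) //; last by rewrite !size_cat z1 z2 z3; lia.
  by rewrite !map_cat -!catA (endo_circE _ _ hb) ?size_map.
have rhs : mfun (circ i' (circ j a c) b) (s1 ++ s2 ++ s3 ++ s4 ++ s5) = mfun a
    (map (kz w) (map (kz v) s1) ++ kz w (mfun b s2) :: map (kz w) s3 ++ mfun c s4 :: s5).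
  rewrite (endo_circE _ _ hb) ?ei //.
  have -> : map (kz v) s1 ++ mfun b s2 :: s3 ++ s4 ++ s5
      = (map (kz v) s1 ++ mfun b s2 :: s3) ++ s4 ++ s5 by rewrite -!catA.
  rewrite (endo_circE _ _ hc) //; last by rewrite size_cat /= size_map z1 z3; lia.
  by rewrite map_cat /= -!catA.
rewrite castop_mlin mfunZ lhs rhs.
rewrite !map_koszulD // addbC (koszul_mlin dgW two _ _ hb).
by rewrite (linZ (mlinear_slot _ _ (mlin_mlinear a))) andbC signZK.
Qed.
End EndoCirc.

(** * Koszul signs of permutations *)

Local Notation "\xor_ ( i <- r ) F" := (\big[addb/false]_(i <- r) F)
  (at level 36, F at level 36, i, r at level 50).

(** Koszul signs of permutations are products over pairs of positions.  Working
    with lists of labels rather than with ordinals turns a block decomposition of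
    the positions into concatenation. *)
Fixpoint pairsum (T : Type) (e : T -> T -> bool) (L : seq T) : bool :=
  if L is x :: L' then (\xor_(y <- L') e x y) (+) pairsum e L' else false.

(** Associativity and commutativity of sums modulo 2, by truth tables once the sums
    are generalized. *)
Ltac xor_ac :=
  repeat match goal with
  | |- context [@bigop.body bool ?I ?i ?r ?F] => generalize (@bigop.body bool I i r F)
  | |- context [@pairsum ?T ?e ?L] => generalize (@pairsum T e L)
  end; repeat (let b := fresh "b" in intro b; destruct b); reflexivity.

Section PairSum.
Variable T : eqType.
Implicit Types (e F G : T -> T -> bool) (L : seq T).

Lemma pairsum_cat e L1 L2 : pairsum e (L1 ++ L2) =
  (pairsum e L1 (+) pairsum e L2) (+) \xor_(x <- L1) \xor_(y <- L2) e x y.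
Proof.
elim: L1 => [|x L1 IH] /=; first by rewrite big_nil addbF.
rewrite big_cons big_cat /= IH; xor_ac.
Qed.

Lemma eq_pairsum e F L : {in L &, forall x y, e x y = F x y} -> pairsum e L = pairsum F L.
Proof.
elim: L => //= x L IH eF; rewrite IH => [|y z yL zL]; last by rewrite eF ?inE ?yL ?zL ?orbT.
by congr (_ (+) _); rewrite big_seq [RHS]big_seq; apply: eq_bigr => y yL; rewrite eF ?inE ?eqxx ?yL ?orbT.
Qed.

Lemma pairsum_addb e F L : pairsum (fun x y => e x y (+) F x y) L = pairsum e L (+) pairsum F L.
Proof. by elim: L => //= x L ->; rewrite big_split /= addbACA. Qed.

(** Only the unordered pairs matter, because F is symmetric on the labels. *)
Lemma pairsum_perm F L L' : perm_eq L L' -> {in L &, forall x y, F x y = F y x} ->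
  pairsum F L = pairsum F L'.
Proof.
elim: L L' => [|x L IH] L' LL' Fs; first by rewrite perm_sym in LL'; rewrite (perm_nilP LL').
have /splitPr xL' : x \in L' by rewrite -(perm_mem LL') mem_head.
case: xL' LL' => L1 L2; rewrite perm_sym -cat1s perm_catCA /= perm_cons perm_sym => LL.
have xL y : y \in L1 ++ L2 -> y \in L by rewrite (perm_mem LL).
rewrite /= (IH _ LL) => [|y z yL zL]; last by rewrite Fs ?inE ?yL ?zL ?orbT.
rewrite !pairsum_cat /= (perm_big _ LL) big_cat /=.
under [\xor_(x0 <- L1) \xor_(y <- x :: L2) _]eq_bigr do rewrite big_cons.
rewrite big_split /=.
have -> : \xor_(i <- L1) F x i = \xor_(i <- L1) F i x.
  rewrite big_seq [RHS]big_seq; apply: eq_bigr => y yL.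
  by rewrite Fs ?mem_head // inE xL ?mem_cat ?yL // orbT.
xor_ac.
Qed.
End PairSum.

Lemma pairsum_map (T T' : eqType) (h : T -> T') (e : T' -> T' -> bool) L :
  pairsum e (map h L) = pairsum (fun x y => e (h x) (h y)) L.
Proof. by elim: L => //= x L ->; rewrite big_map. Qed.

Lemma pairsum_enum n (F : 'I_n -> 'I_n -> bool) :
  pairsum F (enum 'I_n) = \big[addb/false]_(i < n) \big[addb/false]_(j < n) ((i < j)%N && F i j).
Proof.
elim: n F => [|n IH] F; first by rewrite (size0nil (size_enum_ord 0)) /= big_ord0.
rewrite enum_ordSl /= big_map big_enum /= pairsum_map IH !big_ord_recl /=; congr (_ (+) _).
by apply: eq_bigr => i _; rewrite big_ord_recl /=.
Qed.

Definition inverted (q : nat -> bool) (x y : nat) : bool := [&& (y < x)%N, q x & q y].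
(** (-1)^(kparity q L) is the Koszul sign of rearranging letters with the parities
    q into the order L ([ksignE]). *)
Definition kparity (q : nat -> bool) (L : seq nat) : bool := pairsum (inverted q) L.

Lemma kparity_iota q m n : kparity q (iota m n) = false.
Proof.
elim: n m => //= n IH m; rewrite /kparity /= -/(kparity _ _) IH addbF big_seq big1 // => i.
by rewrite mem_iota /inverted => /andP[/ltnW]; rewrite leqNgt => /negPf ->.
Qed.

(** The one-line notation of s. *)
Definition labels n (s : 'S_n) : seq nat := [seq val (s j) | j <- enum 'I_n].

Lemma size_labels n (s : 'S_n) : size (labels s) = n.
Proof. by rewrite size_map size_enum_ord. Qed.
Lemma nth_labels n (s : 'S_n) (j : 'I_n) : nth 0%N (labels s) j = s j.
Proof. by rewrite (nth_map j) ?size_enum_ord ?nth_ord_enum. Qed.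
Lemma perm_labels n (s : 'S_n) : perm_eq (labels s) (iota 0 n).
Proof.
rewrite -val_enum_ord /labels (map_comp val s); apply: perm_map; apply: uniq_perm.
- by rewrite (map_inj_uniq perm_inj) enum_uniq.
- exact: enum_uniq.
move=> i; rewrite mem_enum; apply/mapP; exists (s^-1 i)%g; rewrite ?mem_enum // permKV //.
Qed.
Lemma labels_mkseq n (s : 'S_n) : mkseq (nth 0%N (labels s)) n = labels s.
Proof. by rewrite -{2}(mkseq_nth 0%N (labels s)) size_labels. Qed.
Lemma uniq_labels n (s : 'S_n) : uniq (labels s).
Proof. by rewrite (perm_uniq (perm_labels s)) iota_uniq. Qed.
Lemma mem_labels n (s : 'S_n) x : (x \in labels s) = (x < n)%N.
Proof. by rewrite (perm_mem (perm_labels s)) mem_iota. Qed.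
Lemma labels1 n : labels (1%g : 'S_n) = iota 0 n.
Proof. by rewrite -val_enum_ord; apply: eq_map => j; rewrite perm1. Qed.
Lemma labelsM n (s t : 'S_n) : labels (s * t)%g = map (nth 0%N (labels t)) (labels s).
Proof. by rewrite -map_comp; apply: eq_map => j; rewrite /= nth_labels permM. Qed.

(** Cocycle property of the Koszul sign.  The summand F records whether t reverses
    the relative order of two letters; it is symmetric, so its sum may be taken
    along the labels of s instead of the natural order.  The two resulting
    expressions for the sum give the identity. *)
Lemma kparityM n (s t : 'S_n) q :
  kparity q (labels (s * t)%g) =
  kparity q (labels t) (+) kparity (fun x => q (nth 0%N (labels t) x)) (labels s).
Proof.
set T := nth 0%N (labels t); set q' := fun x => q (T x).
pose F x y := inverted q' x y (+) inverted q (T x) (T y).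
have Fsym : {in labels s &, forall x y, F x y = F y x}.
  move=> x y; rewrite !mem_labels => xn yn.
  have [->//|xy] := eqVneq x y.
  have Txy : T x != T y.
    by rewrite nth_uniq ?size_labels ?uniq_labels.
  rewrite /F /inverted /q'; move: xy Txy; case: (q (T x)); case: (q (T y)); rewrite ?andbF //= !andbT.
  by case: ltngtP => // _ _; case: ltngtP.
have := pairsum_perm (perm_labels s) Fsym; rewrite /F !pairsum_addb -!pairsum_map.
rewrite -/(kparity q' _) -/(kparity q' _) kparity_iota /= -labelsM -!/(kparity _ _).
rewrite [map T _](labels_mkseq t) => <-.
by rewrite addbAC addbb.
Qed.

Section Mid.
Variables (q : nat -> bool) (i : nat) (L1 L2 : seq nat).

(** The parity of the letters that change sides with i. *)
Definition jumped := (\xor_(y <- L1) ((i < y)%N && q y)) (+) \xor_(y <- L2) ((y < i)%N && q y).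

Lemma kparity_mid : kparity q (L1 ++ i :: L2) = kparity q (L1 ++ L2) (+) (q i && jumped).
Proof.
rewrite /kparity !pairsum_cat /=.
under [\xor_(x <- L1) \xor_(y <- i :: L2) _]eq_bigr do rewrite big_cons.
rewrite big_split /=.
have -> : \xor_(x <- L1) inverted q x i = q i && \xor_(y <- L1) ((i < y)%N && q y).
  rewrite (big_morph (andb (q i)) (andb_addr _) (andbF _)).
  by apply: eq_bigr => y _; rewrite /inverted; case: ltnP; case: (q y); case: (q i).
have -> : \xor_(y <- L2) inverted q i y = q i && \xor_(y <- L2) ((y < i)%N && q y).
  rewrite (big_morph (andb (q i)) (andb_addr _) (andbF _)).
  by apply: eq_bigr => y _; rewrite /inverted; case: ltnP; case: (q y); case: (q i).
rewrite /jumped andb_addr.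
case: (q i) => /=; xor_ac.
Qed.

(** The letters before i in the natural order and those before i in the list differ
    exactly by the letters that change sides with i. *)
Lemma before_jumped n : perm_eq (L1 ++ i :: L2) (iota 0 n) ->
  \xor_(x <- iota 0 i) q x = jumped (+) \xor_(y <- L1) q y.
Proof.
move=> pL; have uL : uniq (L1 ++ i :: L2) by rewrite (perm_uniq pL) iota_uniq.
have lt_in : (i < n)%N.
  have : i \in iota 0 n by rewrite -(perm_mem pL) mem_cat mem_head orbT.
  by rewrite mem_iota.
have -> : \xor_(x <- iota 0 i) q x = \xor_(x <- iota 0 n) ((x < i)%N && q x).
  rewrite -(subnKC (ltnW lt_in)) iotaD big_cat /= add0n.
  rewrite [X in _ (+) X]big_seq [X in _ (+) X]big1 ?addbF => [|x].
    by rewrite big_seq [RHS]big_seq; apply: eq_bigr => x; rewrite mem_iota => /andP[_ ->].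
  by rewrite mem_iota => /andP[]; rewrite leqNgt => /negPf ->.
rewrite -(perm_big _ pL) big_cat big_cons /= ltnn /= /jumped.
have -> : \xor_(x <- L1) ((x < i)%N && q x)
    = (\xor_(y <- L1) ((i < y)%N && q y)) (+) \xor_(y <- L1) q y.
  rewrite -big_split big_seq [RHS]big_seq; apply: eq_bigr => y yL /=.
  have : y != i.
    by apply: contraTneq uL => yi; rewrite cat_uniq -yi /= yL !(orbT, andbF).
  by case: ltngtP; case: (q y).
by rewrite addbAC.
Qed.
End Mid.

(** * The symmetric group action on the endomorphism operad *)

Section EndoAct.
Variables (k : fieldType) (W : dgmod k) (dgW : isDg W) (two : (2 : k) != 0).
Local Notation eps := (@sgn k W).
Local Notation E := (endo W true).
Local Notation kz := (@koszul k W).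
Implicit Types (e : nat -> W) (q : nat -> bool).

(** Arguments are given by an infinite sequence of which the first n count; this
    makes relabelling a composition of functions. *)
Definition homog n q e : Prop := forall i, (i < n)%N -> part W (q i) (e i) = e i.

Lemma mlinear0 f s : mlinear f -> 0 \in s -> f s = 0 :> W.
Proof. by move=> fL /splitPr[s1 s2]; apply: lin0 (mlinear_slot s1 s2 fL). Qed.

Lemma ksignE n (s : 'S_n) q : ksign k s [ffun i : 'I_n => q i] = (-1) ^+ kparity q (labels s).
Proof.
rewrite /ksign -signr_odd; congr (_ ^+ nat_of_bool _).
rewrite /kparity /labels pairsum_map pairsum_enum cardsE -sum1_card.
rewrite (big_morph odd oddD (erefl (odd 0))) big_mkcond /=.
rewrite [RHS]pair_bigA; apply: eq_bigr => -[i j] _; rewrite /= unfold_in /= !ffunE /inverted.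
by case: (i < j)%N; case: (_ < _)%N; rewrite //= andbC; case: (_ && _).
Qed.

(** On homogeneous arguments the sum over all parities that defines the action has
    one nonzero term. *)
Lemma endo_actE n (s : 'S_n) (f : E n) q e : homog n q e ->
  mfun (act isT s f) (mkseq e n) = (-1) ^+ kparity q (labels s) *: mfun f (map e (labels s)).
Proof.
move=> he; rewrite /= /endo_act_fun /guard size_mkseq eqxx.
rewrite (bigD1 [ffun i : 'I_n => q i]) //= big1 ?addr0 => [|q' q'q].
  rewrite ksignE; congr (_ *: mfun f _); rewrite /labels -map_comp; apply: eq_map => j /=.
  by rewrite ffunE nth_mkseq // he.
rewrite (mlinear0 (mlin_mlinear f)) ?scaler0 //.
(* a wrong parity at i puts 0 among the arguments *)
have [i qi] : exists i, q' i != q i.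
  apply/existsP; apply: contraNT q'q; rewrite negb_exists => /forallP q'q.
  by apply/eqP/ffunP => i; rewrite ffunE; apply/eqP; have := q'q i; rewrite negbK.
apply/mapP; exists ((s^-1)%g i); rewrite ?mem_enum // permKV nth_mkseq //.
by rewrite (part_hom dgW _ (he i (ltn_ord i))) (negPf qi).
Qed.

(** The arguments are replaced one at a time by their homogeneous components; s1 in
    the proof is the part already treated. *)
Lemma mlin_homog_ext n (F G : E n) :
  (forall q e, homog n q e -> mfun F (mkseq e n) = mfun G (mkseq e n)) -> F = G.
Proof.
move=> FG; apply: mlin_ext => s.
have [sn|sn] := eqVneq (size s) n; last by rewrite !mlin_size.
have H (s2 s1 : seq W) : (size s1 + size s2)%N = n ->
    (forall i, (i < size s1)%N -> exists p, part W p (nth 0 s1 i) = nth 0 s1 i) ->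
    mfun F (s1 ++ s2) = mfun G (s1 ++ s2).
  elim: s2 s1 => [|w s2 IH] s1 /= ss h1.
    rewrite addn0 in ss; rewrite cats0 -(mkseq_nth 0 s1) ss.
    (* q is true at an entry that has both parities, that is, at 0 *)
    pose q i := part W true (nth 0 s1 i) == nth 0 s1 i.
    apply: (FG q) => i; rewrite -ss /q => /h1[p hp].
    by case: eqP => // he; case: p hp.
  rewrite -(dg_part_sum dgW w) (linD (mlinear_slot _ _ (mlin_mlinear F))).
  rewrite (linD (mlinear_slot _ _ (mlin_mlinear G))) -!cat_rcons.
  have K p : mfun F (rcons s1 (part W p w) ++ s2) = mfun G (rcons s1 (part W p w) ++ s2).
    apply: IH => [|i]; first by rewrite size_rcons addSnnS.
    rewrite size_rcons nth_rcons ltnS leq_eqVlt => /predU1P[->|/[dup] ii ->]; last exact: h1.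
    by rewrite ltnn eqxx; exists p; rewrite (dg_partK dgW) eqxx.
  by rewrite !K.
exact: (H s [::]).
Qed.

(** The sign by which an operation of parity p passes the arguments in X. *)
Lemma koszul_block p q e (f : seq W -> W) (X : seq nat) r : mlinear f ->
  (forall x, x \in X -> part W (q x) (e x) = e x) ->
  f (map (kz p) (map e X) ++ r) = (-1) ^+ (p && \xor_(x <- X) q x) *: f (map e X ++ r).
Proof.
move=> fL he; elim: X f fL he => [|x X IH] f fL he; first by rewrite big_nil andbF scale1r.
rewrite big_cons /= (koszul_hom dgW _ (he x _)) ?mem_head //.
rewrite (linZ (mlinear_slot [::] _ fL)) /= (IH _ (mlinear_cons _ fL)) => [|y yX].
  by rewrite signZ_addb andb_addr.
by apply: he; rewrite inE yX orbT.
Qed.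

Lemma mlin_value_hom n p q e (f : E n) X : part _ p f = f ->
  (forall x, x \in X -> part W (q x) (e x) = e x) ->
  part W (p (+) \xor_(x <- X) q x) (mfun f (map e X)) = mfun f (map e X).
Proof.
move=> hf he; apply/(hom_sgnP dgW two); move/(endo_homP dgW two): hf => ->.
have := koszul_block true [::] (mlin_mlinear f) he; rewrite !cats0 => H.
by rewrite [mfun f (map eps _)]H signZ_addb.
Qed.

Lemma endo_act_hom n (s : 'S_n) p (f : E n) : part _ p f = f ->
  part _ p (act isT s f) = act isT s f.
Proof.
move=> hf; apply: mlin_homog_ext => q e he; rewrite endo_partE //.
have he' : homog n q (fun i => eps (e i)).
  by move=> i lt_in; rewrite -sgn_part // he.
have emap : map eps (mkseq e n) = mkseq (fun i => eps (e i)) n by rewrite /mkseq -map_comp.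
rewrite emap (endo_actE _ _ he) (endo_actE _ _ he') sgnZ.
move/(endo_homP dgW two): hf => ->; rewrite -map_comp.
have -> : map (eps \o (fun i => eps (e i))) (labels s) = map e (labels s).
  by apply: eq_map => i /=; rewrite sgnK.
by rewrite [_ *: (_ *: (_ *: _))]scalerA mulrC -scalerA signZK scale2K.
Qed.

Lemma endo_act1 n (f : E n) : act isT 1%g f = f.
Proof.
apply: mlin_homog_ext => q e he.
by rewrite (endo_actE _ _ he) labels1 kparity_iota scale1r.
Qed.

Lemma endo_actM n (s t : 'S_n) (f : E n) : act isT (s * t)%g f = act isT t (act isT s f).
Proof.
apply: mlin_homog_ext => q e he; rewrite !(endo_actE _ _ he) kparityM labelsM.
have -> : map e (labels t) = mkseq (e \o nth 0%N (labels t)) n.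
  by rewrite -{1}(labels_mkseq t) /mkseq -map_comp.
rewrite (@endo_actE _ _ _ (q \o nth 0%N (labels t))) => [|i lt_in /=].
  by rewrite signZ_addb -map_comp.
by apply: he; rewrite -(mem_labels t) mem_nth // size_labels.
Qed.

(** Indexing the terms by letters rather than by positions makes the differentials of
    two orders of the same letters comparable term by term. *)
Lemma Dsum_labels q e (f : seq W -> W) (L : seq nat) : mlinear f -> uniq L ->
  (forall x, x \in L -> part W (q x) (e x) = e x) ->
  Dsum f (map e L) = \sum_(i <- L) (-1) ^+ (\xor_(x <- take (index i L) L) q x)
     *: f (map (fun x => if x == i then diff W (e i) else e x) L).
Proof.
elim: L f => [|x L IH] f fL /= => [_ _|/andP[xL uL] he]; first by rewrite big_nil.
rewrite big_cons eqxx big_nil scale1r; congr (f (_ :: _) + _).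
  by apply/eq_in_map => y yL; case: eqP => // yx; rewrite -yx yL in xL.
rewrite (IH _ (mlinear_cons _ fL) uL) => [|y yL]; last by apply: he; rewrite inE yL orbT.
rewrite big_seq [RHS]big_seq; apply: eq_bigr => i iL.
have /negPf xi : x != i by apply: contraNneq xL => ->.
rewrite xi /= big_cons (sgn_hom dgW (he x (mem_head _ _))).
by rewrite (linZ (mlinear_slot [::] _ fL)) /= signZ_addb addbC.
Qed.

(** When d hits the letter i, the parity of i flips, which changes the Koszul sign of
    the permutation by the parity of the letters that change sides with i.  That is
    also the discrepancy between the signs of d reaching i in the natural and in
    the permuted order. *)
Lemma endo_act_diff n (s : 'S_n) p (f : E n) : part _ p f = f ->
  act isT s (diff _ f) = diff _ (act isT s f).
Proof.
move=> hf; apply: mlin_homog_ext => q e he.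
rewrite (endo_diffE dgW two _ (endo_act_hom s hf)) !(endo_actE _ _ he).
rewrite (endo_diffE dgW two _ hf) scalerBr (linZ (linearP (diff W))); congr (_ - _).
rewrite scalerA mulrC -scalerA; congr (_ *: _).
have hL x : x \in labels s -> part W (q x) (e x) = e x by rewrite mem_labels => /he.
have hI x : x \in iota 0 n -> part W (q x) (e x) = e x by rewrite mem_iota => /he.
rewrite (Dsum_labels (mlin_mlinear f) (uniq_labels s) hL).
rewrite (Dsum_labels (mlin_mlinear _) (iota_uniq 0 n) hI).
rewrite -(perm_big _ (perm_labels s)) scaler_sumr.
apply: eq_big_seq => i iL /=; have lt_in : (i < n)%N by rewrite -(mem_labels s).
pose q' x := if x == i then ~~ q i else q x.
have he' : homog n q' (fun x => if x == i then diff W (e i) else e x).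
  by move=> x lt_xn; rewrite /q'; case: eqP => _; [apply: diff_hom => //; apply: he | apply: he].
rewrite [X in _ = _ *: X](endo_actE s f he').
rewrite !signZ_addb; congr ((-1) ^+ nat_of_bool _ *: _).
have -> : take (index i (iota 0 n)) (iota 0 n) = iota 0 i.
  by rewrite -{1}[i]add0n -(nth_iota 0 0 lt_in) index_uniq ?size_iota ?iota_uniq // take_iota (minn_idPl (ltnW lt_in)).
have [L1 [L2 [eL eL1]]] : exists L1 L2, labels s = L1 ++ i :: L2 /\ take (index i (labels s)) (labels s) = L1.
  exists (take (index i (labels s)) (labels s)), (drop (index i (labels s)).+1 (labels s)).
  split=> //; rewrite -{1}(cat_take_drop (index i (labels s)) (labels s)).
  by rewrite (drop_nth 0%N) ?index_mem // nth_index.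
have pL := perm_labels s; have uL := uniq_labels s; rewrite eL in pL uL *.
rewrite -eL eL1 eL (before_jumped q pL).
have qq' x : x \in L1 ++ L2 -> q' x = q x.
  rewrite /q' => xL; case: eqP => // xi; move: uL; rewrite -cat1s uniq_catCA /= -xi xL //.
have ej : jumped q' i L1 L2 = jumped q i L1 L2.
  rewrite /jumped; congr (_ (+) _); rewrite big_seq [RHS]big_seq; apply: eq_bigr => y yL;
  by rewrite qq' // mem_cat yL ?orbT.
have ek : kparity q' (L1 ++ L2) = kparity q (L1 ++ L2).
  by apply: eq_pairsum => x y xL yL; rewrite /inverted !qq'.
rewrite !kparity_mid ej ek {1}/q' eqxx.
by case: jumped; case: (q i); case: kparity; case: (\big[_/_]_(_ <- _) _).
Qed.
End EndoAct.

(** * Equivariance of partial composition in the endomorphism operad *)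

Lemma outer_mono m l x y : x != l -> y != l -> (outer m l y < outer m l x)%N = (y < x)%N.
Proof. by move=> xl yl; rewrite /outer; case: (ltnP y) => ?; case: (ltnP x) => ?; lia. Qed.
Lemma outer_after m l x y : x != l -> (y < m)%N -> (l + y < outer m l x)%N = (l < x)%N.
Proof. by move=> xl ym; rewrite /outer; case: (ltnP x) => ?; lia. Qed.
Lemma outer_before m l x y : x != l -> (y < m)%N -> (outer m l x < l + y)%N = (x < l)%N.
Proof. by move=> xl ym; rewrite /outer; case: (ltnP x) => ?; lia. Qed.

Section EndoCircAct.
Variables (k : fieldType) (W : dgmod k) (dgW : isDg W) (two : (2 : k) != 0).
Local Notation E := (endo W true).
Local Notation kz := (@koszul k W).

Section Labels.
Variables (n m : nat) (s : 'S_n) (t : 'S_m) (l : 'I_n) (r : 'S_(n + m).-1).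
Hypothesis r_outer : forall (j : 'I_n) (x : 'I_(n + m).-1),
  j != l -> x = outer m l j :> nat -> r x = outer m (s l) (s j) :> nat.
Hypothesis r_inner : forall (j : 'I_m) (x : 'I_(n + m).-1),
  x = (l + j)%N :> nat -> r x = (s l + t j)%N :> nat.
Local Notation o := (outer m (s l)).
Let S1 := take l (labels s).
Let S2 := drop l.+1 (labels s).

Lemma labels_split : labels s = S1 ++ val (s l) :: S2.
Proof.
rewrite -{1}(cat_take_drop l (labels s)) (drop_nth 0%N) ?size_labels //.
by rewrite nth_labels.
Qed.

Lemma labels_block : labels r = map o S1 ++ map (addn (s l)) (labels t) ++ map o S2.
Proof.
have ln := ltn_ord l.
have z1 : size S1 = l by rewrite size_take size_labels ln.
have z2 : size S2 = (n - l.+1)%N by rewrite size_drop size_labels.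
apply: (@eq_from_nth _ 0%N) => [|i].
  by rewrite size_labels !size_cat (size_map o) (size_map (addn _)) (size_map o) size_labels z1 z2; lia.
rewrite size_labels => ilt; rewrite -[i]/(val (Ordinal ilt)) nth_labels /=.
rewrite nth_cat size_map z1; case: ltnP => il.
  have iln : (i < n)%N by lia.
  rewrite (nth_map 0%N) ?z1 // nth_take // -[i in nth _ _ i]/(val (Ordinal iln)) nth_labels.
  apply: r_outer; rewrite /= ?/outer ?il //.
  by rewrite -val_eqE /= ltn_eqF.
rewrite nth_cat size_map size_labels; case: ltnP => im.
  rewrite (nth_map 0%N) ?size_labels // -[X in nth _ _ X]/(val (Ordinal im)) nth_labels.
  by apply: r_inner; rewrite /= subnKC.
have jn : (i.+1 - m < n)%N by lia.
have -> : (i - l - m)%N = ((i.+1 - m) - l.+1)%N by lia.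
rewrite (nth_map 0%N) ?z2; last by lia.
rewrite nth_drop subnKC; last by lia.
rewrite -[X in nth _ _ X]/(val (Ordinal jn)) nth_labels.
apply: r_outer; rewrite -?val_eqE /= ?/outer; last by case: ltnP; lia.
by rewrite gtn_eqF //; lia.
Qed.

Lemma sl_notin x : x \in S1 ++ S2 -> x != s l.
Proof.
move=> xS; have := uniq_labels s; rewrite labels_split -cat1s uniq_catCA /= => /andP[+ _].
by apply: contraNneq => <-.
Qed.


Variables (q : nat -> bool) (b : bool).
Let qi x := q (s l + x)%N.
(** Parities of the arguments of a once the block has been replaced by the value of
    an operation of parity b on it. *)
Definition block_parity (x : nat) := if x == s l then b (+) \xor_(y <- labels t) qi y else q (o x).

(** Comparison of the signs on the two sides of equivariance.  A pair inside the
    block contributes to the sign of t.  A pair of outer letters, or an outer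
    letter with the whole block, contributes to the sign of s.  What remains is
    the own parity b of the inner operation: on one side it passes the arguments
    in front of the block in the original order, on the other side those in front of
    it in the permuted order, and on the first side it also takes part in the sign
    of s.  These cancel by [before_jumped]. *)
Lemma kparity_block :
  (b && \xor_(x <- iota 0 (s l)) q x) (+) kparity qi (labels t) (+) kparity block_parity (labels s)
  = kparity q (labels r) (+) (b && \xor_(x <- map o S1) q x).
Proof.
set q' := block_parity.
have q'E x : x \in S1 ++ S2 -> q' x = q (o x).
  by rewrite /q' /block_parity => /sl_notin /negPf ->.
have q'S1 x : x \in S1 -> q' x = q (o x) by move=> xS; apply: q'E; rewrite mem_cat xS.
have q'S2 x : x \in S2 -> q' x = q (o x) by move=> xS; apply: q'E; rewrite mem_cat xS orbT.
have pL : perm_eq (S1 ++ val (s l) :: S2) (iota 0 n) by rewrite -labels_split perm_labels.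
have -> : \xor_(x <- iota 0 (s l)) q x = \xor_(x <- iota 0 (s l)) q' x.
  rewrite big_seq [RHS]big_seq; apply: eq_bigr => x; rewrite mem_iota add0n => /andP[_ xl].
  by rewrite /q' /block_parity ltn_eqF // /outer xl.
rewrite (before_jumped q' pL) labels_split kparity_mid.
have -> : \xor_(x <- map o S1) q x = \xor_(y <- S1) q' y.
  by rewrite big_map big_seq [RHS]big_seq; apply: eq_bigr => x xS; rewrite q'S1.
set sq := \xor_(y <- labels t) qi y.
suff -> : kparity q (labels r)
    = kparity qi (labels t) (+) kparity q' (S1 ++ S2) (+) (sq && jumped q' (s l) S1 S2).
  rewrite {4}/q' /block_parity eqxx -/sq.
  move: (\big[_/_]_(_ <- S1) _) (kparity _ _) (kparity _ _) (jumped _ _ _ _) sq.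
  by case: (b) => -[] [] [] [] [].
rewrite labels_block /kparity !pairsum_cat !(pairsum_map o) (pairsum_map (addn (s l))) (big_map o).
under [\xor_(x <- S1) \xor_(y <- _ ++ _) _]eq_bigr do rewrite big_cat.
rewrite big_split.
have inv_o : {in S1 ++ S2 &, forall x y, inverted q (o x) (o y) = inverted q' x y}.
  by move=> x y xS yS; rewrite /inverted !q'E // outer_mono // sl_notin.
have -> : pairsum (fun x y => inverted q (s l + x) (s l + y)) (labels t) = pairsum (inverted qi) (labels t).
  by apply: eq_pairsum => x y _ _; rewrite /inverted ltn_add2l.
have c12 : \xor_(x <- S1) \xor_(y <- map o S2) inverted q (o x) y
    = \xor_(x <- S1) \xor_(y <- S2) inverted q' x y.
  rewrite big_seq [RHS]big_seq; apply: eq_bigr => x xS; rewrite (big_map o).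
  rewrite big_seq [RHS]big_seq; apply: eq_bigr => y yS.
  by rewrite inv_o // mem_cat ?xS ?yS ?orbT.
have c1t : \xor_(x <- S1) \xor_(y <- map (addn (s l)) (labels t)) inverted q (o x) y
    = sq && \xor_(y <- S1) ((s l < y)%N && q' y).
  rewrite (big_morph (andb sq) (andb_addr _) (andbF _)).
  rewrite big_seq [RHS]big_seq; apply: eq_bigr => x xS; rewrite (big_map (addn (s l))) /sq.
  rewrite (big_morph (andb^~ _) (fun y z => andb_addl y z _) (andFb _)).
  rewrite big_seq [RHS]big_seq; apply: eq_bigr => y; rewrite mem_labels => ym.
  have xn : x != s l :> nat by rewrite sl_notin // mem_cat xS.
  have lt_o : (s l + y < o x)%N = (s l < x)%N := outer_after xn ym.
  by rewrite q'S1 // /inverted -/(qi y) lt_o; case: (qi y); case: (q _); rewrite ?andbF.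
have ct2 : \xor_(x <- map (addn (s l)) (labels t)) \xor_(y <- map o S2) inverted q x y
    = sq && \xor_(y <- S2) ((y < s l)%N && q' y).
  rewrite (big_map (addn (s l))) /sq (big_morph (andb^~ _) (fun y z => andb_addl y z _) (andFb _)).
  rewrite big_seq [RHS]big_seq; apply: eq_bigr => x; rewrite mem_labels => xm.
  rewrite (big_morph (andb _) (andb_addr _) (andbF _)) (big_map o).
  rewrite big_seq [RHS]big_seq; apply: eq_bigr => y yS.
  have yn : y != s l :> nat by rewrite sl_notin // mem_cat yS orbT.
  have lt_o : (o y < s l + x)%N = (y < s l)%N := outer_before yn xm.
  by rewrite q'S2 // /inverted -/(qi x) lt_o andbCA.
have e1 : pairsum (fun x y => inverted q (o x) (o y)) S1 = pairsum (inverted q') S1.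
  by apply: eq_pairsum => x y xS yS; apply: inv_o; rewrite mem_cat ?xS ?yS.
have e2 : pairsum (fun x y => inverted q (o x) (o y)) S2 = pairsum (inverted q') S2.
  by apply: eq_pairsum => x y xS yS; apply: inv_o; rewrite mem_cat ?xS ?yS orbT.
rewrite e1 e2 c1t ct2 /= c12 /jumped; clear c12 c1t ct2; case: sq => /=; xor_ac.
Qed.
End Labels.

(** Both sides are a evaluated at the same list, in which the block has been replaced
    by the value v of b on it; e' is that list before s permutes it.  The signs
    agree by [kparity_block]. *)
Lemma endo_circ_act n m (s : 'S_n) (t : 'S_m) (l : 'I_n) (r : 'S_(n + m).-1)
    (a : E n) (b : E m) p : part _ p b = b ->
  (forall (j : 'I_n) (x : 'I_(n + m).-1), j != l -> x = outer m l j :> nat ->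
     r x = outer m (s l) (s j) :> nat) ->
  (forall (j : 'I_m) (x : 'I_(n + m).-1), x = (l + j)%N :> nat ->
     r x = (s l + t j)%N :> nat) ->
  circ (s l) (act isT s a) (act isT t b) = act isT r (circ l a b).
Proof.
move=> hb r1 r2; apply: mlin_homog_ext => // q e he.
have sln := ltn_ord (s l).
pose o := outer m (s l); pose qi x := q (s l + x)%N; pose ei x := e (s l + x)%N.
pose v := mfun b (map ei (labels t)).
pose e' (x : nat) := if x == s l then v else e (o x).
pose q' := block_parity s t l q p.
have hei x : x \in labels t -> part W (qi x) (ei x) = ei x.
  by rewrite mem_labels => xm; apply: he; lia.
have he' : homog n q' e'.
  move=> x xn; rewrite /q' /block_parity /e'; case: eqP => [_|/eqP xl].
    exact: mlin_value_hom.
  by apply: he; rewrite /o /outer; case: (ltnP x) => ?; lia.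
have lhs : mfun (circ (s l) (act isT s a) (act isT t b)) (mkseq e (n + m).-1)
    = (-1) ^+ ((p && \xor_(x <- iota 0 (s l)) q x) (+) kparity qi (labels t) (+) kparity q' (labels s))
      *: mfun a (map e' (labels s)).
  have -> : mkseq e (n + m).-1 = map e (iota 0 (s l)) ++ mkseq ei m ++
      map e (iota (s l + m) (n - (s l).+1)).
    have -> : mkseq ei m = map e (iota (s l) m).
      by rewrite -[X in iota X]addn0 iotaDl -map_comp.
    by rewrite -!map_cat -iotaD -{3}[nat_of_ord (s l)]add0n -iotaD /mkseq; congr (map e (iota 0 _)); lia.
  rewrite (endo_circE dgW two _ _ (endo_act_hom dgW two t hb)) ?size_map ?size_iota //.
  rewrite (endo_actE dgW t b (q := qi)) => [|x xm]; last by apply: he; lia.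
  rewrite (linZ (mlinear_slot _ _ (mlin_mlinear _))) (koszul_block dgW _ _ (mlin_mlinear _) (q := q)) => [|x].
    have -> : map e (iota 0 (s l)) ++ v :: map e (iota (s l + m) (n - (s l).+1)) = mkseq e' n.
      have -> : mkseq e' n = map e' (iota 0 (s l) ++ val (s l) :: iota (s l).+1 (n - (s l).+1)).
        rewrite /mkseq; congr (map e' _).
        by rewrite -[in LHS](subnKC (ltnW sln)) iotaD add0n -(subnSK sln).
      rewrite map_cat /= {2}/e' eqxx; congr (_ ++ _ :: _).
        apply/eq_in_map => x; rewrite mem_iota /e' /o /outer add0n => /andP[_ xl].
        by rewrite xl ltn_eqF.
      rewrite -[(s l + m)%N]addn0 -[in X in _ = X](addn0 (s l).+1) !iotaDl -!map_comp addn0.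
      apply: eq_map => x; rewrite /= /e' /o /outer gtn_eqF ?leq_addr // ltnNge.
      by rewrite ltnW ?leq_addr //=; congr e; lia.
    rewrite (endo_actE dgW _ _ he') !signZ_addb; congr (_ ^+ nat_of_bool _ *: _).
    by case: (p && _); case: kparity; case: kparity.
  by rewrite mem_iota => xl; apply: he; lia.
rewrite lhs (endo_actE dgW _ _ he) (labels_block r1 r2).
have mS (S : seq nat) : {subset S <= take l (labels s) ++ drop l.+1 (labels s)} ->
    map e (map o S) = map e' S.
  move=> Ss; rewrite -map_comp; apply/eq_in_map => x xS /=.
  by rewrite /e' (negPf (sl_notin (Ss _ xS))).
rewrite !map_cat -[map e (map _ (labels t))]map_comp.
rewrite -[map (_ \o _) (labels t)]/(map ei _) mS => [|x xS]; last by rewrite mem_cat xS.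
rewrite mS => [|x xS]; last by rewrite mem_cat xS orbT.
have z1 : size (map e' (take l (labels s))) = l by rewrite size_map size_take size_labels ltn_ord.
have z2 : size (map ei (labels t)) = m by rewrite size_map size_labels.
rewrite (endo_circE dgW two _ _ hb z1 z2).
rewrite -[mfun b (map ei _)]/v.
rewrite (koszul_block dgW p (q := q') _ (mlin_mlinear a)) => [|x xS]; last first.
  by apply: he'; rewrite -(mem_labels s) (mem_take xS).
rewrite signZ_addb -(labels_block r1 r2).
have -> : \xor_(x <- take l (labels s)) q' x = \xor_(x <- map o (take l (labels s))) q x.
  rewrite big_map big_seq [RHS]big_seq; apply: eq_bigr => x xS.
  have /sl_notin/negPf xl : x \in take l (labels s) ++ drop l.+1 (labels s) by rewrite mem_cat xS.
  by rewrite /q' /block_parity xl.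
rewrite -(kparity_block r1 r2 q p); congr (_ *: mfun a _).
rewrite {1}(labels_split s l) map_cat /= {2}/e' eqxx.
by [].
Qed.

Lemma endo_isOperad (sym : bool) : isOperad (endo W sym).
Proof.
apply: (@isOperad_span _ _ (endo W sym) (fun n p f => part _ p f = f)) => //.
- exact: (endo_isDg dgW two).
- by move=> n; apply: hom_spanning; apply: endo_isDg.
- by move=> n m i a b p q ha hb; apply: endo_circ_hom.
- by move=> n m i a b p q ha hb; apply: (endo_circ_diff dgW two i ha hb).
- by move=> n m p i j l a b c u v w e _ hb hc el; apply: (endo_circ_seq dgW two a e hb hc el).
- by move=> n m p i j j' i' a b c u v w e _ hb hc ij ej ei; apply: (endo_circ_par dgW two a e hb hc ij ej ei).
- by case: sym => n // h a p _; have -> : h = isT by []; apply: endo_act1.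
- by case: sym => n // h s t a p _; apply: endo_actM.
- by case: sym => n // h s p a; apply: endo_act_hom.
- by case: sym => n // h s a p; apply: endo_act_diff.
by case: sym => n // m h s t l r a b p q _ hb r1 r2; apply: (endo_circ_act a hb r1 r2).
Qed.
End EndoCircAct.

(** * The tensor product of an operad with a commutative dg algebra *)

Section TensorDg.
Variables (k : fieldType) (B : nilcdga k).

Lemma tens_decomp (U : lmodType k) (x : tens B U) : x = \sum_i pure (bas i) (x i).
Proof.
apply/ffunP => j; rewrite sum_ffunE (bigD1 j) //= big1 ?addr0 => [|i ij]; rewrite ffunE.
  by rewrite /bas coord_free ?eqxx ?scale1r //; apply: basis_free; apply: vbasisP.
by rewrite /bas coord_free ?(negPf ij) ?scale0r //; apply: basis_free; apply: vbasisP.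
Qed.

Section Dg.
Variables (U : dgmod k) (dgU : isDg U).

Lemma pureZl c (b : B) (u : U) : pure (c *: b) u = c *: pure b u.
Proof. exact: (linZ (pure_linearl u)). Qed.
Lemma pureZr c (b : B) (u : U) : pure b (c *: u) = c *: pure b u.
Proof. by rewrite linearZ. Qed.
Lemma pure0l (u : U) : pure (0 : B) u = 0.
Proof. exact: (lin0 (pure_linearl u)). Qed.
Lemma pureDl (b c : B) (u : U) : pure (b + c) u = pure b u + pure c u.
Proof. exact: (linD (pure_linearl u)). Qed.
Lemma pureDr (b : B) (u v : U) : pure b (u + v) = pure b u + pure b v.
Proof. exact: linearD. Qed.

(** Elementary tensors of homogeneous elements; all sign computations in the tensor
    product take place on these. *)
Variant hpure (r : bool) (x : tensdg B U) : Prop :=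
  HPure p q (b : B) (u : U) of npart B p b = b & part U q u = u & r = p (+) q & x = pure b u.

Lemma hpure_spanning : spanning (fun x : tensdg B U => exists r, hpure r x).
Proof.
move=> V F G FL GL FG x; rewrite [x]tens_decomp (lin_sum _ _ _ FL) (lin_sum _ _ _ GL).
apply: eq_bigr => i _.
have dgB : isDg (ndg B) := ndgP B.
move: (bas i) (x i) => b u; rewrite -(dg_part_sum dgU u) -(dg_part_sum dgB b).
rewrite !pureDl !pureDr !(linD FL) !(linD GL).
have H p q : F (pure (npart B p b) (part U q u)) = G (pure (npart B p b) (part U q u)).
  apply: FG; exists (p (+) q); apply: (HPure _ _ (erefl _) (erefl _)).
    by have := dg_partK dgB p p b; rewrite eqxx.
  by rewrite (dg_partK dgU) eqxx.
by rewrite !H.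
Qed.

Lemma tens_part_pure p q r (b : B) (u : U) : npart B p b = b -> part U q u = u ->
  part (tensdg B U) r (pure b u) = if r == p (+) q then pure b u else 0.
Proof.
move=> hb hu; have dgB : isDg (ndg B) := ndgP B.
rewrite /= /tens_part big_bool /= !tmap_pure.
have hb' s : npart B s b = if s == p then b else 0 := part_hom dgB s hb.
rewrite !hb' !(part_hom dgU _ hu).
by case: p q r {hb hb' hu} => -[] []; rewrite /= ?pure0l ?linear0 ?addr0 ?add0r.
Qed.

Lemma tens_diff_pure p (b : B) (u : U) : npart B p b = b ->
  diff (tensdg B U) (pure b u) = pure (ndiff B b) u + (-1) ^+ p *: pure b (diff U u).
Proof.
move=> hb; have dgB : isDg (ndg B) := ndgP B.
rewrite /= /tens_diff !tmap_pure /=; congr (_ + _).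
by rewrite -pureZl; congr (pure _ _); exact: (sgn_hom dgB hb).
Qed.

Lemma ndiff_hom p b : npart B p b = b -> npart B (~~ p) (ndiff B b) = ndiff B b.
Proof. exact: (diff_hom (ndgP B)). Qed.

Lemma hpure_hom r x : hpure r x -> part (tensdg B U) r x = x.
Proof. by case=> p q b u hb hu -> ->; rewrite (tens_part_pure _ hb hu) eqxx. Qed.

Lemma tensdg_isDg : isDg (tensdg B U).
Proof.
have dgB : isDg (ndg B) := ndgP B.
have part_h r s x : hpure r x -> part (tensdg B U) s x = if s == r then x else 0.
  by case=> p q b u hb hu -> ->; rewrite (tens_part_pure _ hb hu).
have span (V : lmodType k) (F G : tensdg B U -> V) : linear F -> linear G ->
    (forall r x, hpure r x -> F x = G x) -> forall x, F x = G x.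
  by move=> FL GL FG; apply: hpure_spanning => // x [r]; apply: FG.
split.
- move=> p q; case: eqP => [<-|/eqP pq]; apply: span => [||r x hx]; try by lin.
  + by rewrite (part_h _ _ _ hx); case: eqP => [->|_]; rewrite ?linear0 // (part_h _ _ _ hx) eqxx.
  + by move=> a u v; rewrite scaler0 addr0.
  rewrite (part_h _ _ _ hx); case: eqP => [qr|_]; rewrite ?linear0 // (part_h _ _ _ hx).
  by rewrite -qr (negPf pq).
- apply: span => [||r x hx]; try by lin.
  by rewrite !(part_h _ _ _ hx); case: (r); rewrite /= ?addr0 ?add0r.
- move=> s; apply: span => [||r x]; try by lin.
  case=> p q b u hb hu er ->; rewrite (tens_part_pure _ hb hu).
  rewrite (tens_diff_pure _ hb) partD partZr.
  rewrite (tens_part_pure _ (ndiff_hom hb) hu) (tens_part_pure _ hb (diff_hom dgU hu)).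
  rewrite addNb addbN; case: eqP => [->|/eqP nsp]; first by rewrite eqxx (tens_diff_pure _ hb).
  have -> : (~~ s == ~~ (p (+) q)) = false by case: (s) (p (+) q) nsp => [] [].
  by rewrite !linear0 addr0.
apply: span => [||r x]; try by lin.
  by move=> a u v; rewrite scaler0 addr0.
case=> p q b u hb hu er ->; rewrite (tens_diff_pure _ hb) diffD diffZ.
rewrite (tens_diff_pure _ (ndiff_hom hb)) (tens_diff_pure _ hb).
have -> : ndiff B (ndiff B b) = 0 := dg_sq0 dgB b.
rewrite (dg_sq0 dgU) linear0 pure0l !scaler0 add0r addr0.
by case: (p); rewrite /= ?scale1r ?scaleN1r ?subrr // addNr.
Qed.
End Dg.
End TensorDg.

Section TensorOperad.
Variables (k : fieldType) (B : nilcdga k) (sym : bool) (P : preoperad k sym) (oP : isOperad P).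
Local Notation T := (tensop B P).
Let dgP n : isDg (P n). Proof. exact: op_dg. Qed.
Let dgB : isDg (ndg B) := ndgP B.

Lemma tens_circ_pure n m (i : 'I_n) p q (b c : B) (u : P n) (v : P m) :
  part _ p u = u -> npart B q c = c ->
  @circ _ _ T _ _ i (pure b u) (pure c v) = (-1) ^+ (p && q) *: pure (nmul b c) (circ i u v).
Proof.
move=> hu hc; rewrite /= /tens_circ tmul_pure; last first.
- exact: circ_linearr.
- exact: circ_linearl.
have hc' s : npart B s c = if s == q then c else 0 := part_hom dgB s hc.
have b0 : nmul b 0 = 0 := lin0 (nmul_linearr b).
rewrite big_bool /= !hc' -pureZr -(linZ (circ_linearl i v)).
rewrite (sgn_hom (dgP n) hu).
by case: q {hc hc'} => /=; rewrite b0 pure0l ?addr0 ?add0r ?andbT // andbF scale1r.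
Qed.

Lemma castop_pure n m (e : n = m) (b : B) (u : P n) :
  castop e (pure b u : T n) = pure b (castop e u).
Proof. by case: m / e. Qed.

Lemma tens_act_pure n h (s : 'S_n) (b : B) (u : P n) :
  @act _ _ T _ h s (pure b u) = pure b (act h s u).
Proof. by apply/ffunP => i; rewrite !ffunE (linZ (act_linear h s)). Qed.

Lemma nmul_hom p q (b c : B) : npart B p b = b -> npart B q c = c ->
  npart B (p (+) q) (nmul b c) = nmul b c.
Proof. by move=> <- <-; rewrite nmul_part. Qed.
Lemma circ_hom n m (i : 'I_n) p q (u : P n) (v : P m) : part _ p u = u -> part _ q v = v ->
  part _ (p (+) q) (circ i u v) = circ i u v.
Proof. by move=> <- <-; rewrite (circ_part oP). Qed.

(** On elementary tensors each axiom is the axiom of P tensored with a property of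
    the algebra: the Leibniz rule for [circ_diff], associativity for [circ_seq],
    graded commutativity for [circ_par].  The interchange signs are bilinear in the
    parities and match on both sides. *)
Lemma tensop_isOperad : isOperad T.
Proof.
have cl := @circ_linearl _ _ T; have cr := @circ_linearr _ _ T.
apply: (@isOperad_span _ _ T (fun n => @hpure _ B (P n))).
- by move=> n; apply: tensdg_isDg.
- by move=> n r x; apply: hpure_hom.
- by move=> n; apply: hpure_spanning.
- move=> n m i _ _ _ _ [p q b u hb hu -> ->] [p' q' c v hc hv -> ->].
  rewrite (tens_circ_pure _ _ _ hu hc) partZr addbACA.
  by rewrite (tens_part_pure (dgP _) _ (nmul_hom hb hc) (circ_hom i hu hv)) eqxx.
- move=> n m i _ _ _ _ [p q b u hb hu -> ->] [p' q' c v hc hv _ ->].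
  rewrite (tens_circ_pure _ _ _ hu hc) diffZ.
  rewrite (tens_diff_pure _ (nmul_hom hb hc)) (tens_diff_pure _ hb) (tens_diff_pure _ hc).
  rewrite ndiffM (circ_diff oP) (sgn_hom (dgP _) hu).
  have -> : @sgn k (ndg B) b = (-1) ^+ p *: b := sgn_hom dgB hb.
  rewrite (linD (cl _ _ _ _)) (linD (cr _ _ _ _)) (linZ (cl _ _ _ _)) (linZ (cr _ _ _ _)).
  rewrite (linZ (nmul_linearl (ndiff B c))) pureDl pureDr pureZl.
  rewrite (linZ (circ_linearl i _)) pureZr.
  rewrite !(tens_circ_pure _ _ _ hu hc) (tens_circ_pure _ _ _ (diff_hom (dgP _) hu) hc).
  rewrite (tens_circ_pure _ _ _ hu (ndiff_hom hc)) !scalerDr !signZ_addb addrACA.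
  by congr (_ ^+ nat_of_bool _ *: _ + _ ^+ nat_of_bool _ *: _ +
    (_ ^+ nat_of_bool _ *: _ + _ ^+ nat_of_bool _ *: _));
    case: (p) (q) (p') => -[] [].
- move=> n m r i j l a0 b0 c0 u0 v0 w0 e [p q b u hb hu _ ->] [p' q' c v hc hv _ ->].
  case=> p2 q2 d w hd hw _ -> el.
  rewrite (tens_circ_pure _ _ _ hu hc) (tens_circ_pure _ _ _ hv hd).
  rewrite (linZ (cl _ _ _ _)) (linZ (cr _ _ _ _)) (linZ (castop_lin _)).
  rewrite (tens_circ_pure _ _ _ (circ_hom i hu hv) hd) (tens_circ_pure _ _ _ hu (nmul_hom hc hd)).
  rewrite (linZ (castop_lin _)) castop_pure (circ_seq oP _ _ _ _ el) nmulA !signZ_addb.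
  by congr (_ ^+ nat_of_bool _ *: _); case: (q) (q') (p') (p2) => -[] [] [].
- move=> n m r i j j' i' a0 b0 c0 u0 v0 w0 e [p q b u hb hu _ ->] [p' q' c v hc hv -> ->].
  case=> p2 q2 d w hd hw -> -> ij ej ei.
  rewrite (tens_circ_pure _ _ _ hu hc) (tens_circ_pure _ _ _ hu hd).
  rewrite !(linZ (cl _ _ _ _)) (linZ (castop_lin _)).
  rewrite (tens_circ_pure _ _ _ (circ_hom i hu hv) hd) (tens_circ_pure _ _ _ (circ_hom j hu hw) hc).
  have := circ_par oP u v w q' q2 e ij ej ei; rewrite hv hw => E.
  rewrite (linZ (castop_lin _)) castop_pure E pureZr.
  have -> : nmul (nmul b c) d = (-1) ^+ (p' && p2) *: nmul (nmul b d) c.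
    by rewrite -!nmulA -{1}hc -{1}hd nmulC hc hd (linZ (nmul_linearr b)).
  rewrite pureZl !signZ_addb.
  by congr (_ ^+ nat_of_bool _ *: _); case: (q) (q') (p') (p2) (q2) => -[] [] [] [].
- by move=> n h _ _ [p q b u hb hu _ ->]; rewrite tens_act_pure (act1 oP).
- by move=> n h s t _ _ [p q b u hb hu _ ->]; rewrite !tens_act_pure (actM oP).
- move=> n h s _ _ [p q b u hb hu -> ->]; rewrite tens_act_pure.
  have hau : part _ q (act h s u) = act h s u by rewrite -(act_part oP) hu.
  by rewrite (tens_part_pure (dgP _) _ hb hau) eqxx.
- move=> n h s _ _ [p q b u hb hu _ ->]; rewrite tens_act_pure !(tens_diff_pure _ hb).
  rewrite (linD (@act_linear _ _ T _ _ _)) (linZ (@act_linear _ _ T _ _ _)).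
  by rewrite !tens_act_pure (act_diff oP).
move=> n m h s t l r _ _ _ _ [p q b u hb hu _ ->] [p' q' c v hc hv _ ->] r1 r2.
have hau : part _ q (act h s u) = act h s u by rewrite -(act_part oP) hu.
rewrite !tens_act_pure (tens_circ_pure _ _ _ hau hc) (tens_circ_pure _ _ _ hu hc).
by rewrite (linZ (@act_linear _ _ T _ _ _)) tens_act_pure (circ_act oP h u v r1 r2).
Qed.
End TensorOperad.

(** * Nilpotence of the ideal generated by a nullary operation *)

Section Nilpotence.
Variables (k : fieldType) (B : nilcdga k) (two : (2 : k) != 0).
Implicit Types (b c : B).

Definition annihilated j b : Prop := forall s : seq B, size s = j -> foldl (@nmul k B) b s = 0.

Lemma foldl_nmul_linear (s : seq B) : linear (fun b => foldl (@nmul k B) b s).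
Proof. by elim: s => [|c s IH] a u v //=; rewrite nmul_linearl IH. Qed.

Lemma annihilated_lin j a b c : annihilated j b -> annihilated j c -> annihilated j (a *: b + c).
Proof. by move=> hb hc s sj; rewrite foldl_nmul_linear hb // hc // scaler0 addr0. Qed.
Lemma annihilated_le j l b : (j <= l)%N -> annihilated j b -> annihilated l b.
Proof.
move=> jl hb s sl; rewrite -(cat_take_drop j s) foldl_cat hb ?size_takel ?sl //.
exact: (lin0 (foldl_nmul_linear _)).
Qed.
Lemma annihilated_mul j b c : annihilated j b -> annihilated j.-1 (nmul b c).
Proof.
case: j => [|j] hb s sj; last by have := hb (c :: s); rewrite /= sj; apply.
have -> : b = 0 := hb [::] (erefl _).
by rewrite (lin0 (nmul_linearl c)) (lin0 (foldl_nmul_linear s)).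
Qed.

Lemma nsgnM b c : @sgn k (ndg B) (nmul b c) = nmul (@sgn k (ndg B) b) (@sgn k (ndg B) c).
Proof.
have dgB : isDg (ndg B) := ndgP B.
have sL : linear (@sgn k (ndg B)) by exact: sgn_linear.
move: b; apply: (hom_spanning dgB) => [||b [p hb]].
- exact: lin_comp sL (nmul_linearl c).
- exact: lin_comp (nmul_linearl (@sgn k (ndg B) c)) sL.
move: c; apply: (hom_spanning dgB) => [||c [q hc]].
- exact: lin_comp sL (nmul_linearr b).
- exact: lin_comp (nmul_linearr (@sgn k (ndg B) b)) sL.
have hbc : part (ndg B) (p (+) q) (nmul b c : ndg B) = nmul b c := nmul_hom hb hc.
rewrite (sgn_hom dgB hb) (sgn_hom dgB hc) [LHS](sgn_hom dgB hbc).
by rewrite (linZ (nmul_linearl _)) (linZ (nmul_linearr _)) signZ_addb.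
Qed.

Lemma annihilated_sgn j b : annihilated j b -> annihilated j (@sgn k (ndg B) b).
Proof.
move=> hb s sj; have -> : foldl (@nmul k B) (@sgn k (ndg B) b) s
    = @sgn k (ndg B) (foldl (@nmul k B) b (map (@sgn k (ndg B)) s)).
  elim: s b {hb sj} => [|c s IH] b //=; rewrite -IH nsgnM; congr (foldl _ (nmul _ _) _).
  by rewrite sgnK //; exact: ndgP.
by rewrite hb ?size_map //; exact: (lin0 (@sgn_linear _ (ndg B))).
Qed.

Section Filtration.
Variable N : nat.
Hypothesis annN : forall b, annihilated N b.

(** A stand-in for the r-th power of the algebra: multiplication by b shortens by r
    the products needed to reach 0.  The condition is multiplicative by
    associativity alone, and nothing but 0 satisfies it for r > N. *)
Definition filt r b : Prop :=
  (forall j c, annihilated j c -> annihilated (j - r) (nmul c b)) /\ annihilated (N.+1 - r) b.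

Lemma filt_le r r' b : (r' <= r)%N -> filt r b -> filt r' b.
Proof.
move=> rr [h1 h2]; split=> [j c hc|]; last by apply: annihilated_le h2; lia.
by apply: annihilated_le (h1 j c hc); lia.
Qed.
Lemma filt1 b : filt 1 b.
Proof.
split=> [j c hc|]; first by rewrite subn1; apply: annihilated_mul.
by rewrite subn1.
Qed.
Lemma filt_lin r a b c : filt r b -> filt r c -> filt r (a *: b + c).
Proof.
move=> [hb1 hb2] [hc1 hc2]; split=> [j d hd|]; last exact: annihilated_lin.
by rewrite nmul_linearr; apply: annihilated_lin; [apply: hb1|apply: hc1].
Qed.
Lemma filt_mul r r' b c : filt r b -> filt r' c -> filt (r + r') (nmul b c).
Proof.
move=> [hb1 hb2] [hc1 _]; split=> [j d hd|]; last by rewrite subnDA; apply: hc1.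
by rewrite nmulA subnDA; apply: hc1; apply: hb1.
Qed.
Lemma filt_part r q b : filt r b -> filt r (npart B q b).
Proof.
move=> hb; have dgB : isDg (ndg B) := ndgP B.
have hs : filt r (@sgn k (ndg B) b).
  case: hb => h1 h2; split=> [j c hc|]; last exact: annihilated_sgn.
  have -> : nmul c (@sgn k (ndg B) b) = @sgn k (ndg B) (nmul (@sgn k (ndg B) c) b).
    by rewrite nsgnM (@sgnK _ (ndg B) dgB).
  by apply: annihilated_sgn; apply: h1; apply: annihilated_sgn.
have -> : npart B q b = 2^-1 *: ((-1) ^+ q *: (@sgn k (ndg B) b) + b).
  by have := partE dgB two q b; rewrite addrC.
rewrite -[_ *: _]addr0; apply: filt_lin; first exact: filt_lin.
by rewrite -[0](subrr b) addrC -scaleN1r; apply: filt_lin.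
Qed.
Lemma filt_ge r b : (N < r)%N -> filt r b -> b = 0.
Proof. by move=> Nr [_]; move: Nr; rewrite -subn_eq0 => /eqP -> /(_ [::] (erefl _)). Qed.

Inductive tfilt (U : lmodType k) (r : nat) : tens B U -> Prop :=
| tfilt0 : tfilt r 0
| tfilt_pure b (u : U) (x : tens B U) (a : k) : filt r b -> tfilt r x -> tfilt r (a *: pure b u + x).

Lemma tfilt_lin (U : lmodType k) r (a : k) (x y : tens B U) :
  tfilt r x -> tfilt r y -> tfilt r (a *: x + y).
Proof.
move=> hx hy; elim: hx => [|b u x' d hb _ IH]; first by rewrite scaler0 add0r.
by rewrite scalerDr scalerA -addrA; apply: tfilt_pure.
Qed.
Lemma tfilt_pure1 (U : lmodType k) r b (u : U) : filt r b -> tfilt r (pure b u).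
Proof.
by move=> hb; rewrite -[pure _ _]scale1r -[_ *: _]addr0; apply: tfilt_pure => //; apply: tfilt0.
Qed.
Lemma tfilt_sum (U : lmodType k) r (I : finType) (F : I -> tens B U) :
  (forall i, tfilt r (F i)) -> tfilt r (\sum_i F i).
Proof.
move=> hF; apply: (big_ind (tfilt r)) => // [|x y hx hy]; first exact: tfilt0.
by rewrite -[x]scale1r; apply: tfilt_lin.
Qed.
Lemma tfilt1 (U : lmodType k) (x : tens B U) : tfilt 1 x.
Proof. by rewrite [x]tens_decomp; apply: tfilt_sum => i; apply: tfilt_pure1; apply: filt1. Qed.
Lemma tfilt_le (U : lmodType k) r r' (x : tens B U) : (r' <= r)%N -> tfilt r x -> tfilt r' x.
Proof.
move=> rr; elim=> [|b u y c hb _ IH]; first exact: tfilt0.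
by apply: tfilt_pure => //; apply: filt_le hb.
Qed.
Lemma tfilt_ge (U : lmodType k) r (x : tens B U) : (N < r)%N -> tfilt r x -> x = 0.
Proof.
move=> Nr; elim=> // b u y c hb _ ->; rewrite (filt_ge Nr hb).
by rewrite (lin0 (pure_linearl u)) scaler0 addr0.
Qed.

Lemma tfilt_mul (U U' U2 : dgmod k) (h : U -> U' -> U2) r r' (x : tensdg B U) (y : tensdg B U') :
  (forall v, linear (h^~ v)) -> (forall u, linear (h u)) ->
  tfilt r x -> tfilt r' y -> tfilt (r + r') (tmul h x y).
Proof.
move=> hl hr hx hy; elim: hx => [|b u x' d hb _ IH].
  by rewrite (lin0 (tmul_linearl y hl)); apply: tfilt0.
rewrite (tmul_linearl y hl); apply: tfilt_lin => // {IH}.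
elim: hy => [|c v y' d' hc _ IH].
  by rewrite (lin0 (tmul_linearr _ hr)); apply: tfilt0.
rewrite (tmul_linearr _ hr); apply: tfilt_lin => //.
rewrite tmul_pure //; apply: tfilt_sum => q; apply: tfilt_pure1.
by apply: filt_mul => //; apply: filt_part.
Qed.

(** Each occurrence of x contributes a factor from the nilpotent algebra. *)
Lemma xpow_tfilt (sym : bool) (P : preoperad k sym) (x : tensop B P 0%N) r n (a : tensop B P n) :
  xpow x r a -> tfilt r a.
Proof.
elim=> {r n a} [|n a|j n a _ IH|j n|j n d a b _ IHa _ IHb|j l n m' i a b _ IHa _ IHb|j n h s a _ IH].
- exact: tfilt1.
- by apply: tfilt_le (tfilt1 a).
- exact: tfilt_le IH.
- exact: tfilt0.
- exact: tfilt_lin.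
- by apply: tfilt_mul => //; [apply: circ_linearl|apply: circ_linearr].
have aL := @act_linear _ _ (tensop B P) n h s.
elim: IH => [|b u y c hb _ IH]; first by rewrite (lin0 aL); apply: tfilt0.
by rewrite aL tens_act_pure; apply: tfilt_pure.
Qed.
End Filtration.

Lemma xpow_nilpotent (sym : bool) (P : preoperad k sym) (x : tensop B P 0%N) :
  exists N, forall r n (a : tensop B P n), (N <= r)%N -> xpow x r a -> a = 0.
Proof.
have [N annN] := nnil B.
have annN' b : annihilated N b by move=> s; apply: annN.
exists N.+1 => r n a Nr /(xpow_tfilt annN'); exact: tfilt_ge.
Qed.
End Nilpotence.

(** * The Maurer-Cartan series as a substitution of nullary operations *)

Lemma tmap_idE (k : fieldType) (B : nilcdga k) (U U' : lmodType k) (psi : U -> U') (x : tens B U) i :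
  tmap idfun psi x i = psi (x i).
Proof.
have -> : tmap idfun psi x = [ffun j => psi (x j)] by
  rewrite [RHS]tens_decomp; apply: eq_bigr => j _; rewrite ffunE.
by rewrite ffunE.
Qed.

Section Fill.
Variables (k : fieldType) (W : dgmod k) (dgW : isDg W) (two : (2 : k) != 0) (sym : bool).
Local Notation E := (endo W sym).

Lemma endo0_inj : injective (@endo0 k W).
Proof.
move=> f g fg; apply: mlin_ext => -[|w s]; first exact: fg.
by rewrite !mlin_size.
Qed.

Lemma fill_inst n (f : E n.+1) (g : E 0%N) :
  castop (fill_arity n) (circ ord0 f g) = endo_inst f (endo0 g).
Proof.
apply: mlin_ext => s; rewrite castop_mlin /= /endo_circ_fun /guard /endo_inst_fun addn0 /=.
case: eqP => [_|/eqP sn]; last by rewrite mlin_size.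
have slot := mlinear_slot [::] s (mlin_mlinear f); rewrite /= in slot.
rewrite big_bool /= take0 /= drop0 take0 -(linD slot).
congr (mfun f (_ :: s)); rewrite addrC.
exact: (congr1 (fun h : endo_op W 0 => mfun h [::]) (endo_part_sum two g)).
Qed.

Variable B : nilcdga k.
Local Notation T := (tensop B E).
(** A nullary operation of the endomorphism operad is an element of W; this is the
    identification after tensoring with B. *)
Definition tvalue : tensdg B (endo_op W 0) -> tensdg B W := tmap idfun (@endo0 k W).

Lemma tvalue_linear : linear tvalue.
Proof. exact: linearP. Qed.
Lemma tvalue_inj : injective tvalue.
Proof.
by move=> x y xy; apply/ffunP => i; apply: endo0_inj; rewrite -!tmap_idE; congr (_ _ i).
Qed.

(** Inserting x successively in the first slot evaluates the first argument each
    time; no Koszul sign arises from the slots because nothing stands in front of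
    the first one. *)
Lemma fill_mulext n (y : T n) (x : T 0%N) : tvalue (fill y x) = mulext y (nseq n (tvalue x)).
Proof.
elim: n y => [//|n IH] y /=; rewrite IH; congr mulext.
have castL := @castop_lin _ _ T _ _ (fill_arity n).
rewrite [LHS](lin_sum _ _ _ castL); apply: eq_bigr => i _.
rewrite [LHS](lin_sum _ _ _ castL); apply: eq_bigr => j _.
rewrite [LHS](lin_sum _ _ _ castL); apply: eq_bigr => q _.
by rewrite [LHS]castop_pure /tvalue tmap_idE -fill_inst.
Qed.

Lemma mulextN n (y : tensdg B (endo_op W n)) xs : mulext (- y) xs = - mulext y xs.
Proof.
elim: n y xs => [|n IH] y xs /=; first by rewrite linearN.
rewrite -IH; congr mulext.
have hl v : linear ((@endo_inst k W n)^~ v) by move=> a f g; apply: mlin_ext.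
exact: (linN (tmul_linearl _ hl)).
Qed.

Lemma endo0_part p (f : endo_op W 0) : endo0 (part _ p f) = part W p (endo0 f).
Proof. by rewrite /endo0 endo_partE /= -(partE dgW two). Qed.
Lemma endo0_diff (f : endo_op W 0) : endo0 (diff _ f) = diff W (endo0 f).
Proof. by rewrite /endo0 /= /endo_diff_fun /guard /= big_ord0 subr0. Qed.

Lemma tvalue_part p x : tvalue (part _ p x) = part (tensdg B W) p (tvalue x).
Proof.
rewrite /= /tens_part /tvalue linear_sum; apply: eq_bigr => q _.
rewrite [LHS]tmap_comp [RHS]tmap_comp; apply: eq_bigr => i _.
by congr (pure _ _); apply: endo0_part.
Qed.
Lemma tvalue_diff x : tvalue (diff _ x) = diff (tensdg B W) (tvalue x).
Proof.
rewrite /= /tens_diff /tvalue linearD; congr (_ + _);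
  rewrite [LHS]tmap_comp [RHS]tmap_comp; apply: eq_bigr => i _ //.
by congr (pure _ _); apply: endo0_diff.
Qed.
End Fill.

(** * Morphisms into inverse limits of operads *)

Section Morphisms.
Variables (k : fieldType) (sym : bool).

Lemma dgmor_comp_part (U V W : dgmod k) (f : dgmor V W) (g : dgmor U V) p u :
  (f \o g) (part U p u) = part W p ((f \o g) u).
Proof. by rewrite /= !dgmor_part. Qed.
Lemma dgmor_comp_diff (U V W : dgmod k) (f : dgmor V W) (g : dgmor U V) u :
  (f \o g) (diff U u) = diff W ((f \o g) u).
Proof. by rewrite /= !dgmor_diff. Qed.
Definition dgmor_comp (U V W : dgmod k) (f : dgmor V W) (g : dgmor U V) : dgmor U W :=
  @DgMor k U W (f \o g) (dgmor_comp_part f g) (dgmor_comp_diff f g).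

Lemma opmor_comp_circ (P Q R : preoperad k sym) (f : opmor Q R) (g : opmor P Q)
    n m (i : 'I_n) (a : P n) (b : P m) :
  dgmor_comp (f _) (g _) (circ i a b) = circ i (dgmor_comp (f _) (g _) a) (dgmor_comp (f _) (g _) b).
Proof. by rewrite /= !opmor_circ. Qed.
Lemma opmor_comp_act (P Q R : preoperad k sym) (f : opmor Q R) (g : opmor P Q)
    n h (s : 'S_n) (a : P n) :
  dgmor_comp (f _) (g _) (act h s a) = act h s (dgmor_comp (f _) (g _) a).
Proof. by rewrite /= !opmor_act. Qed.
Definition opmor_comp (P Q R : preoperad k sym) (f : opmor Q R) (g : opmor P Q) : opmor P R :=
  OpMor (opmor_comp_circ f g) (opmor_comp_act f g).

Lemma eval_mor G (P Q : preoperad k sym) (F : opmor P Q) (g : forall n, G n -> P n) n (t : term k sym G n) :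
  F n (eval g t) = eval (fun n x => F n (g n x)) t.
Proof.
elim: t => {n} [n x|n|n s IHs t IHt|n c t IH|n p t IH|n t IH|n m i s IHs t IHt|n h s t IH] //=.
- exact: linear0.
- by rewrite linearD IHs IHt.
- by rewrite linearZ IH.
- by rewrite dgmor_part IH.
- by rewrite dgmor_diff IH.
- by rewrite opmor_circ IHs IHt.
- by rewrite opmor_act IH.
Qed.

Lemma eq_eval G (P : preoperad k sym) (g g' : forall n, G n -> P n) n (t : term k sym G n) :
  (forall n x, g n x = g' n x) -> eval g t = eval g' t.
Proof.
move=> gg'; elim: t => {n} [n x|n|n s IHs t IHt|n c t IH|n p t IH|n t IH|n m i s IHs t IHt|n h s t IH] //=;
  by rewrite ?IHs ?IHt ?IH.
Qed.

Section Lim.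
Variables (I : Type) (le : I -> I -> Prop) (P : I -> preoperad k sym).
Variable tr : forall i j, le i j -> opmor (P j) (P i).
Local Notation L := (limop tr).

Section Proj.
Variable i : I.
Definition lim_proj_fun n (x : L n) : P i n := proj x i.
Lemma lim_proj_linear n : linear (@lim_proj_fun n).
Proof. by []. Qed.
HB.instance Definition _ n :=
  GRing.isLinear.Build k (L n) (P i n) *:%R (@lim_proj_fun n) (@lim_proj_linear n).
Definition lim_proj : opmor L (P i) :=
  @OpMor _ _ L (P i) (fun n => @DgMor k (L n) (P i n) (@lim_proj_fun n)
    (fun _ _ => erefl) (fun _ => erefl)) (fun _ _ _ _ _ => erefl) (fun _ _ _ _ => erefl).
End Proj.

Section Lift.
Variables (Q : preoperad k sym) (F : forall i, opmor Q (P i)).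
Hypothesis F_compat : forall i j (h : le i j) n (a : Q n), tr h n (F j n a) = F i n a.

Definition lim_lift_fun n (a : Q n) : L n :=
  @InvLim k I le (fun i => P i n) (fun i j h => tr h n) (fun i => F i n a) (fun i j h => F_compat h a).
Lemma lim_lift_linear n : linear (@lim_lift_fun n).
Proof. by move=> c a b; apply: invlim_ext => i /=; rewrite linearP. Qed.
HB.instance Definition _ n :=
  GRing.isLinear.Build k (Q n) (L n) *:%R (@lim_lift_fun n) (@lim_lift_linear n).
Lemma lim_lift_part n p (a : Q n) : lim_lift_fun (part _ p a) = part (L n) p (lim_lift_fun a).
Proof. by apply: invlim_ext => i /=; rewrite dgmor_part. Qed.
Lemma lim_lift_diff n (a : Q n) : lim_lift_fun (diff _ a) = diff (L n) (lim_lift_fun a).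
Proof. by apply: invlim_ext => i /=; rewrite dgmor_diff. Qed.
Lemma lim_lift_circ n m (l : 'I_n) (a : Q n) (b : Q m) :
  lim_lift_fun (circ l a b) = @circ _ _ L _ _ l (lim_lift_fun a) (lim_lift_fun b).
Proof. by apply: invlim_ext => i /=; rewrite opmor_circ. Qed.
Lemma lim_lift_act n h (s : 'S_n) (a : Q n) :
  lim_lift_fun (act h s a) = @act _ _ L _ h s (lim_lift_fun a).
Proof. by apply: invlim_ext => i /=; rewrite opmor_act. Qed.
Definition lim_lift : opmor Q L :=
  @OpMor _ _ Q L (fun n => @DgMor k (Q n) (L n) (@lim_lift_fun n) (@lim_lift_part n) (@lim_lift_diff n))
    lim_lift_circ lim_lift_act.
End Lift.
End Lim.
End Morphisms.

(** * Continuous morphisms out of a completed free adjunction *)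

Section Adjoin.
Variables (k : fieldType) (sym : bool) (O : preoperad k sym).
Variables (m : forall n, O n.+1) (c : nat -> k).
Local Notation Ox := (adjoin m c).

Definition adjoin_incl : opmor O Ox :=
  @lim_lift _ _ _ _ (trunc m c) (@trunc_map _ _ _ m c) O (trunc_incl m c)
    (fun i j h n a => adjoin_compat m c (Old a) h).

Lemma adjoin_x_even : part _ false (adjoin_x m c) = adjoin_x m c.
Proof. by apply: invlim_ext => N; have [i _ []] := trunc_relT m c N. Qed.

(** The relation imposed on x in O[x]/(x^N), read in the completion: the series for
    d x converges. *)
Lemma adjoin_x_diff N r : (N <= r)%N ->
  proj (diff _ (adjoin_x m c) - \sum_(n < r) c n.+1 *: fill (adjoin_in m c (m n)) (adjoin_x m c)) N = 0.
Proof.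
move=> Nr; apply/eqP; rewrite subr_eq0; apply/eqP.
have [i iE [_ _ /(_ r Nr) d]] := trunc_relT m c N.
rewrite [LHS]d -[RHS]/(lim_proj (@trunc_map _ _ _ m c) N 0%N _) linear_sum.
apply: eq_bigr => n _; rewrite linearZ; congr (_ *: _).
by rewrite fill_mor /= iE.
Qed.

(** The suboperad generated by O and x is dense, because every element of
    O[x]/(x^N) is the class of a term. *)
Lemma adjoin_dense n (a : Ox n) N :
  exists t : term k sym (adjgen O) n, proj a N = proj (eval (@adjoin_gen _ _ _ m c) t) N.
Proof.
exists (rep (proj a N)).
rewrite -[RHS]/(lim_proj (@trunc_map _ _ _ m c) N n _) eval_mor.
apply: pres_ext => P g oP Pg.
rewrite -[RHS]/(pres_mor oP Pg n _) eval_mor /pres_eval.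
by apply: eq_eval => l x; rewrite [RHS]pres_mor_gen.
Qed.

(** By continuity, both morphisms factor at each stage i through some O[x]/(x^N),
    where density applies. *)
Lemma adjoin_mor_unique (I : Type) (le : I -> I -> Prop) (P : I -> preoperad k sym)
    (tr : forall i j, le i j -> opmor (P j) (P i)) (F G : topOpmor Ox (limop tr)) :
  (forall n (a : O n), F n (adjoin_in m c a) = G n (adjoin_in m c a)) ->
  F 0%N (adjoin_x m c) = G 0%N (adjoin_x m c) -> forall n (a : Ox n), F n a = G n a.
Proof.
move=> Fin Fx n a; apply: invlim_ext => i.
have [N1 c1] := top_opmor_continuous F n i; have [N2 c2] := top_opmor_continuous G n i.
have [t at_] := adjoin_dense a (maxn N1 N2).
set b := eval _ t in at_; have low N' : (N' <= maxn N1 N2)%N -> proj (a - b) N' = 0.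
  move=> h; rewrite -(proj_compat (a - b) h) [proj _ _](_ : _ = 0) ?linear0 //.
  by apply/eqP; rewrite [_ == _]subr_eq0 at_.
have Fab : proj (F n (a - b)) i = 0 by apply: c1; apply: low; rewrite leq_maxl.
have Gab : proj (G n (a - b)) i = 0 by apply: c2; apply: low; rewrite leq_maxr.
have Fb : F n b = G n b by rewrite /b !eval_mor; apply: eq_eval => l -[].
move/eqP: Fab; move/eqP: Gab; rewrite !linearB !subr_eq0 => /eqP -> /eqP ->.
by rewrite Fb.
Qed.

Definition adj_interp (P : preoperad k sym) (phi : opmor O P) (x : P 0%N) n (t : adjgen O n) : P n :=
  match t in adjgen _ n return P n with Old n a => phi n a | New => x end.

Section Extend.
Variables (I : Type) (le : I -> I -> Prop) (P : I -> preoperad k sym).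
Variable tr : forall i j, le i j -> opmor (P j) (P i).
Variables (phi : opmor O (limop tr)) (x : limop tr 0%N).
Hypothesis oP : forall i, isOperad (P i).
Hypothesis phi_trunc : forall i, exists N, isTrunc m c N (opmor_comp (lim_proj tr i) phi) (proj x i).

(** At each stage i the universal property of O[x]/(x^N) gives a morphism, with N
    depending on i.  Two stages are compared on O[x]/(x^M) for a common bound M of
    their exponents, where morphisms are determined by the generators.  Factoring
    through O[x]/(x^N) is what makes the limit continuous. *)
Lemma adjoin_extend : exists F : topOpmor Ox (limop tr),
  (forall n (a : O n), F n (adjoin_in m c a) = phi n a) /\ F 0%N (adjoin_x m c) = x.
Proof.
have [Nf HN] := choice phi_trunc.
pose phi_ i := opmor_comp (lim_proj tr i) phi.
pose g i := adj_interp (phi_ i) (proj x i).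
have Hg i N : (Nf i <= N)%N -> relT m c N (g i).
  by move=> h; apply: relT_le h _ _ _; exists (phi_ i) => //; apply: HN.
pose F_ i : opmor Ox (P i) :=
  opmor_comp (pres_mor (oP i) (Hg i _ (leqnn _))) (lim_proj (@trunc_map _ _ _ m c) (Nf i)).
have F_compat i j (h : le i j) n (a : Ox n) : tr h n (F_ j n a) = F_ i n a.
  pose M := maxn (Nf i) (Nf j).
  have hi : (Nf i <= M)%N := leq_maxl _ _; have hj : (Nf j <= M)%N := leq_maxr _ _.
  pose G1 := opmor_comp (tr h) (opmor_comp (pres_mor (oP j) (Hg j _ (leqnn _))) (trunc_map m c hj)).
  pose G2 := opmor_comp (pres_mor (oP i) (Hg i _ (leqnn _))) (trunc_map m c hi).
  have E : G1 n (proj a M) = G2 n (proj a M).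
    have gi := Hg i M hi.
    rewrite (pres_mor_unique (oP i) gi (f := G1)) => [|l t].
      rewrite (pres_mor_unique (oP i) gi (f := G2)) // => l t.
      transitivity (pres_mor (oP i) (Hg i _ (leqnn _)) l (trunc_map m c hi l (pgen (@relT _ _ _ m c M) t))).
        by [].
      by rewrite adjoin_compat pres_mor_gen.
    transitivity (tr h l (pres_mor (oP j) (Hg j _ (leqnn _)) l
      (trunc_map m c hj l (pgen (@relT _ _ _ m c M) t)))); first by [].
    rewrite adjoin_compat pres_mor_gen.
    by case: t => [l' b|]; apply: proj_compat.
  by have := E; rewrite /= -!/(trunc_map m c _ n _) !(proj_compat a).
pose F0 := lim_lift F_compat.
have F0c n (i : nbh_index (limop tr)) : exists N : nbh_index Ox,
    forall a : Ox n, nbh N a -> nbh i (F0 n a).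
  exists (Nf i) => a a0.
  exact: etrans (congr1 (pres_mor (oP i) (Hg i _ (leqnn _)) n) a0) (linear0 _).
exists (@TopOpMor _ _ Ox (limop tr) F0 F0c); split=> [n a|]; apply: invlim_ext => i /=.
  exact: (pres_mor_gen (oP i) (Hg i _ (leqnn _)) (Old a)).
exact: (pres_mor_gen (oP i) (Hg i _ (leqnn _)) (New O)).
Qed.
End Extend.
End Adjoin.

(** * Maurer-Cartan elements and operad maps *)

Lemma Pi_isDg (k : fieldType) (V : dgmod k) : isDg V -> isDg (Pi V).
Proof.
move=> dgV; split=> /= [p q v|v|p v|v].
- by rewrite (dg_partK dgV); case: p; case: q.
- by rewrite addrC (dg_part_sum dgV).
- by rewrite /pi_diff (dg_odd dgV) linearN.
- by rewrite /pi_diff linearN (dg_sq0 dgV) !oppr0.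
Qed.

Section Constant.
Variables (k : fieldType) (W : dgmod k).
Lemma constant_multilinear (w : W) : guard 0 (fun=> w) \in @multilinear k W 0.
Proof. by apply: guard_multilinear. Qed.
(** The inverse of the evaluation [endo0] of nullary operations. *)
Definition constant (w : W) : endo_op W 0 := MLin (constant_multilinear w).
Lemma constant_linear : linear constant.
Proof. by move=> a u v; apply: mlin_ext => -[|x s] //; rewrite !mlin_size. Qed.
HB.instance Definition _ := GRing.isLinear.Build k W (endo_op W 0) *:%R constant constant_linear.
End Constant.

Section MaurerCartan.
Variables (k : fieldType) (A : formalCdga k) (V : dgvect k) (two : (2 : k) != 0).
Variables (sym : bool) (O : preoperad k sym) (m : forall n, O n.+1) (c : nat -> k).
Local Notation W := (Pi V).
Local Notation E := (endo W sym).
Let dgW : isDg W := Pi_isDg (dgvectP V).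

Definition cvalue : ctens A (endo_op W 0) -> ctens A W := ctens_map (@endo0 k W).

Lemma cvalue_inj : injective cvalue.
Proof.
move=> x y xy; apply: invlim_ext => i; apply: tvalue_inj.
exact: (congr1 (fun z : ctens A W => proj z i) xy).
Qed.

Lemma cvalueK (xi : ctens A W) : cvalue (ctens_map (@constant k W) xi) = xi.
Proof. by apply: invlim_ext => i; apply/ffunP => j; rewrite /= !tmap_idE. Qed.

(** The structure maps are the negatives of the images of the m_n, so the
    Maurer-Cartan equation says that d x is the series of the substitutions of x in
    the m_n: the relation imposed on x in O[x]/(x^N), for partial sums of large
    length. *)
Lemma isMC_fill (f : alg_structure A V (discrete O)) (x : ctens A (endo_op W 0)) :
  isMC m c f (cvalue x) <->
  part _ false x = x /\
  forall i, exists N, forall r, (N <= r)%N ->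
    diff (tensop (falg i) E 0%N) (proj x i) =
    \sum_(n < r) c n.+1 *: fill (proj (f n.+1 (m n)) i : tensop (falg i) E _) (proj x i).
Proof.
have partE : part _ false (cvalue x) = cvalue x <-> part _ false x = x.
  have cp : part _ false (cvalue x) = cvalue (part _ false x).
    by apply: invlim_ext => i; rewrite [RHS](tvalue_part dgW two).
  by rewrite cp; split=> [/cvalue_inj|->].
have eqE i r : (diff _ (proj (cvalue x) i) + \sum_(n < r) c n.+1 *:
      mulext (proj (structure_map m f n) i) (nseq n.+1 (proj (cvalue x) i)) = 0) <->
    (diff (tensop (falg i) E 0%N) (proj x i) =
    \sum_(n < r) c n.+1 *: fill (proj (f n.+1 (m n)) i : tensop (falg i) E _) (proj x i)).
  have -> : diff _ (proj (cvalue x) i) = tvalue (diff (tensop (falg i) E 0%N) (proj x i)).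
    by rewrite [RHS]tvalue_diff.
  have -> : \sum_(n < r) c n.+1 *: mulext (proj (structure_map m f n) i) (nseq n.+1 (proj (cvalue x) i))
      = - tvalue (\sum_(n < r) c n.+1 *: fill (proj (f n.+1 (m n)) i : tensop (falg i) E _) (proj x i)).
    rewrite (lin_sum _ _ _ (@tvalue_linear _ W (falg i))) -sumrN; apply: eq_bigr => n _.
    rewrite (linZ (@tvalue_linear _ W (falg i))) (fill_mulext two) -scalerN; congr (_ *: _).
    exact: mulextN.
  split=> [/eqP|->]; last by rewrite subrr.
  by rewrite subr_eq0 => /eqP/tvalue_inj.
split=> -[/partE px H]; split=> // i; have [N HN] := H i; exists N => r Nr; apply/eqE; exact: HN.
Qed.

(** N must bound both the nilpotence at stage i and the length after which the
    Maurer-Cartan sums are constant. *)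
Lemma mc_extend (f : alg_structure A V (discrete O)) (xi : ctens A W) : isMC m c f xi ->
  exists2 F : alg_structure A V (adjoin m c), restricts_to F f xi &
    forall G : alg_structure A V (adjoin m c), restricts_to G f xi ->
      forall n (a : adjoin m c n), G n a = F n a.
Proof.
pose x := ctens_map (@constant k W) xi.
rewrite -[xi]cvalueK -/x => /isMC_fill[x_even x_diff].
have oP (i : fidx A) : isOperad (tensop (falg i) E).
  by apply: tensop_isOperad; apply: endo_isOperad.
have phi_trunc i : exists N, isTrunc m c N (opmor_comp (lim_proj
    (fun i j (h : fle i j) => tensop_mor (@ftr _ A i j h) E) i) f) (proj x i).
  have [N1 H1] := xpow_nilpotent two (proj x i : tensop (falg i) E 0%N).
  have [N2 H2] := x_diff i.
  exists (maxn N1 N2); split=> [|r n a|r]; rewrite ?geq_max.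
  - by rewrite -[in RHS]x_even.
  - by case/andP=> N1r _; apply: H1.
  by case/andP=> _ N2r; apply: H2.
have [F [Fin Fx]] := adjoin_extend oP phi_trunc.
exists F; first by split=> //; rewrite Fx.
move=> G [Gin Gx]; apply: adjoin_mor_unique => [n a|]; first by rewrite Gin Fin.
by apply: cvalue_inj; rewrite Fx.
Qed.

(** Continuity at stage i provides the N after which the image of the series for d x
    is constant there. *)
Lemma mc_restrict (F : alg_structure A V (adjoin m c)) :
  exists (f : alg_structure A V (discrete O)) (xi : ctens A W), restricts_to F f xi /\ isMC m c f xi.
Proof.
pose f0 : opmor O (ctensop A E) := opmor_comp F (adjoin_incl m c).
have f0c n (j : nbh_index (ctensop A E)) : exists i : nbh_index (discrete O),
    forall a : discrete O n, nbh i a -> nbh j (f0 n a).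
  by exists tt => a ->; rewrite linear0.
pose f : alg_structure A V (discrete O) := @TopOpMor _ _ (discrete O) (ctensop A E) f0 f0c.
exists f, (cvalue (F 0%N (adjoin_x m c))); split; first by split.
apply/isMC_fill; split=> [|i]; first by rewrite -dgmor_part adjoin_x_even.
have [N HN] := top_opmor_continuous F 0%N i; exists N => r Nr.
have := HN _ (adjoin_x_diff m c Nr).
rewrite /nbh /= linearB dgmor_diff => /eqP.
rewrite [_ == _]subr_eq0 => /eqP E0; rewrite [LHS]E0.
pose tr := (fun i j (h : fle i j) => tensop_mor (@ftr _ A i j h) E).
rewrite -[LHS]/(lim_proj tr i 0%N _) !linear_sum; apply: eq_bigr => n _.
rewrite !linearZ; congr (_ *: _).
exact: (fill_mor (opmor_comp (lim_proj tr i) F) (adjoin_in m c (m n)) (adjoin_x m c)).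
Qed.
End MaurerCartan.

Theorem theorem2p3 (k : fieldType) (char0 : [pchar k]%R =i pred0)
    (A : formalCdga k) (V : dgvect k) :
  ((forall (f : alg_structure A V (discrete (Linf k))) (xi : ctens A (Pi V)),
      isMC (@mL k) (@coefL k) f xi ->
      exists2 F : alg_structure A V (sLinf k),
        restricts_to F f xi &
        forall G : alg_structure A V (sLinf k), restricts_to G f xi ->
          forall n (a : sLinf k n), G n a = F n a) /\
   (forall F : alg_structure A V (sLinf k),
      exists (f : alg_structure A V (discrete (Linf k))) (xi : ctens A (Pi V)),
        restricts_to F f xi /\ isMC (@mL k) (@coefL k) f xi)) /\
  ((forall (f : alg_structure A V (discrete (Ainf k))) (xi : ctens A (Pi V)),
      isMC (@mA k) (@coefA k) f xi ->
      exists2 F : alg_structure A V (sAinf k),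
        restricts_to F f xi &
        forall G : alg_structure A V (sAinf k), restricts_to G f xi ->
          forall n (a : sAinf k n), G n a = F n a) /\
   (forall F : alg_structure A V (sAinf k),
      exists (f : alg_structure A V (discrete (Ainf k))) (xi : ctens A (Pi V)),
        restricts_to F f xi /\ isMC (@mA k) (@coefA k) f xi)).

Proof.
have two : (2 : k) != 0 by have /pcharf0P -> := char0.
by split; split=> *; [apply: mc_extend|apply: mc_restrict|apply: mc_extend|apply: mc_restrict].
Qed.
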